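(* Let $M\ge 2$, let $S=\{i_1,\ldots,i_M\}\subset\mathbb{R}$ with $i_1<\cdots<i_M$, and let $\underline p=(p_1,\ldots,p_M)$ be a probability mass function over $S$ with $\min_j p_j>0$ and expected value $e_0=\sum_{j=1}^M i_jp_j$. For any specified (deterministic) $t>0$ there exists a CMRW process $X$ with state space $S$ (see context) such that $$\mathbb{P}(X_t=i_j\mid X_0=e_0)=p_j,\qquad j=1,\ldots,M.$$
   Context: CMRW (continuous time Markov martingale random walk on the finite state space $S=\{i_1<\cdots<i_M\}$): a martingale that is a time homogeneous continuous time Markov chain for which there exists $\underline\lambda=(\lambda_1,\ldots,\lambda_M)\in\{0\}\times\mathbb{R}_+^{M-2}\times\{0\}$ such that: (1) $\mathbb{P}(X_{s+u}=i_j\ \forall\,0\le u\le v\mid X_s=i_j)=e^{-\lambda_jv}$ for all $v\ge0$, $j=1,\ldots,M$; (2) for $j=2,\ldots,M-1$, $\lim_{h\to0}\frac1h\mathbb{P}(X_{s+h}=i_{j+1}\mid X_s=i_j)=\frac{i_j-i_{j-1}}{i_{j+1}-i_{j-1}}\lambda_j$ and $\lim_{h\to0}\frac1h\mathbb{P}(X_{s+h}=i_{j-1}\mid X_s=i_j)=\frac{i_{j+1}-i_j}{i_{j+1}-i_{j-1}}\lambda_j$; (3) if the initial value $y$ lies in $(i_{j-1},i_j)$, the process immediately jumps at time $0$: $\mathbb{P}(X_{0+}=i_j\mid X_0=y)=\frac{y-i_{j-1}}{i_j-i_{j-1}}$, $\mathbb{P}(X_{0+}=i_{j-1}\mid X_0=y)=\frac{i_j-y}{i_j-i_{j-1}}$.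 *)

(* Defs.v *)
From HB Require Import structures.
From mathcomp Require Import all_boot all_order all_algebra.
From mathcomp Require Import all_classical all_reals all_analysis.

Set Implicit Arguments.
Unset Strict Implicit.
Unset Printing Implicit Defensive.

Import Order.TTheory GRing.Theory Num.Theory.
Import numFieldNormedType.Exports.

Local Open Scope classical_set_scope.
Local Open Scope ring_scope.

Section Processes.
Context {d : measure_display} {T : measurableType d} {R : realType}.
Variable P : probability T R.

(* P(A | B), meaningful only when 0 < P B (it is 0 when P B = 0); [P] is
   unconstrained on non-measurable sets, so A and B must be measurable too. *)
Definition cond_prob (A B : set T) : R := fine (P (A `&` B)) / fine (P B).

(* Processes are indexed by R, but only the times s >= 0 are constrained. *)
Variable X : R -> {RV P >-> R}.

Definition at_state (s x : R) : set T := [set w | X s w = x].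

Definition stays_at (s v x : R) : set T :=
  [set w | forall u, 0 <= u <= v -> X (s + u) w = x].

(* The event X_{0+} = x. *)
Definition starts_right_at (x : R) : set T :=
  [set w | X h w @[h --> 0^'+] --> x].

Definition natural_filtration (s : R) : set (set T) :=
  <<s \bigcup_(r in [set r : R | 0 <= r <= s])
        preimage_set_system setT (X r) measurable >>.

(* For u >= s, E[X_u | F_s] = X_s a.s., where F is the natural filtration. *)
Definition martingale : Prop :=
  (forall s, 0 <= s -> P.-integrable setT (EFin \o X s)) /\
  (forall s u, 0 <= s -> s <= u ->
    forall A, natural_filtration s A ->
      (\int[P]_(w in A) (X u w)%:E = \int[P]_(w in A) (X s w)%:E)%E).

Section StateSpace.
Variables (M : nat) (i : 'I_M -> R).

(* The initial value is allowed to lie outside the state space. *)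
Definition has_state_space : Prop :=
  forall s, 0 < s -> forall w, exists j, X s w = i j.

(* At time 0 the past is trivial given X_0, so conditioning on states of S
   loses nothing even if X_0 is not in S. *)
Definition markov_property : Prop :=
  forall s u, 0 <= s -> 0 <= u ->
  forall A, natural_filtration s A ->
  forall j k, (0 < P (A `&` at_state s (i j)))%E ->
    cond_prob (at_state (s + u) (i k)) (A `&` at_state s (i j)) =
    cond_prob (at_state (s + u) (i k)) (at_state s (i j)).

Definition time_homogeneous : Prop :=
  forall s s' u, 0 <= s -> 0 <= s' -> 0 <= u ->
  forall j k,
    (0 < P (at_state s (i j)))%E -> (0 < P (at_state s' (i j)))%E ->
    cond_prob (at_state (s + u) (i k)) (at_state s (i j)) =
    cond_prob (at_state (s' + u) (i k)) (at_state s' (i j)).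

Definition holding_times (lambda : 'I_M -> R) : Prop :=
  forall s v, 0 <= s -> 0 <= v ->
  forall j, (0 < P (at_state s (i j)))%E ->
    measurable (stays_at s v (i j)) /\
    cond_prob (stays_at s v (i j)) (at_state s (i j)) = expR (- (lambda j * v)).

(* a, j, b are consecutive indices, so j is an interior one. *)
Definition jump_rates (lambda : 'I_M -> R) : Prop :=
  forall s, 0 <= s ->
  forall a j b : 'I_M, j = a.+1 :> nat -> b = j.+1 :> nat ->
  (0 < P (at_state s (i j)))%E ->
    (h^-1 * cond_prob (at_state (s + h) (i b)) (at_state s (i j))
       @[h --> 0^'+] --> (i j - i a) / (i b - i a) * lambda j) /\
    (h^-1 * cond_prob (at_state (s + h) (i a)) (at_state s (i j))
       @[h --> 0^'+] --> (i b - i j) / (i b - i a) * lambda j).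

Definition initial_jump (y : R) : Prop :=
  forall a b : 'I_M, b = a.+1 :> nat -> i a < y < i b ->
    [/\ measurable (starts_right_at (i a)),
        measurable (starts_right_at (i b)),
        cond_prob (starts_right_at (i b)) (at_state 0 y) =
          (y - i a) / (i b - i a) &
        cond_prob (starts_right_at (i a)) (at_state 0 y) =
          (i b - y) / (i b - i a)].

(* lambda in {0} x R_+^(M-2) x {0} *)
Definition rate_vector (lambda : 'I_M -> R) : Prop :=
  (forall j, 0 <= lambda j) /\
  (forall j : 'I_M, j = 0%N :> nat \/ j = M.-1 :> nat -> lambda j = 0).

(* [X] is a continuous time Markov martingale random walk on the state space
   {i_1 < ... < i_M} with initial value y, i.e. X_0 = y almost surely. *)
Definition CMRW (y : R) : Prop :=
  [/\ P (at_state 0 y) = 1%E, has_state_space, martingale,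
      markov_property /\ time_homogeneous &
      exists lambda : 'I_M -> R,
        [/\ rate_vector lambda, holding_times lambda, jump_rates lambda &
            initial_jump y]].

End StateSpace.
End Processes.

(* Main.v *)
Require Import Defs.
From HB Require Import structures.
From mathcomp Require Import all_boot all_order all_algebra.
From mathcomp Require Import all_classical all_reals all_analysis.
From mathcomp Require Import measurable_realfun ring lra.
Import Order.TTheory GRing.Theory Num.Theory.
Import numFieldNormedType.Exports.

(** The process moves along S by jumps to neighbouring states: from an interior state
    i_j it leaves at rate proportional to a number theta_j and chooses the side so that
    its mean does not move, and the two extreme states are absorbing. Its generator is
    diag(theta) L, where L is the symmetric second difference matrix [lapl] of the
    points i_1 < ... < i_M. The rate numbers theta are the unknowns: there is one for
    each interior state, and the law at time t has to be p.

    Choice of theta. The chain starts from the law with mean e0 on the two states around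
    e0, which has smaller call prices sum_k law_k (i_k - i_l)^+ than p at every interior
    strike. Let W_l be the price under p minus the price under the law at time t. If all
    W_l vanish, the law at time t is p, because two laws with one mean and the same call
    prices are equal. Existence of such a theta is a fixed point problem. Its
    topological input is [simplex_equilibrium]: a continuous W on a simplex has a point
    x at which every coordinate with x_l > 0 maximises W. This statement is equivalent
    to Brouwer's theorem and is obtained here from Scarf's combinatorial lemma [scarf].
    It is applied with theta_l = K x_l at interior l; the two end coordinates are slack,
    and there W is 0 whatever x is. If a slack coordinate is positive, then W <= 0
    everywhere, and since W_l > 0 at an interior l with theta_l = 0, all of W is 0. If
    both are zero, W is maximal at each l with theta_l > 0, so its second difference p_l
    - law_l there is nonpositive, and sum_l theta_l law_l^2 >= K (min p)^2. But t times
    this energy has a bound that does not involve theta ([energy_bound]): the energy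
    decreases since L is negative semidefinite, it is at most the total flow sum_l
    theta_l law_l, and the flow at l is the derivative of the call price at strike l,
    which never exceeds i_M - i_1. For K large this is a contradiction ([exists_rates]).

    Construction of the process. The semigroup of the generator is an exponential
    series, written in the uniformised form in which its entries are visibly nonnegative
    ([semigroup]). For a countable dense set of times it prescribes consistent
    finite-dimensional laws, and these are realised on the unit interval by subdividing
    it into nested intervals ([word_process]). On a bounded time interval the expected
    number of changes along any finite set of these times is at most the uniformisation
    rate times the length, so almost every path has limits from the right at all real
    times simultaneously ([pr_regular], [few_changes_right_limit]). The process of these
    limits is right-continuous and Markov with respect to its own past ([jump_process]).
    Finally X is e0 at time 0 and the state reached at later times. Holding times come
    from the probability that the chain sits in j at the N-th parts of an interval,
    which is P_{v/N}(j,j)^N and tends to exp(Q_jj v); jump rates from the derivative of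
    the semigroup at 0; the martingale property from the fact that the semigroup fixes
    the vector of the i_j. *)

Set Implicit Arguments.
Unset Strict Implicit.
Unset Printing Implicit Defensive.

(** * Scarf's combinatorial lemma *)

Section FiniteSets.
Import mathcomp.boot.fintype mathcomp.boot.finset.

(** A set with one element more than its image has exactly one pair that collides; the
    last clause expresses that only a and b can be removed without shrinking the image. *)
Lemma one_collision (X Y : finType) (f : X -> Y) (A : {set X}) :
  #|A| = #|f @: A|.+1 ->
  exists a b, [/\ a \in A, b \in A, a != b, f a = f b &
    {in A, forall x, f x \in f @: (A :\ x) -> (x == a) || (x == b)}].
Proof.
move=> cA; have /dinjectivePn[a aA [b /andP[/= ba bA] fab]] : ~~ dinjectiveb f A.
  by apply/negP => /dinjectiveP /card_in_imset eA; move: cA; rewrite eA => /n_Sn.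
have inj x y : x \in A -> y \in A -> x != y -> f x = f y ->
    {in A :\ y &, injective f}.
  move=> xA yA xy fxy; apply/imset_injP; apply/eqP.
  have -> : f @: (A :\ y) = f @: A.
    apply/setP => u; apply/imsetP/imsetP => -[v vA ->].
      by exists v => //; move: vA; rewrite !inE => /andP[].
    have [->|vy] := eqVneq v y; last by exists v; rewrite // !inE vy.
    by exists x; rewrite // !inE xy.
  by apply: succn_inj; rewrite -cA (cardsD1 y A) yA.
exists a, b; split; rewrite // 1?eq_sym //.
move=> x xA /imsetP[y]; rewrite !inE => /andP[yx yA] fxy.
have [//|xa] /= := eqVneq x a; apply: contraT => xb.
have [yb|yb] := eqVneq y b.
  have := inj _ _ bA aA ba (esym fab) x y; rewrite !inE xa xA yA yb ba /=.
  by move=> /(_ isT isT); rewrite fxy yb => /(_ erefl) xeb; rewrite xeb eqxx in xb.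
have ab : a != b by rewrite eq_sym.
have := inj _ _ aA bA ab fab x y; rewrite !inE xb xA yA yb /=.
by move=> /(_ isT isT fxy) xy; rewrite xy eqxx in yx.
Qed.

Lemma setU1_of_subset (X : finType) (T S : {set X}) :
  T \subset S -> #|S| = #|T|.+1 -> exists2 z, z \notin T & S = z |: T.
Proof.
move=> TS cS; have : #|S :\: T| == 1%N.
  by rewrite cardsDS // cS subSnn.
move=> /cards1P[z Sz]; exists z.
  have : z \in S :\: T by rewrite Sz inE.
  by rewrite inE => /andP[].
apply/setP => x; have := congr1 (fun A : {set X} => x \in A) Sz.
rewrite !inE => <-; case: (boolP (x \in T)) => /= xT; last by rewrite orbF.
by rewrite (subsetP TS).
Qed.

End FiniteSets.

Section Scarf.
Import mathcomp.boot.fintype mathcomp.boot.finset.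
Variables (V I : finType) (r : I -> V -> nat) (c : V -> I).
Hypothesis r_inj : forall i, injective (r i).
Variables (v0 : V) (i0 : I).

(** One subset S of V + I encodes a pair: the points inl x in S, and the set of
    directions, which is the complement of the inr i in S. Adding any element to S then
    means either adding a point or dropping a direction, so both moves of Scarf's
    argument are the same operation, and the sets that matter all have size |I| or one
    less. S is dominant when no point of V exceeds, in every direction of S, the lowest
    point of S in that direction. *)
Definition dominant (S : {set V + I}) : bool :=
  [forall y, [exists i, (inr i \notin S) &&
    [forall x, (inl x \in S) ==> (r i y <= r i x)]]].

Definition color (z : V + I) : I := match z with inl x => c x | inr i => i end.

Definition room (S : {set V + I}) : bool :=
  [&& dominant S, #|S| == #|I| & [set~ i0] \subset color @: S].

Definition door (T : {set V + I}) : bool :=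
  [&& dominant T, #|T|.+1 == #|I| & color @: T == [set~ i0]].

Lemma dominantP (S : {set V + I}) :
  reflect (forall y, exists2 i, inr i \notin S &
             forall x, inl x \in S -> r i y <= r i x) (dominant S).
Proof.
apply: (iffP forallP) => dS y.
  have /existsP[i /andP[iS /forallP h]] := dS y.
  by exists i => // x; apply/implyP.
have [i iS h] := dS y; apply/existsP; exists i; rewrite iS /=.
by apply/forallP => x; apply/implyP/h.
Qed.

Lemma dominant_subset (T S : {set V + I}) : T \subset S -> dominant S -> dominant T.
Proof.
move=> /subsetP TS /dominantP dS; apply/dominantP => y.
have [i iS h] := dS y; exists i; first by apply: contra iS => /TS.
by move=> x /TS /h.
Qed.

Lemma card_color (T : {set V + I}) : color @: T = [set~ i0] -> #|color @: T|.+1 = #|I|.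
Proof. by move=> ->; rewrite cardsC1 prednK //; apply/card_gt0P; exists i0. Qed.

(** A room that misses a colour has one element more than it has colours, so exactly one
    pair of its elements shares a colour; the doors are obtained by removing one of the
    two. *)
Lemma two_doors (S : {set V + I}) : room S -> color @: S != [set: I] ->
  #|[set T | door T & T \subset S]| = 2.
Proof.
case/and3P => dS /eqP cS i0S nS.
have eS : color @: S = [set~ i0].
  apply/eqP; rewrite eqEsubset i0S andbT; apply/subsetP => i iS.
  rewrite !inE; apply: contra nS => /eqP ii0; apply/eqP/setP => j.
  rewrite [RHS]inE; have [->|jN] := eqVneq j i0; first by rewrite -ii0.
  by apply: (subsetP i0S); rewrite !inE.
have [|a [b [aS bS ab cab uniq]]] := @one_collision _ _ color S.
  by rewrite (card_color eS).
have colD x y : x \in S -> y \in S -> x != y -> color x = color y ->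
    color @: (S :\ x) = color @: S.
  move=> xS yS xy cxy; apply/setP => u; apply/imsetP/imsetP => -[v vA ->].
    by exists v => //; move: vA; rewrite !inE => /andP[].
  have [->|vy] := eqVneq v x; last by exists v; rewrite // !inE vy.
  by exists y; rewrite // !inE eq_sym xy.
have doorD x y : x \in S -> y \in S -> x != y -> color x = color y ->
    door (S :\ x).
  move=> xS yS xy cxy; rewrite /door (dominant_subset (subD1set _ _) dS) /=.
  by rewrite (colD _ _ xS yS) // eS eqxx andbT -cS [X in _ == X](cardsD1 x S) xS.
suff -> : [set T | door T & T \subset S] = [set S :\ a; S :\ b].
  rewrite cards2; case: eqVneq => // /setP /(_ a).
  by rewrite !inE eqxx /= ab aS.
apply/setP => T; rewrite !inE; apply/andP/orP; last first.
  case=> /eqP ->; split; rewrite ?subD1set //.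
    exact: doorD ab cab.
  by rewrite eq_sym in ab; apply: doorD ab (esym cab).
move=> [/and3P[dT /eqP cT /eqP colT] TS].
have [x xT Sx] : exists2 z, z \notin T & S = z |: T.
  by apply: setU1_of_subset; rewrite // cS.
have ST : S :\ x = T.
  by apply/setP => y; rewrite Sx !inE; case: eqVneq => //= ->; rewrite (negbTE xT).
have xS : x \in S by rewrite Sx !inE eqxx.
have := uniq _ xS; rewrite ST colT -eS imset_f // => /(_ isT).
by case/orP => /eqP <-; rewrite ST eqxx; [left|right].
Qed.

Lemma room_of_door (T : {set V + I}) z : door T -> z \notin T ->
  room (z |: T) = dominant (z |: T).
Proof.
move=> /and3P[dT /eqP cT /eqP colT] zT; rewrite /room.
rewrite cardsU1 zT add1n cT eqxx /= -colT imsetS ?andbT //.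
exact: subsetUr.
Qed.

Lemma roomsP (T : {set V + I}) : door T ->
  [set S | room S & T \subset S] =
  [set z |: T | z in [set z | z \notin T & dominant (z |: T)]].
Proof.
move=> dT; apply/setP => S; rewrite !inE; apply/andP/imsetP.
  case=> rS TS; have [z zT SE] : exists2 z, z \notin T & S = z |: T.
    apply: setU1_of_subset => //.
    by case/and3P: rS => _ /eqP -> _; case/and3P: dT => _ /eqP -> _.
  by exists z => //; rewrite inE zT -SE; case/and3P: rS => ->.
move=> [z]; rewrite inE => /andP[zT dz] ->.
by rewrite (room_of_door dT zT) dz subsetUr.
Qed.

Lemma card_rooms (T : {set V + I}) : door T ->
  #|[set S | room S & T \subset S]| = #|[set z | z \notin T & dominant (z |: T)]|.
Proof.
move=> dT; rewrite (roomsP dT) card_in_imset // => y z.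
rewrite !inE => /andP[yT _] /andP[zT _] /setP /(_ y).
by rewrite !in_setU1 eqxx (negbTE yT) !orbF => /esym /eqP.
Qed.

(** The map sending a direction to the lowest point of T in that direction is onto the
    points of T, and there is one direction more than points, so exactly two directions
    a, b share their lowest point. Each of them allows exactly one extension of T: give
    up the threshold of that direction, and the candidates are the points above the
    thresholds m i in all others. If there is none the direction itself can be dropped;
    otherwise the candidate that is best in the given direction is added, as any other
    would be exceeded by it. *)
Lemma inner_door (T : {set V + I}) x0 : door T -> inl x0 \in T ->
  #|[set z | z \notin T & dominant (z |: T)]| = 2.
Proof.
move=> dT x0T; case/and3P: (dT) => domT /eqP cT _.
have {}domT := dominantP _ domT.
pose tau := [set x | inl x \in T]; pose D := [set i | inr i \notin T].
have x0tau : x0 \in tau by rewrite inE.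
pose m i := [arg min_(x < x0 in tau) r i x].
have mtau i : m i \in tau by rewrite /m; case: arg_minnP.
have m_le i x : x \in tau -> r i (m i) <= r i x.
  by move=> xt; rewrite /m; case: arg_minnP => // u _; apply.
have m_eq i x : x \in tau -> (forall y, y \in tau -> r i x <= r i y) -> m i = x.
  move=> xt h; apply: (@r_inj i); apply/eqP; rewrite eqn_leq m_le //=.
  exact/h/mtau.
have mD : m @: D = tau.
  apply/setP => x; apply/imsetP/idP => [[i _ ->]|xt]; first exact: mtau.
  have [i iT h] := domT x; exists i; first by rewrite inE.
  by rewrite (m_eq i x) // => y yt; apply: h; rewrite inE in yt.
have cTsum : #|T| = #|tau| + #|~: D|.
  have -> : T = (inl @: tau) :|: (inr @: ~: D).
    apply/setP => -[x|i]; rewrite inE.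
      rewrite mem_imset; last by move=> ? ? [].
      rewrite inE; case: (inl x \in T) => //=.
      by apply/esym/negP => /imsetP[].
    rewrite [X in _ || X]mem_imset; last by move=> ? ? [].
    rewrite !inE negbK; case: (inr i \in T); rewrite ?orbT ?orbF //.
    by apply/esym/negP => /imsetP[].
  rewrite cardsU (_ : _ :&: _ = set0).
    by rewrite cards0 subn0 !card_imset // => ? ? [].
  by apply/setP => z; rewrite !inE; apply/negP => /andP[/imsetP[? _ ->] /imsetP[]].
have cD : #|D| = #|m @: D|.+1.
  rewrite mD; move: cT; rewrite cTsum -(cardsC D) -addSn => /eqP.
  by rewrite eqn_add2r => /eqP.
have [a [b [aD bD ab mab uniq]]] := one_collision cD.
pose Y j := [set y | [forall i in D :\ j, r i (m i) < r i y]].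
have YP j y : reflect (forall i, i \in D -> i != j -> r i (m i) < r i y) (y \in Y j).
  rewrite inE; apply: (iffP forall_inP) => h i; last by rewrite !inE => /andP[? ?]; apply: h;
    rewrite ?inE.
  by move=> iD ij; apply: h; rewrite in_setD1 ij iD.
pose Z j : V + I := if [pick y in Y j] is Some y then inl [arg max_(u > y in Y j) r j u]
                    else inr j.
have ZP j : (Z j = inr j /\ forall y, y \notin Y j) \/
    exists2 x, Z j = inl x & (x \in Y j) /\ forall y, y \in Y j -> r j y <= r j x.
  rewrite /Z; case: pickP => [y yY|Y0]; last by left; split => // y; rewrite Y0.
  by right; case: arg_maxnP => // x xY mx; exists x.
have ZT j j' : j \in D -> j' \in D -> j != j' -> m j = m j' ->
    Z j \notin T /\ dominant (Z j |: T).
  move=> jD j'D jj' mjj'.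
  have mDj x : x \in tau -> exists i, [/\ i \in D, i != j & x = m i].
    rewrite -mD => /imsetP[i iD ->].
    have [->|ij] := eqVneq i j; first by exists j'; rewrite eq_sym.
    by exists i.
  case: (ZP j) => [[-> Y0]|[x -> [xY xmax]]].
    split; first by rewrite inE in jD.
    apply/dominantP => y; have := Y0 y; rewrite inE negb_forall => /existsP[i].
    rewrite negb_imply !in_setD1 -leqNgt => /andP[/andP[ij iD] le].
    exists i; first by rewrite !inE negb_or; rewrite inE in iD; rewrite iD andbT;
      apply: contra ij => /eqP[->].
    move=> x; rewrite !inE /= => xT; apply: (leq_trans le); apply: m_le.
    by rewrite inE.
  have /YP xY' := xY.
  split.
    apply/negP => xT; have [|i [iD ij xE]] := mDj x; first by rewrite inE.
    by have := xY' i iD ij; rewrite -xE ltnn.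
  apply/dominantP => y; case: (boolP (y \in Y j)) => yY.
    exists j; first by rewrite !inE /=; rewrite inE in jD.
    move=> u; rewrite !inE => /orP[/eqP[->]|uT]; first exact: xmax.
    have [i iT h] := domT y; have [<-|ij] := eqVneq i j; first exact: h.
    have /YP/(_ i) := yY; rewrite inE iT ij => /(_ isT isT); rewrite ltnNge.
    by rewrite h //; have := mtau i; rewrite inE.
  move: yY; rewrite inE negb_forall => /existsP[i].
  rewrite negb_imply !in_setD1 -leqNgt => /andP[/andP[ij iD] le].
  exists i; first by rewrite !inE /=; rewrite inE in iD.
  move=> u; rewrite !inE => /orP[/eqP[->]|uT]; apply: (leq_trans le).
    by apply/ltnW/xY'.
  by apply: m_le; rewrite inE.
have coll i k : i \in D -> k \in D -> i != k -> m i = m k ->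
    (i == a) || (i == b).
  move=> iD kD ik mik; apply: uniq => //; rewrite mik; apply: imset_f.
  by rewrite in_setD1 kD eq_sym ik.
have [ZaT Zad] := ZT _ _ aD bD ab mab.
have [ZbT Zbd] : Z b \notin T /\ dominant (Z b |: T).
  by apply: (ZT b a); rewrite // eq_sym.
have Zab : Z a != Z b.
  case: (ZP a) => [[-> _]|[x -> [/YP xY _]]]; case: (ZP b) => [[-> _]|[x' -> [/YP x'Y _]]] //.
  apply/eqP => -[xx']; subst x'; have [i iT h] := domT x.
  have : r i x <= r i (m i) by apply: h; have := mtau i; rewrite inE.
  rewrite leqNgt => /negP; apply; have [->|ia] := eqVneq i a; first exact: x'Y.
  by apply: xY; rewrite // inE.
suff -> : [set z | z \notin T & dominant (z |: T)] = [set Z a; Z b].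
  by rewrite cards2 Zab.
apply/setP => z; rewrite !inE; apply/andP/orP; last by case=> /eqP ->.
move=> [zT /dominantP zd].
suff [j jab ->] : exists2 j, (j == a) || (j == b) & z = Z j.
  by case/orP: jab => /eqP ->; [left|right].
case: z zT zd => [x|j] zT zd; last first.
  have jD : j \in D by rewrite inE.
  have zd' y : exists i, [/\ i \in D, i != j & forall x, x \in tau -> r i y <= r i x].
    have [i iT h] := zd y; exists i; move: iT; rewrite !inE negb_or => /andP[ij iT].
    split=> [//||x xt].
      by apply: contra ij => /eqP ->.
    by apply: h; rewrite !inE in xt *.
  exists j.
    have [i [iD ij h]] := zd' (m j); apply: (coll _ i); rewrite 1?eq_sym //.
    by apply/esym/m_eq => //; apply: mtau.
  case: (ZP j) => [[-> //]|[x _ [/YP xY _]]].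
  have [i [iD ij h]] := zd' x.
  by have := xY i iD ij; rewrite ltnNge h ?mtau.
have zd' y : exists i, [/\ i \in D, r i y <= r i x & forall x, x \in tau -> r i y <= r i x].
  have [i iT h] := zd y; exists i; move: iT; rewrite !inE /= => iT.
  split=> [//||u ut].
    by apply: h; rewrite !inE eqxx.
  by apply: h; rewrite !inE in ut *; rewrite ut orbT.
have xtau : x \notin tau by rewrite inE.
have [j [jD _ xj]] := zd' x.
have ltxj : r j x < r j (m j).
  rewrite ltn_neqAle xj ?mtau // andbT; apply: contra xtau => /eqP/r_inj ->.
  exact: mtau.
have ij_of i : r i (m j) <= r i x -> i != j.
  by move=> le; apply/eqP => ij; move: le; rewrite ij leqNgt ltxj.
have jab : (j == a) || (j == b).
  have [i [iD lei h]] := zd' (m j); apply: (coll _ i); rewrite 1?eq_sym ?ij_of //.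
  by apply/esym/m_eq => //; apply: mtau.
exists j => //.
have xY : x \in Y j.
  apply/YP => i iD ij; have [k [kD lek h]] := zd' (m i).
  have mik : m k = m i by apply: m_eq => //; apply: mtau.
  have [ki|ki] := eqVneq k i.
    subst k; rewrite ltn_neqAle lek andbT; apply: contra xtau => /eqP/r_inj <-.
    exact: mtau.
  exfalso; have kj : k != j.
    by apply/eqP => kj; subst k; move: lek; rewrite -mik leqNgt ltxj.
  have kab := coll _ _ kD iD ki mik.
  have iab : (i == a) || (i == b) by apply: (coll _ k); rewrite 1?eq_sym.
  move: jab kab iab ki ij kj.
  by do 3![case/orP => /eqP ->]; rewrite ?eqxx.
case: (ZP j) => [[_ /(_ x)]|[u -> [uY umax]]]; first by rewrite xY.
congr inl; apply: (@r_inj j); apply/eqP; rewrite eqn_leq umax //=.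
have [i [iD lei h]] := zd' u; have [<-//|ij] := eqVneq i j.
by have /YP/(_ i iD ij) := uY; rewrite ltnNge h ?mtau.
Qed.

(** The door with no point and the single direction i0: the boundary from which the
    parity argument starts. *)
Definition outer : {set V + I} := [set inr i | i in [set~ i0]].

Lemma inr_outer i : (inr i \in outer) = (i != i0).
Proof. by rewrite mem_imset ?inE // => ? ? []. Qed.

Lemma inl_outer x : (inl x \in outer) = false.
Proof. by apply/negP => /imsetP[]. Qed.

Lemma outer_door : door outer.
Proof.
apply/and3P; split.
- apply/dominantP => y; exists i0; first by rewrite inr_outer eqxx.
  by move=> x; rewrite inl_outer.
- rewrite card_imset ?cardsC1 ?prednK //; last by move=> ? ? [].
  by apply/card_gt0P; exists i0.
- rewrite /outer -imset_comp; apply/eqP/setP => i; apply/imsetP/idP => [[j jN ->]//|iN].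
  by exists i.
Qed.

(** With i0 as only direction, one point can be added: the maximum of r i0. No direction
    can be dropped, since the empty set of directions is not dominant. *)
Lemma outer_door_rooms :
  #|[set z | z \notin outer & dominant (z |: outer)]| = 1%N.
Proof.
pose x := [arg max_(u > v0) r i0 u].
have xmax y : r i0 y <= r i0 x by rewrite /x; case: arg_maxnP => // u _; apply.
apply/eqP/cards1P; exists (inl x); apply/setP => -[u|i]; rewrite !inE.
  rewrite inl_outer /=; apply/dominantP/eqP => [du|[->] y]; last first.
    exists i0; first by rewrite !inE inr_outer eqxx.
    by move=> v; rewrite !inE inl_outer orbF => /eqP[->].
  congr inl; apply: (@r_inj i0); apply/eqP; rewrite eqn_leq xmax /=.
  have [i] := du x; rewrite !inE inr_outer negbK => /eqP -> h.
  by apply: h; rewrite !inE eqxx.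
rewrite inr_outer negbK; apply/andP => -[/eqP -> /dominantP /(_ v0)[j]].
rewrite !inE inr_outer negb_or negbK => /andP[jN /eqP ji].
by rewrite ji eqxx in jN.
Qed.

Lemma doorE (T : {set V + I}) : door T -> T = outer \/ exists x, inl x \in T.
Proof.
move=> dT; have [/existsP[x xT]|/existsPn h] := boolP [exists x, inl x \in T].
  by right; exists x.
left; apply/setP => -[x|i]; first by rewrite inl_outer (negbTE (h x)).
rewrite inr_outer; case/and3P: dT => _ _ /eqP /setP /(_ i).
rewrite !inE => <-; apply/idP/imsetP => [iT|[[x|j] zT /= ->//]]; first by exists (inr i).
by rewrite (negbTE (h x)) in zT.
Qed.

(** Count incidences between doors and rooms modulo 2. If every room missed a colour it
    would have two doors, while every door other than [outer] lies in two rooms and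
    [outer] in one. *)
Lemma rainbow_room : exists2 S, dominant S & color @: S = [set: I].
Proof.
case: (boolP [exists S, room S && (color @: S == [set: I])]) => [/existsP[S]|/existsPn nr].
  by case/andP => /and3P[dS _ _] /eqP cS; exists S.
have room2 S : room S -> #|[set T | door T & T \subset S]| = 2.
  by move=> rS; apply: two_doors => //; have := nr S; rewrite rS.
have : \sum_(T | door T) #|[set S | room S & T \subset S]| =
       \sum_(S | room S) #|[set T | door T & T \subset S]|.
  rewrite (eq_bigr (fun T : {set V + I} => \sum_(S : {set V + I} | room S && (T \subset S)) 1)).
    rewrite (exchange_big_dep room) //=.
      apply: eq_bigr => S rS.
      by rewrite -sum1_card; apply: eq_bigl => T; rewrite inE rS.
    by move=> T S _ /andP[].
  by move=> T _; rewrite -sum1_card; apply: eq_bigl => S; rewrite inE.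
under [in RHS]eq_bigr => S rS do rewrite (room2 S rS).
rewrite (bigD1 outer) ?outer_door //= card_rooms ?outer_door // outer_door_rooms.
rewrite (eq_bigr (fun=> 2)); last first.
  move=> T /andP[dT nT]; rewrite card_rooms //; have [eT|[x xT]] := doorE dT;
    first by rewrite eT eqxx in nT.
  exact: inner_door dT xT.
rewrite !sum_nat_const => /(congr1 odd).
by rewrite oddD !oddM /= !andbF.
Qed.

(** In a room of all colours every direction i is the colour of a point: colour i
    occurs, and inr i, which is the only element of that colour other than points, is
    not in the room. *)
Lemma scarf : exists2 s : {set V}, s != set0 &
  forall y, exists2 i, i \in c @: s & forall x, x \in s -> r i y <= r i x.
Proof.
have [S /dominantP dS /setP cS] := rainbow_room.
have dS' y : exists2 i, i \in c @: [set x | inl x \in S] &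
    forall x, x \in [set x | inl x \in S] -> r i y <= r i x.
  have [i iS h] := dS y; exists i => [|x]; last by rewrite inE; apply: h.
  have := cS i; rewrite inE => /imsetP[[x|j] xS /= iE].
    by rewrite iE; apply: imset_f; rewrite inE.
  by rewrite iE xS in iS.
exists [set x | inl x \in S] => //.
have [i /imsetP[x xS _] _] := dS' v0.
by apply/set0Pn; exists x.
Qed.

End Scarf.

(** * Equilibria on a simplex *)

Section Grid.
Variables (n N : nat).
Local Notation I := 'I_n.+1.
Definition on_grid : pred {ffun I -> 'I_N.+2} :=
  [pred x : {ffun I -> 'I_N.+2} | \sum_i (x i : nat) == N.+1].
Local Notation V := {x : {ffun I -> 'I_N.+2} | on_grid x}.

Lemma grid_sum (x : V) : \sum_i val x i = N.+1.
Proof. by case: x => x /= /eqP. Qed.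

Lemma grid_of (y : I -> nat) : \sum_i y i = N.+1 ->
  exists x : V, forall i, val x i = y i :> nat.
Proof.
move=> sy; have yN i : y i < N.+2 by rewrite ltnS -sy (bigD1 i) //= leq_addr.
have xP : on_grid [ffun i => inord (y i)].
  by apply/eqP; rewrite /= -[RHS]sy; apply: eq_bigr => i _; rewrite ffunE inordK.
by exists (Sub [ffun i => inord (y i)] xP) => i; rewrite SubK ffunE inordK.
Qed.

(** Scarf's set of points is small. Its minima m i over the used colours i in C add up
    to more than N + 1 - |C|, for otherwise raising each of them by one, and one of them
    possibly further, would give a grid point above all the minima m i, i in C. As the
    coordinates of a grid point add up to N + 1, each of them exceeds its minimum by at
    most n if its index is in C, and is itself at most n if it is not. *)
Lemma grid_cell (c : V -> I) : exists s : {set V}, s != finset.set0 /\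
  forall x, x \in s -> forall i, n < val x i ->
  exists y, [/\ y \in s, c y = i &
    forall k, val x k <= val y k + n /\ val y k <= val x k + n].
Proof.
(* the coordinate, with ties broken by a fixed enumeration of the grid *)
pose r i (x : V) := (val x i * #|{: V}| + enum_rank x)%N.
have r_lt i (x y : V) : val x i < val y i -> r i x < r i y.
  move=> lt; apply: (@leq_trans ((val x i).+1 * #|{: V}|)).
    by rewrite mulSnr ltn_add2l ltn_ord.
  by apply: leq_trans (leq_addr _ _); rewrite leq_mul2r lt orbT.
have r_inj i : injective (r i).
  move=> x y exy; case: (ltngtP (val x i) (val y i)) => [/r_lt|/r_lt|e].
  - by rewrite exy ltnn.
  - by rewrite exy ltnn.
  by move: exy; rewrite /r e => /addnI /val_inj /enum_rank_inj.
have [v0 _] : exists x : V, forall i, val x i = (if i == ord0 then N.+1 else 0) :> nat.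
  by apply: grid_of; rewrite -big_mkcond big_pred1_eq.
have [s s0 dom] := scarf c r_inj v0 ord0.
exists s; split=> // x xs.
have [x0 x0s] := finset.set0Pn _ s0.
pose C := c @: s; pose m i := val (val [arg min_(z < x0 in s) r i z] i).
have m_le i z : z \in s -> m i <= val z i.
  move=> zs; rewrite /m; case: arg_minnP => // u us /(_ z zs) h.
  by rewrite leqNgt; apply: contraL h => /r_lt; rewrite -ltnNge.
have nodom (y : V) : exists2 i, i \in C & val y i <= m i.
  have [i iC h] := dom y; exists i => //; rewrite /m; case: arg_minnP => // u us _.
  by rewrite leqNgt; apply: contraL (h u us) => /r_lt; rewrite -ltnNge.
have [i0 i0C] : exists i, i \in C by have [i iC _] := nodom v0; exists i.
have big_m : N.+1 < \sum_(i in C) (m i).+1.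
  rewrite ltnNge; apply/negP => le.
  pose rest := \sum_(i in C | i != i0) (m i).+1.
  have le' : (m i0).+1 + rest <= N.+1 by move: le; rewrite (bigD1 i0).
  have [|y yE] := @grid_of (fun i => if i == i0 then N.+1 - rest else
                      if i \in C then (m i).+1 else 0).
    rewrite (bigD1 i0) //= eqxx.
    rewrite (eq_bigr (fun i => if i \in C then (m i).+1 else 0)); last first.
      by move=> i /negbTE ->.
    rewrite -big_mkcondr (eq_bigl (fun i => (i \in C) && (i != i0))); last first.
      by move=> i; rewrite andbC.
    by rewrite -/rest subnK //; apply: leq_trans le'; rewrite leq_addl.
  have [i iC] := nodom y; rewrite yE; have [->|ii0] := eqVneq i i0.
    by rewrite leqNgt ltn_subRL addnC le'.
  by rewrite iC ltnn.
have cC : #|C| <= n.+1 by rewrite -[X in _ <= X]card_ord max_card.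
have big_m' : N.+1 < \sum_(i in C) m i + n.+1.
  apply: (leq_trans big_m); rewrite (eq_bigr (fun i => m i + 1)); last by move=> *; rewrite addn1.
  by rewrite big_split /= sum1_card leq_add2l.
have inC z i : z \in s -> i \in C -> val z i <= m i + n.
  move=> zs iC; rewrite -ltnS -addnS -(ltn_add2r (\sum_(j in C | j != i) m j)).
  rewrite addnAC -[X in _ < X + _](bigD1 i) //=.
  apply: leq_ltn_trans big_m'; have := grid_sum z;
    rewrite (bigD1 i) //= => /eq_leq/(leq_trans _); apply.
  rewrite leq_add2l.
  rewrite big_mkcond /= [X in _ <= X]big_mkcond /=; apply: leq_sum => j _.
  by case: (j == i); rewrite /= ?andbF ?andbT //; case: ifP => // _; apply: m_le.
have outC z i : z \in s -> i \notin C -> val z i <= n.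
  move=> zs iC; rewrite -ltnS -(ltn_add2l (\sum_(j in C) m j)).
  apply: leq_ltn_trans big_m'; have := grid_sum z;
    rewrite (bigD1 i) //= => /eq_leq/(leq_trans _); apply.
  rewrite addnC leq_add2l.
  rewrite big_mkcond /= [X in _ <= X]big_mkcond /=; apply: leq_sum => j _.
  case: ifP => // jC; rewrite ifT; first exact: m_le.
  by apply/eqP => ji; rewrite -ji jC in iC.
move=> i ni; have /imsetP[y ys ci] : i \in C.
  by apply: contraLR ni => iC; rewrite -leqNgt outC.
exists y; split => // k; have [kC|kC] := boolP (k \in C).
  split; [apply: leq_trans (inC x k xs kC) _|apply: leq_trans (inC y k ys kC) _].
    by rewrite leq_add2r m_le.
  by rewrite leq_add2r m_le.
by split; apply: leq_trans (leq_addl _ _); apply: outC.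
Qed.

End Grid.

Local Open Scope classical_set_scope.
Local Open Scope ring_scope.

Lemma cvg_sumR (R : realType) (T I : Type) (F : set_system T) (r : seq I) (P : pred I)
    (f : I -> T -> R) (l : I -> R) : Filter F ->
  (forall i, P i -> f i x @[x --> F] --> l i) ->
  \sum_(i <- r | P i) f i x @[x --> F] --> \sum_(i <- r | P i) l i.
Proof. by move=> FF h; apply: cvg_big => //; exact: add_continuous. Qed.

Section Equilibrium.
Variables (R : realType) (n : nat).
Local Notation rV := 'rV[R]_n.+1.

Definition simplex : set rV :=
  [set x | (forall i, 0 <= x ord0 i) /\ \sum_i x ord0 i = 1].

(** Label each grid point with a coordinate maximising f there. In the cell of
    [grid_cell] every coordinate that is not tiny is the label of a nearby point. N + 1
    is the inverse mesh. *)
Lemma approximate_equilibrium (f : rV -> 'I_n.+1 -> R) (N : nat) :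
  exists2 x, simplex x & forall i, n%:R / N.+1%:R < x ord0 i ->
    exists y, [/\ simplex y,
      forall k, `|x ord0 k - y ord0 k| <= n%:R / N.+1%:R &
      forall j, f y j <= f y i].
Proof.
pose V := {x : {ffun 'I_n.+1 -> 'I_N.+2} | on_grid x}.
pose emb (x : V) : rV := \row_i ((val x i)%:R / N.+1%:R).
have simE x : simplex (emb x).
  split=> [i|]; first by rewrite mxE divr_ge0.
  under eq_bigr do rewrite mxE.
  by rewrite -mulr_suml -natr_sum grid_sum divff // pnatr_eq0.
pose c (x : V) := [arg max_(i > ord0) f (emb x) i]%O.
have cP x j : f (emb x) j <= f (emb x) (c x).
  by rewrite /c; case: arg_maxP => // i _; apply.
have [s [/finset.set0Pn[x xs] cell]] := grid_cell c.
exists (emb x) => // i; rewrite mxE ltr_pM2r ?invr_gt0 // ltr_nat => /(cell _ xs).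
move=> [y [ys cy near]]; exists (emb y); split=> // [k|j]; last by rewrite -cy.
rewrite !mxE -mulrBl normrM [X in _ * X]gtr0_norm ?invr_gt0 // ler_pM2r ?invr_gt0 //.
have [/=] := near k; rewrite -(ler_nat R) natrD => h1; rewrite -(ler_nat R) natrD => h2.
by rewrite ler_norml; apply/andP; split; lra.
Qed.

Lemma compact_simplex : compact simplex.
Proof.
have cpt : compact [set v : rV | forall i, `[0, 1]%classic (v ord0 i)].
  by apply: (@rV_compact R n.+1 (fun=> `[0, 1]%classic)) => i; apply: segment_compact.
apply: subclosed_compact cpt _; last first.
  move=> x [x0 x1] i /=; rewrite in_itv /= x0 /= -x1 (bigD1 i) //= lerDl.
  by apply: sumr_ge0.
have coordC i : continuous (fun x : rV => x ord0 i) by move=> x; apply: coord_continuous.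
have -> : simplex = (\bigcap_i [set x : rV | 0 <= x ord0 i]) `&` [set x | \sum_i x ord0 i = 1].
  by apply/seteqP; split => x [h ?]; split => // i; [move=> _; apply: h|apply: h].
apply: closedI.
  apply: closed_bigI => i _.
  apply: (@preimage_closed _ _ (fun x : rV => x ord0 i) [set t | 0 <= t]); last exact: closed_ge.
  by move=> x _; apply: coordC.
apply: (@preimage_closed _ _ (fun x : rV => \sum_i x ord0 i) [set 1]); last exact: closed_eq.
move=> x _; apply: (@cvg_sumR _ _ _ (nbhs x)) => i _; exact: coordC.
Qed.

(** A cluster point of approximate equilibria for finer and finer grids. Were f x i < f
    x j with x_i > 0, the same inequality would hold near x, in particular at the points
    near x where i is a maximiser of f. *)
Lemma simplex_equilibrium (f : rV -> 'I_n.+1 -> R) :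
  (forall x j, simplex x -> f y j @[y --> within simplex (nbhs x)] --> f x j) ->
  exists2 x, simplex x & forall i j, 0 < x ord0 i -> f x j <= f x i.
Proof.
move=> fc.
have /choice[u /all_and2[uS uP]] : forall N, exists u, simplex u /\
    forall i, n%:R / N.+1%:R < u ord0 i ->
    exists y, [/\ simplex y,
      forall k, `|u ord0 k - y ord0 k| <= n%:R / N.+1%:R &
      forall j, f y j <= f y i].
  by move=> N; have [x ? ?] := approximate_equilibrium f N; exists x.
have [|x [xS xcl]] := @compact_simplex (u @ \oo) _.
  by exists 0%N => // N _; apply: uS.
exists x => // i j xi; rewrite leNgt; apply/negP => fij.
pose e := (f x j - f x i) / 2.
have e0 : 0 < e by rewrite divr_gt0 // subr_gt0.
have : \forall y \near within simplex (nbhs x), f y i < f y j.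
  near=> y; have h1 : `|f x i - f y i| < e.
    by near: y; move/cvgrPdist_lt : (fc x i xS); apply.
  have h2 : `|f x j - f y j| < e.
    by near: y; move/cvgrPdist_lt : (fc x j xS); apply.
  by move: h1 h2; rewrite /e !ltr_norml => /andP[? ?] /andP[? ?]; lra.
rewrite near_withinE => /nbhs_ballP[d /= d0 dP].
pose d' := Num.min d (x ord0 i).
have d'0 : 0 < d' by rewrite lt_min d0.
have nN : \forall N \near \oo, n%:R / N.+1%:R < d' / 2 :> R.
  near=> N; rewrite ltr_pdivrMr // mulrC -ltr_pdivrMr ?divr_gt0 //.
  apply: (@lt_le_trans _ _ N%:R); last by rewrite ler_nat.
  by near: N; exact: nbhs_infty_gtr.
(* the cluster point is approached along grids with n / N.+1 < d' / 2, so the point at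
   which i is a maximiser is within d' of x *)
have uA : (u @ \oo) [set z | exists N, z = u N /\ n%:R / N.+1%:R < d' / 2].
  by apply: (@filterS _ \oo _ _ _ _ nN) => N h; exists N.
have [_ [[N [-> /= Nd]] xN]] := xcl _ (ball x (d' / 2)) uA
    (nbhsx_ballx _ _ (divr_gt0 d'0 (ltr0n _ 2))).
have xk k : `|x ord0 k - u N ord0 k| < d' / 2 by case: xN => _; apply.
have [|y [yS yu yi]] := uP N i.
  apply: (lt_trans Nd); have := xk i; rewrite ltr_norml => /andP[_].
  have : d' <= x ord0 i by rewrite ge_min lexx orbT.
  by lra.
have : f y i < f y j; last by rewrite ltNge yi.
apply: dP => //; split=> // k l; rewrite (ord1 k) /ball /=.
apply: (@lt_le_trans _ _ d'); last by rewrite ge_min lexx.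
have := xk l; have := yu l => h1 h2;
  have := ler_normD (x ord0 l - u N ord0 l) (u N ord0 l - y ord0 l).
rewrite subrKA => h3; apply: (le_lt_trans h3); rewrite [d']splitr; apply: ltrD => //;
  exact: le_lt_trans Nd.
Unshelve. all: by end_near. Qed.
End Equilibrium.

(** * The matrix exponential *)

Section MatrixExponential.
Variables (R : realType) (n : nat).
Implicit Types (A Q : 'M[R]_n.+1) (j k l : 'I_n.+1).

Lemma cvg_pseries_exp (f : nat -> R) (b a x : R) :
  (forall i, `|f i| <= b * (a ^+ i / i`!%:R)) -> cvgn (pseries f x).
Proof.
move=> fb; apply: normed_cvg.
apply: (@series_le_cvg _ _ (fun i => b * exp_coeff (a * `|x|) i)).
- by move=> i /=; apply: normr_ge0.
- move=> i; apply: (@le_trans _ _ (b * (a ^+ i / i`!%:R) * `|x| ^+ i)).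
    by rewrite mulr_ge0 ?exprn_ge0 //; apply: le_trans (fb i).
  by rewrite /exp_coeff /= exprMn -[leLHS]mulrA [_ ^+ i / _ * _]mulrAC.
- move=> i /=; rewrite normrM normrX.
  apply: (@le_trans _ _ (b * (a ^+ i / i`!%:R) * `|x| ^+ i)).
    by rewrite ler_wpM2r ?exprn_ge0.
  by rewrite /exp_coeff /= exprMn -[leLHS]mulrA [_ ^+ i / _ * _]mulrAC.
- exact: is_cvg_seriesZ (is_cvg_series_exp_coeff _).
Qed.

Definition mexp_coef A j k (i : nat) : R := (A ^+ i) j k / i`!%:R.

Definition mexp A (s : R) : 'M[R]_n.+1 :=
  \matrix_(j, k) limn (pseries (mexp_coef A j k) s).

Lemma norm_mx_expr A j k i :
  `|(A ^+ i) j k| <= (\sum_u \sum_v `|A u v|) ^+ i.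
Proof.
elim: i j k => [|i IH] j k; first by rewrite !expr0 mxE; case: eqP; rewrite ?normr1 ?normr0.
rewrite !exprS !mxE; apply: (le_trans (ler_norm_sum _ _ _)).
apply: (@le_trans _ _ (\sum_l `|A j l| * (\sum_u \sum_v `|A u v|) ^+ i)).
  by apply: ler_sum => l _; rewrite normrM ler_wpM2l.
rewrite -mulr_suml ler_wpM2r ?exprn_ge0 //.
  by apply: sumr_ge0 => ? _; apply: sumr_ge0.
by rewrite [leRHS](bigD1 j) //= lerDl; apply: sumr_ge0 => ? _; apply: sumr_ge0.
Qed.

(** The factor A ^+ d accounts for the d-th derivative of the exponential series, which
    term-by-term differentiation requires to converge for d = 0, 1, 2. *)
Lemma cvg_mexp_shift A j k d s :
  cvgn (pseries (fun i => (A ^+ (i + d)) j k / i`!%:R) s).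
Proof.
pose a := \sum_u \sum_v `|A u v|.
apply: (@cvg_pseries_exp _ (a ^+ d) a) => i.
rewrite normrM [X in _ * X]ger0_norm ?invr_ge0 // mulrA -exprD addnC ler_wpM2r ?invr_ge0 //.
by rewrite addnC norm_mx_expr.
Qed.

Lemma cvg_mexp A j k s : cvgn (pseries (mexp_coef A j k) s).
Proof. by have := @cvg_mexp_shift A j k 0 s; under eq_fun do rewrite addn0. Qed.

Lemma mexp_diffs A j k :
  pseries_diffs (mexp_coef A j k) = fun i => (A ^+ (i + 1)) j k / i`!%:R.
Proof.
apply/funext => i; rewrite /pseries_diffs /mexp_coef addn1 factS natrM invfM.
by rewrite mulrCA mulVKf // pnatr_eq0.
Qed.

Lemma mexp_diffs2 A j k :
  pseries_diffs (pseries_diffs (mexp_coef A j k)) =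
  fun i => (A ^+ (i + 2)) j k / i`!%:R.
Proof.
rewrite mexp_diffs; apply/funext => i; rewrite /pseries_diffs factS natrM invfM addn1 addn2.
by rewrite mulrCA mulVKf // pnatr_eq0.
Qed.

Lemma is_derive_mexp_lim A j k (s : R) : is_derive s 1 (fun s : R => mexp A s j k)
  (limn (pseries (fun i => (A ^+ (i + 1)) j k / i`!%:R) s)).
Proof.
under eq_fun do rewrite mxE.
rewrite -mexp_diffs; apply: (@pseries_snd_diffs _ _ (`|s| + 1)).
- exact: cvg_mexp.
- by rewrite mexp_diffs; apply: cvg_mexp_shift.
- by rewrite mexp_diffs2; apply: cvg_mexp_shift.
- by rewrite [ltRHS]ger0_norm ?ltrDl // addr_ge0.
Qed.

Lemma lim_pseries_sum (a : 'I_n.+1 -> R) (f : 'I_n.+1 -> nat -> R) s :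
  (forall l, cvgn (pseries (f l) s)) ->
  limn (pseries (fun i => \sum_l a l * f l i) s) =
  \sum_l a l * limn (pseries (f l) s).
Proof.
move=> cf; apply: cvg_lim => //.
have -> : pseries (fun i => \sum_l a l * f l i) s =
    (fun m => \sum_l a l * pseries (f l) s m).
  apply/funext => m; rewrite /pseries /series /=.
  under eq_bigr do rewrite mulr_suml.
  rewrite exchange_big /=; apply: eq_bigr => l _.
  by rewrite mulr_sumr; apply: eq_bigr => i _; rewrite mulrA.
by apply: cvg_sumR => l _; apply: cvgMr; apply: cf.
Qed.

Lemma is_derive_mexp A j k (s : R) :
  is_derive s 1 (fun s : R => mexp A s j k) ((A *m mexp A s) j k).
Proof.
have := is_derive_mexp_lim A j k s.
congr is_derive; rewrite mxE; under [RHS]eq_bigr do rewrite mxE.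
rewrite -lim_pseries_sum => [|l]; last exact: cvg_mexp.
congr (limn (pseries _ _)); apply/funext => i; rewrite addn1 exprS mxE mulr_suml.
by apply: eq_bigr => l _; rewrite mulrA.
Qed.

Lemma mexp_comm A s : mexp A s *m A = A *m mexp A s.
Proof.
apply/matrixP => j k; rewrite !mxE.
under eq_bigr do rewrite mxE mulrC; under [RHS]eq_bigr do rewrite mxE.
rewrite -!lim_pseries_sum => [|l|l]; try exact: cvg_mexp.
congr (limn (pseries _ _)); apply/funext => i.
have -> : \sum_l A l k * mexp_coef A j l i = (A ^+ i.+1) j k / i`!%:R.
  rewrite exprSr mxE mulr_suml; apply: eq_bigr => l _; by rewrite /mexp_coef; ring.
by rewrite exprS mxE mulr_suml; apply: eq_bigr => l _; rewrite mulrA.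
Qed.

Lemma mexp0 A : mexp A 0 = 1%:M.
Proof.
apply/matrixP => j k; rewrite mxE; apply: lim_near_cst => //.
near=> m; rewrite -[m]prednK; last by near: m.
rewrite /pseries /series /= big_nat_recl // big1 => [|i _].
  by rewrite /mexp_coef expr0 fact0 divr1 mulr1 addr0.
by rewrite expr0n mulr0.
Unshelve. all: by end_near. Qed.

Lemma mexp_ge A s j k : (forall u v, 0 <= A u v) -> 0 <= s ->
  (1%:M : 'M[R]_n.+1) j k <= mexp A s j k.
Proof.
move=> A0 s0; have Ai0 i u v : 0 <= (A ^+ i) u v.
  elim: i u v => [|i IH] u v; first by rewrite expr0 mxE ler0n.
  by rewrite exprS mxE; apply: sumr_ge0 => l _; rewrite mulr_ge0.
rewrite [leRHS]mxE; apply: limr_ge; first exact: cvg_mexp.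
near=> m; rewrite -[m]prednK; last by near: m.
rewrite /pseries /series /= big_nat_recl //= {1}/mexp_coef expr0 fact0 divr1 mulr1.
by rewrite lerDl; apply: sumr_ge0 => i _; rewrite mulr_ge0 ?exprn_ge0 // divr_ge0.
Unshelve. all: by end_near. Qed.

End MatrixExponential.

(** * The semigroup of a generator *)

Lemma is_derive_sumR (R : realType) (I : Type) (r : seq I) (P : pred I)
    (f : I -> R -> R) (df : I -> R) (x : R) :
  (forall i, P i -> is_derive x 1 (f i) (df i)) ->
  is_derive x 1 (fun y => \sum_(i <- r | P i) f i y) (\sum_(i <- r | P i) df i).
Proof.
move=> fd; elim: r => [|i r IH].
  by rewrite big_nil; under eq_fun do rewrite big_nil; exact: is_derive_cst.
rewrite big_cons; under eq_fun do rewrite big_cons.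
by case: ifP => // /fd fdi; exact: is_deriveD.
Qed.

Lemma is_derive_mulR (R : realType) (f g : R -> R) (df dg x : R) :
  is_derive x 1 f df -> is_derive x 1 g dg ->
  is_derive x 1 (fun y => f y * g y) (df * g x + f x * dg).
Proof.
move=> fx gx; have -> : df * g x + f x * dg = f x *: dg + g x *: df.
  by rewrite addrC [df * _]mulrC.
exact: is_deriveM.
Qed.

Lemma is_derive_continuous (R : realType) (f : R -> R) (df x : R) :
  is_derive x 1 f df -> {for x, continuous f}.
Proof.
by move=> fx; apply: differentiable_continuous; apply/derivable1_diffP.
Qed.

Section Semigroup.
Variables (R : realType) (n : nat).
Implicit Types (Q : 'M[R]_n.+1) (j k l : 'I_n.+1) (s u t : R).

Definition generator Q :=
  (forall j k, j != k -> 0 <= Q j k) /\ (forall j, \sum_k Q j k = 0).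

Definition unif_rate Q : R := \sum_j \sum_k `|Q j k|.

(** The exponential of s Q, uniformised: Q plus its rate times the identity has
    nonnegative entries, hence so has its exponential, and the scalar factor undoes the
    shift. *)
Definition semigroup Q s : 'M[R]_n.+1 :=
  expR (- (unif_rate Q * s)) *: mexp (Q + (unif_rate Q)%:M) s.

Lemma semigroup0 Q : semigroup Q 0 = 1%:M.
Proof. by rewrite /semigroup mulr0 oppr0 expR0 scale1r mexp0. Qed.

Lemma semigroup_comm Q s : semigroup Q s *m Q = Q *m semigroup Q s.
Proof.
rewrite /semigroup -scalemxAl -scalemxAr; congr (_ *: _).
have := mexp_comm (Q + (unif_rate Q)%:M) s.
rewrite mulmxDl mulmxDr scalar_mxC; exact: addIr.
Qed.

Lemma is_derive_semigroup Q j k s :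
  is_derive s 1 (fun v : R => semigroup Q v j k) ((Q *m semigroup Q s) j k).
Proof.
under eq_fun do rewrite mxE.
have dE : is_derive s 1 (fun v : R => expR (- (unif_rate Q * v)))
    (- unif_rate Q * expR (- (unif_rate Q * s))).
  have -> : (fun v : R => expR (- (unif_rate Q * v))) = expR \o (fun v : R => (- unif_rate Q) *: v).
    by apply/funext => v; rewrite /= /GRing.scale /= mulNr.
  rewrite mulrC; apply: is_derive1_comp.
    by rewrite /GRing.scale /= mulNr; exact: is_derive_expR.
  have := @is_deriveZ _ _ _ (id : R -> R) (- unif_rate Q) s 1 1 (is_derive_id _ _).
  by rewrite /GRing.scale /= mulr1.
have -> : (Q *m semigroup Q s) j k =
    - unif_rate Q * expR (- (unif_rate Q * s)) * mexp (Q + (unif_rate Q)%:M) s j k +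
    expR (- (unif_rate Q * s)) *
      ((Q + (unif_rate Q)%:M) *m mexp (Q + (unif_rate Q)%:M) s) j k.
  rewrite /semigroup -scalemxAr mulmxDl mul_scalar_mx.
  rewrite mxE [X in _ = _ + _ * X]mxE [X in _ = _ + _ * (_ + X)]mxE; ring.
exact: is_derive_mulR dE (is_derive_mexp (Q + (unif_rate Q)%:M) j k s).
Qed.

Lemma is_derive_semigroup_r Q j k s :
  is_derive s 1 (fun v : R => semigroup Q v j k) ((semigroup Q s *m Q) j k).
Proof. by rewrite semigroup_comm; exact: is_derive_semigroup. Qed.

Lemma continuous_semigroup Q j k : continuous (fun v : R => semigroup Q v j k).
Proof. by move=> s; apply: is_derive_continuous (is_derive_semigroup Q j k s). Qed.

(** The interpolation v |-> P_v P'_(t - v) between two semigroups, from Duhamel's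
    formula. With Q' = Q its derivative vanishes, which is the semigroup law; with Q'
    close to Q it bounds the distance of the semigroups. *)
Lemma is_derive_semigroup_conv Q Q' t s j k :
  is_derive s 1 (fun v : R => (semigroup Q v *m semigroup Q' (t - v)) j k)
    ((semigroup Q s *m (Q - Q') *m semigroup Q' (t - s)) j k).
Proof.
under eq_fun do rewrite mxE.
have -> : (semigroup Q s *m (Q - Q') *m semigroup Q' (t - s)) j k =
   \sum_l ((semigroup Q s *m Q) j l * semigroup Q' (t - s) l k +
           semigroup Q s j l * ((Q' *m semigroup Q' (t - s)) l k * -1)).
  rewrite mulmxBr mulmxBl -[X in _ - X]mulmxA mxE [X in _ + X]mxE.
  rewrite [X in X - _]mxE [X in _ - X]mxE -sumrB; apply: eq_bigr => l _.
  by rewrite mulrN1 mulrN.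
apply: is_derive_sumR => l _; apply: is_derive_mulR; first exact: is_derive_semigroup_r.
apply: (@is_derive1_comp _ (fun v => semigroup Q' v l k) (fun v => t - v)).
  exact: is_derive_semigroup.
have := @is_deriveB _ _ _ (cst t) id s 1 0 1 (is_derive_cst _ _ _) (is_derive_id _ _).
by rewrite sub0r.
Qed.

Lemma semigroupD Q s u : semigroup Q (s + u) = semigroup Q s *m semigroup Q u.
Proof.
apply/matrixP => j k.
have := @is_derive_0_is_cst _
  (fun v : R => (semigroup Q v *m semigroup Q (s + u - v)) j k) 0 s.
rewrite semigroup0 subr0 mul1mx [s + u]addrC addrK; apply => x.
have := is_derive_semigroup_conv Q Q (u + s) x j k.
by rewrite subrr mulmx0 mul0mx mxE.
Qed.

(** s |-> P_s f has derivative P_s Q f = 0. With f constant it gives total mass 1; with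
    f the positions of the states, the martingale property. *)
Lemma semigroup_fixed Q (f : 'cV[R]_n.+1) s : Q *m f = 0 -> semigroup Q s *m f = f.
Proof.
move=> Qf; apply/matrixP => j k.
have := @is_derive_0_is_cst _ (fun v : R => (semigroup Q v *m f) j k) s 0.
rewrite semigroup0 mul1mx; apply => x; under eq_fun do rewrite mxE.
have D0 : \sum_l ((semigroup Q x *m Q) j l * f l k + semigroup Q x j l * 0) = 0.
  under eq_bigr do rewrite mulr0 addr0.
  have := congr1 (fun A : 'cV[R]_n.+1 => (semigroup Q x *m A) j k) Qf.
  by rewrite mulmxA mulmx0 mxE [in RHS]mxE.
rewrite -[X in is_derive _ _ _ X]D0.
apply: is_derive_sumR => l _; apply: is_derive_mulR; first exact: is_derive_semigroup_r.
Qed.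

Lemma generator_unif_ge0 Q j k : generator Q -> 0 <= (Q + (unif_rate Q)%:M) j k.
Proof.
move=> [Q0 _]; rewrite !mxE; have [<-|jk] := eqVneq j k; last by rewrite addr0 Q0.
have : `|Q j j| <= unif_rate Q.
  rewrite /unif_rate (bigD1 j) //= (bigD1 j) //= -addrA lerDl.
  by apply: addr_ge0; apply: sumr_ge0 => // ? _; apply: sumr_ge0.
by have := ler_norm (- Q j j); rewrite normrN mulr1n; lra.
Qed.

Lemma semigroup_ge Q s j k : generator Q -> 0 <= s ->
  expR (- (unif_rate Q * s)) * (j == k)%:R <= semigroup Q s j k.
Proof.
move=> gQ s0; rewrite mxE ler_wpM2l ?expR_ge0 //.
apply: (@le_trans _ _ ((1%:M : 'M[R]_n.+1) j k)); first by rewrite mxE.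
by apply: mexp_ge => // u v; apply: generator_unif_ge0.
Qed.

Lemma semigroup_ge0 Q s j k : generator Q -> 0 <= s -> 0 <= semigroup Q s j k.
Proof.
by move=> gQ s0; apply: le_trans (semigroup_ge _ _ gQ s0); rewrite mulr_ge0 ?expR_ge0.
Qed.

Lemma semigroup_sum1 Q s j : generator Q -> \sum_k semigroup Q s j k = 1.
Proof.
move=> [_ gQ]; have := @semigroup_fixed Q (const_mx 1) s.
have -> : Q *m const_mx 1 = (0 : 'cV_n.+1).
  apply/matrixP => a b; rewrite !mxE -[RHS](gQ a).
  by apply: eq_bigr => l _; rewrite mxE mulr1.
move=> /(_ erefl) /matrixP /(_ j ord0); rewrite mxE [RHS]mxE => h; rewrite -[RHS]h.
by apply: eq_bigr => l _; rewrite [X in _ * X]mxE mulr1.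
Qed.

Lemma semigroup_le1 Q s j k : generator Q -> 0 <= s -> semigroup Q s j k <= 1.
Proof.
move=> gQ s0; rewrite -(semigroup_sum1 s j gQ) (bigD1 k) //= lerDl.
by apply: sumr_ge0 => l _; apply: semigroup_ge0.
Qed.

Lemma semigroup_lipschitz Q Q' t j k : generator Q -> generator Q' -> 0 <= t ->
  `|semigroup Q t j k - semigroup Q' t j k| <= t * \sum_a \sum_b `|Q a b - Q' a b|.
Proof.
move=> gQ gQ' t0.
have [c cI] := @MVT_segment _
  (fun v : R => (semigroup Q v *m semigroup Q' (t - v)) j k) _ 0 t t0
  (fun s _ => is_derive_semigroup_conv Q Q' t s j k)
  (continuous_subspaceT (fun s => is_derive_continuous (is_derive_semigroup_conv Q Q' t s j k))).
rewrite subr0 subrr !semigroup0 mul1mx mulmx1 => ->.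
move: cI; rewrite in_itv /= => /andP[c0 ct].
rewrite normrM [X in _ * X]ger0_norm // mulrC ler_wpM2l // mxE.
apply: (le_trans (ler_norm_sum _ _ _)).
rewrite exchange_big /=; apply: ler_sum => b _; rewrite normrM.
rewrite mxE [X in _ * X]ger0_norm; last by rewrite semigroup_ge0 // subr_ge0.
apply: (@le_trans _ _ (\sum_a `|Q a b - Q' a b| * 1)); last first.
  by apply: ler_sum => a _; rewrite mulr1.
rewrite -mulr_suml; apply: ler_pM => //; last by rewrite semigroup_le1 // subr_ge0.
  by rewrite semigroup_ge0 // subr_ge0.
apply: (le_trans (ler_norm_sum _ _ _)); apply: ler_sum => a _.
have -> : (Q - Q') a b = Q a b - Q' a b by rewrite !mxE.
rewrite normrM -[leRHS]mul1r ler_wpM2r //.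
by rewrite ger0_norm ?semigroup_ge0 // semigroup_le1.
Qed.

End Semigroup.

(** * Laws, call prices and energy of a nearest-neighbour chain *)

Lemma ler_of_derive_ge0 (R : realType) (f df : R -> R) (a b : R) :
  a <= b -> (forall x : R, is_derive x 1 f (df x)) ->
  (forall x, a <= x <= b -> 0 <= df x) -> f a <= f b.
Proof.
move=> ab fd df0.
have [c cI] := MVT_segment ab (fun x _ => fd x)
  (continuous_subspaceT (fun x => is_derive_continuous (fd x))).
rewrite -subr_ge0 => ->; rewrite mulr_ge0 ?subr_ge0 // df0 //.
Qed.

Lemma bump0 n : bump 0 n = n.+1.
Proof. by []. Qed.

Section Laplacian.
Variables (R : realType) (m : nat) (i : 'I_m.+2 -> R).
Hypothesis i_incr : forall j k : 'I_m.+2, (j < k)%N -> i j < i k.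
Implicit Types (j k l : 'I_m.+2) (e : 'I_m.+1).

Definition lo e : 'I_m.+2 := widen_ord (leqnSn _) e.
Definition hi e : 'I_m.+2 := lift ord0 e.
Definition gap e : R := i (hi e) - i (lo e).
Definition grad e k : R := (k == hi e)%:R - (k == lo e)%:R.
(** The Laplacian of the path with vertices the states and conductance 1 / gap on each
    edge, in the form - grad^T (1/gap) grad, which makes it symmetric and negative
    semidefinite. Applied to a function it is, at an interior state, the jump of the
    slope of its piecewise linear interpolation. *)
Definition lapl j k : R := - \sum_e grad e j * grad e k / gap e.
Definition interior k : bool := (k != ord0) && (k != ord_max).

Lemma gap_gt0 e : 0 < gap e.
Proof. by rewrite subr_gt0; apply: i_incr; rewrite lift0. Qed.

Lemma i_le j k : (j <= k)%N -> i j <= i k.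
Proof.
by rewrite leq_eqVlt => /orP[/eqP/val_inj -> //|/i_incr/ltW].
Qed.

Lemma laplC j k : lapl j k = lapl k j.
Proof. by congr (- _); apply: eq_bigr => e _; rewrite [grad e j * _]mulrC. Qed.

Lemma grad_apply e (f : 'I_m.+2 -> R) : \sum_k grad e k * f k = f (hi e) - f (lo e).
Proof.
under eq_bigr do rewrite mulrBl.
rewrite sumrB (bigD1 (hi e)) //= [X in _ - X](bigD1 (lo e)) //= !eqxx !mul1r.
by rewrite !big1 ?addr0 // => k /negbTE ->; rewrite mul0r.
Qed.

Lemma lapl_apply j (f : 'I_m.+2 -> R) :
  \sum_k lapl j k * f k = - \sum_e grad e j * ((f (hi e) - f (lo e)) / gap e).
Proof.
under eq_bigr do rewrite mulNr mulr_suml.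
rewrite sumrN exchange_big /=; congr (- _); apply: eq_bigr => e _.
rewrite -grad_apply mulr_suml mulr_sumr; apply: eq_bigr => k _; ring.
Qed.

Lemma interiorP j : interior j -> exists a b, [/\ hi a = j, lo b = j, b = a.+1 :> nat &
  forall F : 'I_m.+1 -> R, \sum_e grad e j * F e = F a - F b].
Proof.
case/andP => j0 jm.
have j_gt0 : (0 < j)%N by rewrite lt0n.
have j_lt : (j < m.+1)%N.
  by rewrite ltn_neqAle -ltnS ltn_ord andbT; apply: contra jm => /eqP h; apply/eqP/val_inj.
have ja : (j.-1 < m.+1)%N by rewrite prednK // ltnW.
exists (Ordinal ja), (Ordinal j_lt); split.
- by apply: val_inj; rewrite /= bump0 prednK.
- exact: val_inj.
- by rewrite /= prednK.
move=> F; under eq_bigr do rewrite mulrBl.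
rewrite sumrB; congr (_ - _).
  rewrite (bigD1 (Ordinal ja)) //= big1 ?addr0 => [|e eN].
    by rewrite (_ : _ == _) ?mul1r //; apply/eqP/val_inj; rewrite /= bump0 prednK.
  rewrite (_ : _ == _ = false) ?mul0r //; apply: contraNF eN => /eqP jh.
  by apply/eqP/val_inj; rewrite /= jh.
rewrite (bigD1 (Ordinal j_lt)) //= big1 ?addr0 => [|e eN].
  by rewrite (_ : _ == _) ?mul1r //; apply/eqP/val_inj.
rewrite (_ : _ == _ = false) ?mul0r //; apply: contraNF eN => /eqP je.
by apply/eqP/val_inj; rewrite /= je.
Qed.

Lemma lapl_interior j a b (f : 'I_m.+2 -> R) : hi a = j -> lo b = j ->
  (forall F : 'I_m.+1 -> R, \sum_e grad e j * F e = F a - F b) ->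
  \sum_k lapl j k * f k = (f (hi b) - f j) / gap b - (f j - f (lo a)) / gap a.
Proof.
by move=> ha lb gE; rewrite lapl_apply gE ha lb opprB.
Qed.

Definition call l k : R := Num.max (i k - i l) 0.

Lemma callE l k : call l k = if (l <= k)%N then i k - i l else 0.
Proof.
rewrite /call; case: leqP => h; first by apply/max_idPl; rewrite subr_ge0 i_le.
by apply/max_idPr; rewrite subr_le0 i_le // ltnW.
Qed.

Lemma call_ge0 l k : 0 <= call l k.
Proof. by rewrite le_max lexx orbT. Qed.

Lemma call_le l k : call l k <= i ord_max - i ord0.
Proof.
rewrite ge_max subr_ge0 i_le // andbT; apply: lerB; first by apply: i_le; rewrite leq_ord.
exact: i_le.
Qed.

Lemma call_slope l e : (call l (hi e) - call l (lo e)) / gap e = (l <= e)%:R.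
Proof.
rewrite !callE /= bump0; case: (leqP l e) => [le|].
  by rewrite (leqW le) opprB addrA subrK divff // lt0r_neq0 // gap_gt0.
rewrite subr0 leq_eqVlt => /orP[/eqP le|le]; last by rewrite leqNgt le mul0r.
by rewrite -le leqnn (_ : l = hi e) ?subrr ?mul0r //; apply: val_inj; rewrite /= bump0.
Qed.

Lemma call_slope_strike k e :
  (call (hi e) k - call (lo e) k) / gap e = - (e < k)%:R.
Proof.
rewrite !callE /= bump0; case: ltnP => [ek|].
  rewrite (ltnW ek) (_ : _ - _ - _ = - gap e); last by rewrite /gap; ring.
  by rewrite mulNr divff // lt0r_neq0 // gap_gt0.
rewrite sub0r leq_eqVlt => /orP[/eqP ek|ek]; last by rewrite leqNgt ek oppr0 mul0r.
by rewrite -ek leqnn (_ : k = lo e) ?subrr ?oppr0 ?mul0r //; apply: val_inj.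
Qed.

(** As a function of the state, the payoff has slope 0 up to the strike and 1 after it. *)
Lemma lapl_call j l : interior j -> \sum_k lapl j k * call l k = (j == l)%:R.
Proof.
move=> /interiorP[a [b [ha lb ba gE]]]; rewrite lapl_apply.
under eq_bigr do rewrite call_slope.
rewrite gE opprB ba; have jE : j = a.+1 :> nat by rewrite -ha /= bump0.
rewrite -val_eqE /= jE; case: (ltngtP l a.+1) => h.
- by rewrite -[(l <= a)%N]ltnS h subrr.
- by rewrite leqNgt (ltnW h) subrr.
by rewrite h ltnn subr0.
Qed.

(** As a function of the strike, the payoff has slope -1 up to the state and 0 after it. *)
Lemma lapl_call_strike j k : interior j -> \sum_l lapl j l * call l k = (j == k)%:R.
Proof.
move=> /interiorP[a [b [ha lb ba gE]]]; rewrite lapl_apply.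
under eq_bigr do rewrite call_slope_strike.
rewrite gE opprB ba opprK addrC; have jE : j = a.+1 :> nat by rewrite -ha /= bump0.
rewrite -val_eqE /= jE; case: (ltngtP k a.+1) => h.
- by rewrite subrr.
- by rewrite subrr.
by rewrite subr0.
Qed.

Lemma lapl_const j c : \sum_k lapl j k * c = 0.
Proof.
by rewrite (lapl_apply j (fun=> c)) big1 ?oppr0 // => e _; rewrite subrr mul0r mulr0.
Qed.

Lemma lapl_linear j : interior j -> \sum_k lapl j k * i k = 0.
Proof.
move=> /interiorP[a [b [ha lb ba gE]]]; rewrite (lapl_interior _ ha lb gE).
have -> : i (hi b) - i j = gap b by rewrite /gap lb.
have -> : i j - i (lo a) = gap a by rewrite /gap ha.
by rewrite !divff ?subrr // lt0r_neq0 // gap_gt0.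
Qed.

Lemma lapl_ge0 j k : j != k -> 0 <= lapl j k.
Proof.
move=> jk; rewrite oppr_ge0; apply: sumr_le0 => e _.
rewrite mulr_le0_ge0 ?invr_ge0 ?(ltW (gap_gt0 _)) // /grad.
have hl : hi e != lo e by apply/eqP => /(congr1 val) /= /eqP; rewrite bump0 (gtn_eqF (ltnSn e)).
have [jh|_] := eqVneq j (hi e).
  rewrite jh (negbTE hl) subr0 mul1r; have [kh|_] := eqVneq k (hi e).
    by rewrite jh kh eqxx in jk.
  by rewrite sub0r oppr_le0.
have [jl|_] := eqVneq j (lo e); last by rewrite subrr mul0r.
have [kl|_] := eqVneq k (lo e); first by rewrite jl kl eqxx in jk.
by rewrite sub0r subr0 mulNr mul1r oppr_le0.
Qed.

Lemma lapl_form (y : 'I_m.+2 -> R) : \sum_k y k * (\sum_j y j * lapl j k) <= 0.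
Proof.
have -> : \sum_k y k * (\sum_j y j * lapl j k) =
    - \sum_e (y (hi e) - y (lo e)) ^+ 2 / gap e.
  under eq_bigr => k _.
    under eq_bigr do rewrite laplC mulrC.
    rewrite lapl_apply mulrN mulr_sumr; over.
  rewrite sumrN exchange_big /=; congr (- _); apply: eq_bigr => e _.
  rewrite expr2 -mulrA -[X in _ = X * _]grad_apply mulr_suml.
  by apply: eq_bigr => k _; ring.
rewrite oppr_le0; apply: sumr_ge0 => e _.
by rewrite mulr_ge0 ?sqr_ge0 // invr_ge0 ltW // gap_gt0.
Qed.

(** Multiplying row j by theta j is a change of speed: it affects how fast the chain
    leaves j, not where it goes. *)
Definition gen (theta : 'I_m.+2 -> R) : 'M[R]_m.+2 := \matrix_(j, k) (theta j * lapl j k).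

Lemma generator_gen theta : (forall j, 0 <= theta j) -> generator (gen theta).
Proof.
move=> th0; split=> [j k jk|j]; first by rewrite mxE mulr_ge0 ?lapl_ge0.
under eq_bigr do rewrite mxE.
by rewrite -mulr_sumr -[X in _ * X](eq_bigr _ (fun k _ => mulr1 (lapl j k))) lapl_const mulr0.
Qed.

Section Flow.
Variables (pi0 theta : 'I_m.+2 -> R).
Hypothesis pi0_ge0 : forall j, 0 <= pi0 j.
Hypothesis pi0_sum : \sum_j pi0 j = 1.
Hypothesis theta_ge0 : forall j, 0 <= theta j.
Hypothesis theta_end : forall j, ~~ interior j -> theta j = 0.

Definition law s k : R := \sum_j pi0 j * semigroup (gen theta) s j k.
Definition flow s j : R := theta j * law s j.

Lemma law0 k : law 0 k = pi0 k.
Proof.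
rewrite /law semigroup0 (bigD1 k) //= big1 => [|j jk]; last by rewrite mxE (negbTE jk) mulr0.
by rewrite mxE eqxx mulr1 addr0.
Qed.

Lemma law_ge0 s k : 0 <= s -> 0 <= law s k.
Proof.
by move=> s0; apply: sumr_ge0 => j _; rewrite mulr_ge0 ?semigroup_ge0 //; apply: generator_gen.
Qed.

Lemma law_sum s : \sum_k law s k = 1.
Proof.
rewrite exchange_big /= -[RHS]pi0_sum; apply: eq_bigr => j _.
by rewrite -mulr_sumr semigroup_sum1 ?mulr1 //; apply: generator_gen.
Qed.

Lemma law_le1 s k : 0 <= s -> law s k <= 1.
Proof.
move=> s0; rewrite -(law_sum s) (bigD1 k) //= lerDl.
by apply: sumr_ge0 => l _; apply: law_ge0.
Qed.

Lemma gen_fixed : gen theta *m (\col_k i k) = 0.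
Proof.
apply/matrixP => j k; rewrite mxE [RHS]mxE.
under eq_bigr do rewrite mxE [X in _ * X]mxE -mulrA.
rewrite -mulr_sumr; case: (boolP (interior j)) => [/lapl_linear -> |/theta_end ->].
  by rewrite mulr0.
by rewrite mul0r.
Qed.

Lemma semigroup_mean s j : \sum_k semigroup (gen theta) s j k * i k = i j.
Proof.
have /matrixP /(_ j ord0) := semigroup_fixed s gen_fixed.
rewrite mxE [RHS]mxE => h; rewrite -[RHS]h.
by apply: eq_bigr => k _; rewrite [X in _ = _ * X]mxE.
Qed.

Lemma law_mean s : \sum_k law s k * i k = \sum_k pi0 k * i k.
Proof.
under eq_bigr do rewrite mulr_suml.
rewrite exchange_big /=; apply: eq_bigr => j _.
rewrite -[in RHS](semigroup_mean s j) mulr_sumr; apply: eq_bigr => k _; ring.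
Qed.

Lemma is_derive_law k (s : R) :
  is_derive s 1 (fun s => law s k) (\sum_j flow s j * lapl j k).
Proof.
have -> : \sum_j flow s j * lapl j k =
    \sum_j (0 * semigroup (gen theta) s j k +
            pi0 j * (semigroup (gen theta) s *m gen theta) j k).
  under [RHS]eq_bigr do rewrite mul0r add0r mxE mulr_sumr.
  rewrite exchange_big /=; apply: eq_bigr => j _; rewrite /flow /law.
  rewrite mulr_sumr mulr_suml; apply: eq_bigr => l _; rewrite [gen _ _ _]mxE; ring.
apply: is_derive_sumR => j _; apply: is_derive_mulR (is_derive_semigroup_r _ _ _ _).
Qed.

Definition price s l : R := \sum_k law s k * call l k.

(** The second difference of the payoff with strike l is the unit mass at l, so the
    price at strike l moves with the flow at l alone: Tanaka's formula, with the flow as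
    the density of the expected local time. *)
Lemma is_derive_price l (s : R) : is_derive s 1 (fun s => price s l) (flow s l).
Proof.
have -> : flow s l = \sum_k ((\sum_j flow s j * lapl j k) * call l k + law s k * 0).
  under eq_bigr do rewrite mulr0 addr0 mulr_suml.
  rewrite exchange_big /= (bigD1 l) //= [X in _ + X]big1 ?addr0 => [|j jl].
    under eq_bigr do rewrite -mulrA.
    rewrite -mulr_sumr; case: (boolP (interior l)) => [/lapl_call -> |lN].
      by rewrite eqxx mulr1.
    by rewrite /flow theta_end // !mul0r.
  under eq_bigr do rewrite -mulrA.
  rewrite -mulr_sumr; case: (boolP (interior j)) => [/lapl_call -> |jN].
    by rewrite (negbTE jl) mulr0.
  by rewrite /flow theta_end // !mul0r.
apply: is_derive_sumR => k _; apply: is_derive_mulR (is_derive_law k s) _.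
Qed.

(** Weighted by theta so that its derivative is twice the quadratic form of [lapl] at
    the flow. *)
Definition energy s : R := \sum_j theta j * (law s j * law s j).

Lemma is_derive_energy (s : R) : is_derive s 1 energy
  (2 * \sum_k flow s k * (\sum_j flow s j * lapl j k)).
Proof.
have -> : 2 * \sum_k flow s k * (\sum_j flow s j * lapl j k) =
    \sum_k (0 * (law s k * law s k) + theta k *
      ((\sum_j flow s j * lapl j k) * law s k + law s k * \sum_j flow s j * lapl j k)).
  by rewrite mulr_sumr; apply: eq_bigr => k _; rewrite {1}/flow; ring.
apply: is_derive_sumR => k _; apply: is_derive_mulR.
by apply: is_derive_mulR; apply: is_derive_law.
Qed.

Lemma energy_nonincr s t : s <= t -> energy t <= energy s.
Proof.
move=> st; rewrite -lerN2.
apply: (@ler_of_derive_ge0 _ (fun s => - energy s)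
  (fun s => - (2 * \sum_k flow s k * (\sum_j flow s j * lapl j k)))) => //.
  by move=> x; apply: is_deriveN (is_derive_energy x).
by move=> x _; rewrite oppr_ge0 pmulr_rle0 // lapl_form.
Qed.

(** Law entries are at most 1, so the energy is below the total flow, the derivative of
    the sum of all call prices. That sum stays below (m + 2) (i_max - i_0), and the
    energy at earlier times is at least that at time t. The bound is uniform in theta. *)
Lemma energy_bound t : 0 <= t -> t * energy t <= m.+2%:R * (i ord_max - i ord0).
Proof.
move=> t0; pose h s := \sum_l price s l + s * (- energy t).
have dh (s : R) : is_derive s 1 h (\sum_l flow s l + (1 * (- energy t) + s * 0)).
  apply: is_deriveD; first by apply: is_derive_sumR => l _; apply: is_derive_price.
  exact: is_derive_mulR.
have : h 0 <= h t.
  apply: (ler_of_derive_ge0 t0 dh) => x /andP[x0 xt].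
  rewrite mul1r mulr0 addr0 subr_ge0; apply: (le_trans (energy_nonincr xt)).
  apply: ler_sum => l _; rewrite /flow ler_wpM2l //.
  by rewrite -[leRHS]mulr1 ler_wpM2l ?law_ge0 ?law_le1.
rewrite /h mul0r addr0 mulrN => h0.
have p0 : 0 <= \sum_l price 0 l.
  by apply: sumr_ge0 => l _; apply: sumr_ge0 => k _; rewrite mulr_ge0 ?law_ge0 ?call_ge0.
have pt : \sum_l price t l <= m.+2%:R * (i ord_max - i ord0).
  apply: (@le_trans _ _ (\sum_(l < m.+2) (i ord_max - i ord0))).
    apply: ler_sum => l _; rewrite /price -[leRHS]mul1r -(law_sum t) mulr_suml.
    by apply: ler_sum => k _; rewrite ler_wpM2l ?law_ge0 ?call_le.
  by rewrite sumr_const card_ord mulr_natl.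
lra.
Qed.

End Flow.
End Laplacian.

(** * Rates that reach a prescribed law *)

Section Rates.
Variables (R : realType) (m : nat) (i : 'I_m.+2 -> R).
Hypothesis i_incr : forall j k : 'I_m.+2, (j < k)%N -> i j < i k.
Variables (pi0 p : 'I_m.+2 -> R) (t : R).
Hypothesis pi0_ge0 : forall j, 0 <= pi0 j.
Hypothesis pi0_sum : \sum_j pi0 j = 1.
Hypothesis p_gt0 : forall j, 0 < p j.
Hypothesis p_sum : \sum_j p j = 1.
Hypothesis mean_eq : \sum_j pi0 j * i j = \sum_j p j * i j.
Hypothesis call_lt : forall l, interior l ->
  \sum_k pi0 k * call i l k < \sum_k p k * call i l k.
Hypothesis t_gt0 : 0 < t.

Local Notation Delta := (@simplex R m.+1).

(** [semigroup_lipschitz] needs nonnegative rates, which are at hand on the simplex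
    only; the filter F is to be that of neighbourhoods within the simplex. *)
Lemma cvg_semigroup_gen (T : Type) (F : set_system T) {FF : Filter F}
    (th : T -> 'I_m.+2 -> R) (th0 : 'I_m.+2 -> R) j k :
  (forall l, 0 <= th0 l) -> (\forall y \near F, forall l, 0 <= th y l) ->
  (forall l, th y l @[y --> F] --> th0 l) ->
  semigroup (gen i (th y)) t j k @[y --> F] --> semigroup (gen i th0) t j k.
Proof.
move=> th0_ge0 th_ge0 thc.
have gc a b : gen i (th y) a b @[y --> F] --> gen i th0 a b.
  by under eq_fun do rewrite mxE; rewrite mxE; apply: cvgMl; exact: thc.
have bc : t * \sum_a \sum_b `|gen i th0 a b - gen i (th y) a b| @[y --> F] -->
    t * \sum_(a < m.+2) \sum_(b < m.+2) `|gen i th0 a b - gen i th0 a b|.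
  apply: cvgMr; apply: cvg_sumR => a _; apply: cvg_sumR => b _; apply: cvg_norm.
  by apply: cvgB; [exact: cvg_cst|exact: gc].
rewrite big1 ?mulr0 in bc; last first.
  by move=> a _; rewrite big1 // => b _; rewrite subrr normr0.
apply/cvgrPdist_lt => e e0.
move/cvgrPdist_lt : bc => /(_ e e0); apply: filterS2 th_ge0 => y y_ge0.
rewrite sub0r normrN => ye.
apply: le_lt_trans (semigroup_lipschitz j k _ _ (ltW t_gt0)) _.
- exact: generator_gen.
- exact: generator_gen.
- by apply: le_lt_trans ye; apply: ler_norm.
Qed.

(** If theta l = 0 at an interior l, the price at strike l keeps its initial value,
    which is less than the price under p; this is how W > 0 arises there. *)
Lemma exists_rates : exists theta : 'I_m.+2 -> R,
  [/\ forall j, 0 <= theta j, forall j, ~~ interior j -> theta j = 0 &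
      forall k, law i pi0 theta t k = p k].
Proof.
have [d d_gt0 dP] : exists2 d, 0 < d & forall j, d <= p j.
  pose j0 := [arg min_(j < ord0) p j]%O.
  by exists (p j0) => // j; rewrite /j0; case: arg_minP => // u _; apply.
pose C := m.+2%:R * (i ord_max - i ord0).
have C0 : 0 <= C by rewrite mulr_ge0 // subr_ge0 i_le.
(* chosen so that t K d^2 > C, whereas t K d^2 <= t * energy <= C would follow if the
   slack coordinates were 0 *)
pose K := C / (t * d ^+ 2) + 1.
have K_gt0 : 0 < K by rewrite ltr_wpDl // divr_ge0 // mulr_ge0 ?sqr_ge0 // ltW.
pose theta (y : 'rV[R]_m.+2) l := if interior l then K * y ord0 l else 0.
have th0 y l : Delta y -> 0 <= theta y l.
  by case=> y0 _; rewrite /theta; case: ifP => // _; rewrite mulr_ge0 // ltW.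
have thE y l : ~~ interior l -> theta y l = 0 by rewrite /theta => /negbTE ->.
pose pit y k := law i pi0 (theta y) t k.
pose W y l := \sum_k (p k - pit y k) * call i l k.
have [|x xS xeq] := @simplex_equilibrium R m.+1 W.
  move=> x l xS; apply: cvg_sumR => k _; apply: cvgMl.
  apply: cvgB; first exact: cvg_cst.
  apply: cvg_sumR => j _; apply: cvgMr.
  apply: (cvg_semigroup_gen (th := theta)); first by move=> u; apply: th0.
    by rewrite near_withinE; apply: nearW => y yS u; apply: th0.
  move=> u; rewrite /theta; case: (interior u); last exact: cvg_cst.
  by apply: cvgMr; apply: cvg_within_filter; apply: coord_continuous.
have thx0 l : 0 <= theta x l by apply: th0.
exists (theta x); split=> //; first exact: thE.
have dsum : \sum_k (p k - pit x k) = 0 by rewrite sumrB p_sum law_sum ?subrr.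
have dmean : \sum_k (p k - pit x k) * i k = 0.
  under eq_bigr do rewrite mulrBl.
  by rewrite sumrB law_mean ?mean_eq ?subrr //; exact: thE.
have W0 : W x ord0 = 0.
  have -> : W x ord0 = \sum_k (p k - pit x k) * i k - (\sum_k (p k - pit x k)) * i ord0.
    rewrite mulr_suml -sumrB; apply: eq_bigr => k _.
    by rewrite callE // leq0n mulrBr.
  by rewrite dmean dsum mul0r subrr.
have Wm : W x ord_max = 0.
  apply: big1 => k _; rewrite callE //; case: ifP => [km|_]; last by rewrite mulr0.
  have -> : k = ord_max by apply/val_inj/eqP; rewrite /= eqn_leq km -ltnS ltn_ord.
  by rewrite subrr mulr0.
have Wgt0 l : interior l -> theta x l = 0 -> 0 < W x l.
  move=> il tl; rewrite /W; under eq_bigr do rewrite mulrBl.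
  rewrite sumrB subr_gt0; apply: le_lt_trans (call_lt il).
  have -> : \sum_k pit x k * call i l k = price i pi0 (theta x) 0 l.
    apply: (@is_derive_0_is_cst _ (fun s => price i pi0 (theta x) s l)) => s.
    have := is_derive_price i_incr pi0 (thE x) l s.
    by rewrite /flow tl mul0r.
  by apply: ler_sum => k _; rewrite law0.
(* second differences in the strike recover the difference of the laws from that of the
   prices *)
have lapW j : interior j -> \sum_l lapl i j l * W x l = p j - pit x j.
  move=> ij; under eq_bigr do rewrite mulr_sumr.
  rewrite exchange_big /= (bigD1 j) //= [X in _ + X]big1 ?addr0 => [|k kj].
    under eq_bigr do rewrite mulrCA.
    by rewrite -mulr_sumr lapl_call_strike // eqxx mulr1.
  under eq_bigr do rewrite mulrCA.
  by rewrite -mulr_sumr lapl_call_strike // eq_sym (negbTE kj) mulr0.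
have solved : (forall l, W x l <= 0) -> forall k, pit x k = p k.
  move=> Wle.
  have W_eq0 l : W x l = 0.
    case: (boolP (interior l)) => [il|]; last first.
      by rewrite /interior negb_and !negbK => /orP[]/eqP ->.
    have [tl|tl] := eqVneq (theta x l) 0.
      by have := Wgt0 l il tl; rewrite ltNge Wle.
    apply/eqP; rewrite eq_le Wle -W0 xeq //.
    move: tl; rewrite /theta il mulf_eq0 negb_or => /andP[_ xl].
    by rewrite lt0r xl /=; case: xS => h _; apply: h.
  have dint j : interior j -> p j - pit x j = 0.
    by move=> ij; rewrite -lapW // big1 // => l _; rewrite W_eq0 mulr0.
  have om : ord_max != ord0 :> 'I_m.+2 by [].
  have split2 (F : 'I_m.+2 -> R) : (forall j, interior j -> F j = 0) ->
      \sum_j F j = F ord0 + F ord_max.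
    move=> F0; rewrite (bigD1 ord0) //= (bigD1 ord_max) //= [X in _ + (_ + X)]big1 ?addr0 //.
  have s1 := dsum; rewrite split2 // in s1.
  have s2 := dmean; rewrite split2 in s2; last by move=> j /dint ->; rewrite mul0r.
  have im : i ord0 < i ord_max by apply: i_incr.
  have dm : p ord_max - pit x ord_max = 0.
    apply/eqP; have := s2.
    have -> : p ord0 - pit x ord0 = - (p ord_max - pit x ord_max) by lra.
    rewrite mulNr addrC -mulrBr => /eqP; rewrite mulf_eq0 => /orP[//|].
    by rewrite subr_eq0 gt_eqF.
  move=> k; apply/eqP; rewrite eq_sym -subr_eq0.
  case: (boolP (interior k)) => [/dint -> //|].
  rewrite /interior negb_and !negbK => /orP[]/eqP ->; last by rewrite dm.
  by move: s1; rewrite dm addr0 => ->.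
(* W vanishes at both ends, so positive slack at either end forces W <= 0 everywhere *)
have [x0|x0] := ltP 0 (x ord0 ord0).
  by apply: solved => l; rewrite -W0; apply: xeq.
have [xm|xm] := ltP 0 (x ord0 ord_max).
  by apply: solved => l; rewrite -Wm; apply: xeq.
exfalso.
have xend j : ~~ interior j -> x ord0 j = 0.
  case: xS => xge _; rewrite /interior negb_and !negbK => /orP[]/eqP ->;
  by apply/eqP; rewrite eq_le xge andbT.
have thK j : theta x j = K * x ord0 j.
  by rewrite /theta; case: ifPn => // /xend ->; rewrite mulr0.
(* W is at its maximum at j, so its slope does not increase there *)
have ple j : 0 < x ord0 j -> p j <= pit x j.
  move=> xj; have ij : interior j.
    by apply: contraLR xj => /xend ->; rewrite ltxx.
  rewrite -subr_le0 -lapW //; have [a [b [ha lb _ gE]]] := interiorP R ij.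
  rewrite (lapl_interior _ _ ha lb gE) subr_le0.
  apply: (@le_trans _ _ 0).
    by rewrite mulr_le0_ge0 ?invr_ge0 ?(ltW (gap_gt0 i_incr _)) // subr_le0 xeq.
  by rewrite mulr_ge0 ?invr_ge0 ?(ltW (gap_gt0 i_incr _)) // subr_ge0 xeq.
have Ebig : K * d ^+ 2 <= energy i pi0 (theta x) t.
  have -> : K * d ^+ 2 = \sum_j K * x ord0 j * d ^+ 2.
    by rewrite -mulr_suml -mulr_sumr; case: xS => _ ->; rewrite mulr1.
  apply: ler_sum => j _; rewrite thK.
  have xj0 : 0 <= x ord0 j by case: xS => h _; apply: h.
  have := xj0; rewrite le_eqVlt => /orP[/eqP <-|xj]; first by rewrite mulr0 !mul0r.
  rewrite ler_wpM2l ?mulr_ge0 ?(ltW K_gt0) // expr2.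
  have dj := le_trans (dP j) (ple j xj).
  by apply: ler_pM => //; apply: ltW.
have := energy_bound i_incr pi0_ge0 pi0_sum thx0 (thE x) (ltW t_gt0).
rewrite -/C leNgt => /negP; apply; apply: (@lt_le_trans _ _ (t * (K * d ^+ 2))).
  rewrite mulrCA /K mulrDl mul1r divfK; last by rewrite mulf_neq0 ?expf_neq0 ?lt0r_neq0.
  by rewrite ltrDl mulr_gt0 ?exprn_gt0.
by rewrite ler_pM2l.
Qed.

End Rates.

(** * Probabilities on words realised on the unit interval *)

Section WordProcess.
Variables (R : realType) (n : nat).
Local Notation A := 'I_n.+1.
Variable w : seq A -> R.
Implicit Types (x y : A) (s : seq A) (r : R).
Hypothesis w_ge0 : forall s, 0 <= w s.
Hypothesis w_nil : w [::] = 1.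
Hypothesis w_cons : forall s, w s = \sum_x w (x :: s).

(** Words are written with the last letter first. The interval of a word of length k is
    cut, from left to right, into the intervals of its extensions by 0, 1, ..., n. *)
Fixpoint left_end (s : seq A) : R :=
  if s is x :: s' then left_end s' + \sum_(y : A | (y < x)%N) w (y :: s') else 0.

Definition cell (s : seq A) : set R := [set` `[left_end s, left_end s + w s[].

(** The first extension whose interval ends after r; intervals of length zero are passed
    over. For r in the interval of s the default ord_max qualifies, since its interval
    ends with that of s. *)
Definition next (r : R) (s : seq A) : A :=
  [arg min_(x < ord_max | r < left_end (x :: s) + w (x :: s)) (x : nat)].

Fixpoint word (r : R) (k : nat) : seq A :=
  if k is k'.+1 then next r (word r k') :: word r k' else [::].

Lemma cellE s r : cell s r = (left_end s <= r < left_end s + w s) :> Prop.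
Proof. by rewrite /cell /mkset /= in_itv. Qed.

Lemma right_endE x s : left_end (x :: s) + w (x :: s) =
  left_end s + \sum_(y : A | (y <= x)%N) w (y :: s).
Proof.
rewrite /= -addrA; congr (_ + _); rewrite [RHS](bigD1 x) //= addrC; congr (_ + _).
by apply: eq_bigl => y; rewrite ltn_neqAle andbC.
Qed.

Lemma left_end_le x y s : (x < y)%N ->
  left_end (x :: s) + w (x :: s) <= left_end (y :: s).
Proof.
move=> xy; rewrite right_endE lerD2l [leRHS](bigID (fun z : A => (z <= x)%N)) /=.
rewrite (eq_bigl (fun z : A => (z < y)%N && (z <= x)%N)) ?lerDl ?sumr_ge0 // => z.
case: (leqP z x) => zx; rewrite ?andbF // andbT (leq_ltn_trans zx) //.
Qed.

Lemma left_end_ge x s : left_end s <= left_end (x :: s).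
Proof. by rewrite /= lerDl sumr_ge0. Qed.

Lemma right_end_le x s : left_end (x :: s) + w (x :: s) <= left_end s + w s.
Proof.
rewrite right_endE lerD2l w_cons [leRHS](bigID (fun z : A => (z <= x)%N)) /=.
by rewrite lerDl sumr_ge0.
Qed.

Lemma right_end_max s : left_end (ord_max :: s) + w (ord_max :: s) = left_end s + w s.
Proof.
by rewrite right_endE w_cons; congr (_ + _); apply: eq_bigl => x; rewrite leq_ord.
Qed.

Lemma cell_word r k : 0 <= r < 1 -> cell (word r k) r.
Proof.
move=> r01; elim: k => [|k]; first by rewrite /cell /= in_itv /= add0r w_nil.
rewrite /cell [word r k.+1]/=; set s := word r k; rewrite /= !in_itv /= => /andP[ls rs].
rewrite -[left_end s + _ as X in X <= _]/(left_end (next r s :: s)).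
rewrite -[X in _ < X]/(left_end (next r s :: s) + _).
rewrite /next; case: arg_minnP => [|x rx xmin]; first by rewrite right_end_max.
rewrite rx andbT; case: (posnP x) => x0.
  by rewrite /= big1 ?addr0 // => y; rewrite x0.
have x1 : (x.-1 < n.+1)%N by apply: leq_ltn_trans (ltn_ord x); rewrite leq_pred.
rewrite leNgt; apply/negP => rlt.
have := xmin (Ordinal x1); rewrite right_endE.
rewrite (eq_bigl (fun y : A => (y < x)%N)) => [/(_ rlt)/=|y]; last by rewrite -ltnS prednK.
by rewrite -ltnS prednK // ltnn.
Qed.

Lemma word_cell r s : 0 <= r < 1 -> cell s r -> word r (size s) = s.
Proof.
move=> r01; elim: s => [//|x s IH] xs.
have cs : cell s r.
  move: xs; rewrite !cellE => /andP[a b]; apply/andP; split.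
    exact: le_trans (left_end_ge x s) a.
  by apply: lt_le_trans (right_end_le x s).
have := cell_word (size s).+1 r01; rewrite /= (IH cs).
set y := next r s => ys; congr (_ :: _); move: xs ys.
rewrite !cellE => /andP[a b] /andP[c d].
apply/eqP; rewrite -val_eqE /=; case: ltngtP => // [yx|xy].
  by have := le_trans (left_end_le s yx) a; rewrite leNgt d.
by have := le_trans (left_end_le s xy) c; rewrite leNgt b.
Qed.

Lemma left_end_bounds s : 0 <= left_end s /\ left_end s + w s <= 1.
Proof.
elim: s => [|x s [IH0 IH1]]; first by rewrite /= w_nil add0r.
split; first exact: le_trans (left_end_ge x s).
exact: le_trans (right_end_le x s) _.
Qed.

Lemma measurable_next s x : measurable [set r : R | next r s = x].
Proof.
have mc y : measurable [set r : R | r < left_end (y :: s) + w (y :: s)].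
  have -> : [set r : R | r < left_end (y :: s) + w (y :: s)] =
      [set` `]-oo, left_end (y :: s) + w (y :: s)[] by apply/seteqP; split => r; rewrite /= in_itv.
  exact: measurable_itv.
pose test (r : R) := [ffun y : A => r < left_end (y :: s) + w (y :: s)].
pose sel (f : {ffun A -> bool}) : A := [arg min_(y < ord_max | f y) (y : nat)].
have -> : [set r | next r s = x] =
    \bigcup_(f in [set f | sel f = x]) [set r | test r = f].
  have nE r : next r s = sel (test r).
    rewrite /next /sel /arg_min; congr (odflt _ _); apply: eq_pick => y /=.
    rewrite /= ffunE; congr (_ && _); apply: eq_forallb => z; by rewrite ffunE.
  apply/seteqP; split => r /=; first by move=> rx; exists (test r); rewrite //= -nE.
  by move=> [f /= fx fr]; rewrite nE fr.
apply: fin_bigcup_measurable => [|f _]; first exact: finite_finset.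
have -> : [set r | test r = f] = \bigcap_(y in [set: A])
    (if f y then [set r : R | r < left_end (y :: s) + w (y :: s)]
     else ~` [set r : R | r < left_end (y :: s) + w (y :: s)]).
  apply/seteqP; split => r /=.
    move=> <- y _; rewrite ffunE; case: ifPn => //= /negP //.
  move=> h; apply/ffunP => y; rewrite ffunE; have := h y I.
  by case: (f y) => /= [//|/negP/negbTE].
apply: fin_bigcap_measurable => // y _; case: (f y); first exact: mc.
apply: measurableC; exact: mc.
Qed.

Lemma measurable_word s k : measurable [set r : R | word r k = s].
Proof.
elim: k s => [|k IH] [|x s] /=.
- by rewrite [X in measurable X](_ : _ = setT); [exact: measurableT|by apply/seteqP; split].
- by rewrite [X in measurable X](_ : _ = set0); [exact: measurable0|by apply/seteqP; split].
- by rewrite [X in measurable X](_ : _ = set0); [exact: measurable0|by apply/seteqP; split].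
rewrite [X in measurable X](_ : _ = [set r | word r k = s] `&` [set r | next r s = x]).
  exact: measurableI (measurable_next s x).
apply/seteqP; split => r /=; first by move=> [] <- <-.
by move=> [-> ->].
Qed.

Let P : probability (measurableTypeR R) R := uniform_prob (@ltr01 R).

Lemma uniform_itv a b : 0 <= a -> a <= b -> b <= 1 ->
  P [set` `[a, b[] = (b - a)%:E.
Proof.
move=> a0 ab b1; rewrite /P /= /uniform_prob (eq_integral (cst 1%E)); last first.
  move=> x; rewrite inE /= in_itv /= => /andP[ax xb].
  by rewrite /uniform_pdf (le_trans a0 ax) (le_trans (ltW xb) b1) subr0 invr1.
rewrite integral_cst //= mul1e lebesgue_measure_itv /= lte_fin.
by case: ltgtP ab => // -> _; rewrite subrr.
Qed.

Lemma prob_word s : P [set r | word r (size s) = s] = (w s)%:E.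
Proof.
have [l0 l1] := left_end_bounds s.
have cs : P (cell s) = (w s)%:E.
  by rewrite /cell uniform_itv // ?lerDl // addrC addKr.
have mc : measurable (cell s) by exact: measurable_itv.
pose I01 : set (measurableTypeR R) := [set` `[0 : R, 1[].
have m01 : measurable I01 by exact: measurable_itv.
have mw := measurable_word s (size s).
have P01 : P (~` I01) = 0%E.
  by rewrite probability_setC // uniform_itv // subr0 subee.
have cell01 : cell s `<=` I01.
  move=> r; rewrite cellE /I01 /mkset /= in_itv /= => /andP[a b].
  by rewrite (le_trans l0 a) (lt_le_trans b l1).
rewrite -cs; apply/eqP; rewrite eq_le; apply/andP; split.
  apply: (@le_trans _ _ (P (cell s `|` ~` I01))); last first.
    have : (P (cell s `|` ~` I01) <= P (cell s) + P (~` I01))%E.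
      exact: measureU2 (measurableC m01).
    by rewrite P01 adde0.
  apply: le_measure; rewrite ?inE //.
    by apply: measurableU => //; apply: measurableC.
  move=> r /= rs; case: (boolP (0 <= r < 1)) => r01; [left|right].
    by have := cell_word (size s) r01; rewrite rs.
  by rewrite /I01 /= in_itv /=; apply/negP.
apply: le_measure; rewrite ?inE // => r rc; apply: word_cell => //.
by have := cell01 _ rc; rewrite /I01 /= in_itv.
Qed.

(** Kolmogorov's extension theorem for a sequence of letters from a finite alphabet: a
    uniform point is read through the nested intervals. *)
Lemma word_process : exists (d : measure_display) (T : measurableType d)
    (P : probability T R) (Z : nat -> T -> A),
  (forall k x, measurable [set r | Z k r = x]) /\
  (forall s, P [set r | [seq Z k r | k <- rev (iota 0 (size s))] = s] = (w s)%:E).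
Proof.
exists _, _, P, (fun k r => head ord0 (word r k.+1)); split=> [k x|s].
  have -> : [set r | head ord0 (word r k.+1) = x] =
      \bigcup_s [set r : R | word r k.+1 = x :: s].
    apply/seteqP; split => r /=; first by move=> <-; exists (word r k).
    by move=> [s _ /= []].
  by apply: countable_bigcupT_measurable => [|s]; [|exact: measurable_word].
have wordE r k : [seq head ord0 (word r l.+1) | l <- rev (iota 0 k)] = word r k.
  by elim: k => [//|k IH]; rewrite -[X in iota 0 X]addn1 iotaD rev_cat /= IH.
rewrite -prob_word; congr (P _).
by apply/seteqP; split => r; rewrite /mkset wordE.
Qed.

End WordProcess.

(** * Probabilities as real numbers *)

Section RealProbability.
Context {d : measure_display} {T : measurableType d} {R : realType}.
Variable P : probability T R.
Implicit Types A B E : set T.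

Definition pr A : R := fine (P A).

Lemma prE A : measurable A -> P A = (pr A)%:E.
Proof. by move=> mA; rewrite /pr fineK // fin_num_measure. Qed.

Lemma pr_ge0 A : 0 <= pr A.
Proof. exact/fine_ge0/measure_ge0. Qed.

Lemma pr_setT : pr setT = 1.
Proof. by rewrite /pr probability_setT. Qed.

Lemma pr_set0 : pr set0 = 0.
Proof. by rewrite /pr measure0. Qed.

Lemma pr_le A B : measurable A -> measurable B -> A `<=` B -> pr A <= pr B.
Proof.
by move=> mA mB AB; rewrite -lee_fin -!prE // le_measure // inE.
Qed.

Lemma pr_setD A B : measurable A -> measurable B -> B `<=` A ->
  pr (A `\` B) = pr A - pr B.
Proof.
move=> mA mB BA; apply: EFin_inj; rewrite EFinB -!prE //; last exact: measurableD.
by rewrite measureD ?setIidr // ltey_eq fin_num_measure.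
Qed.

Lemma pr_setC A : measurable A -> pr (~` A) = 1 - pr A.
Proof. by move=> mA; rewrite -setTD pr_setD // pr_setT. Qed.

Lemma pr_cvg_nd (F : (set T)^nat) : (forall k, measurable (F k)) ->
  nondecreasing_seq F -> pr (F k) @[k --> \oo] --> pr (\bigcup_k F k).
Proof.
move=> mF ndF; have mU : measurable (\bigcup_k F k) by exact: bigcupT_measurable.
have : P (F k) @[k --> \oo] --> P (\bigcup_k F k) := nondecreasing_cvg_mu mF mU ndF.
rewrite prE //; by move/fine_cvgP => [].
Qed.

Lemma pr_split (S : finType) (f : T -> S) A : measurable A ->
  (forall y, measurable [set r | f r = y]) ->
  pr A = \sum_y pr (A `&` [set r | f r = y]).
Proof.
move=> mA mf; apply: EFin_inj; rewrite -prE // -sumEFin.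
have AE : A = \bigcup_(y in [set: S]) (A `&` [set r | f r = y]).
  by apply/seteqP; split => r /= => [Ar|[y _ []//]]; exists (f r).
rewrite {1}AE measure_fin_bigcup //=.
- have -> : [set: S] = [set` index_enum S] by apply/seteqP; split=> y //= _; exact: mem_index_enum.
  rewrite -fsbig_seq ?index_enum_uniq //; apply: eq_bigr => y _.
  exact/prE/measurableI/mf.
- by move=> y z _ _ [r [[_ <-] [_ <-]]].
- by move=> y _; exact: measurableI.
Qed.

Lemma pr_setI_full A G : measurable A -> measurable G -> pr G = 1 ->
  pr (A `&` G) = pr A.
Proof.
move=> mA mG G1; apply/eqP; rewrite eq_le pr_le //; last exact: measurableI.
have h : pr (A `\` G) <= 0.
  rewrite -[leRHS](subrr 1) -[X in _ - X]G1 -pr_setC //.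
  by apply: pr_le; [exact: measurableD|exact: measurableC|move=> r []].
have -> : A `&` G = A `\` (A `\` G) by rewrite setDD.
rewrite pr_setD; [|by []|exact: measurableD|by move=> r []].
by rewrite lerDl oppr_ge0.
Qed.

(** Dominated convergence for indicators that are eventually equal to a limit indicator
    on a set of full measure. It carries every identity from the dense times to all
    times. *)
Lemma pr_ae_cvg (E : (set T)^nat) (E0 G : set T) :
  (forall k, measurable (E k)) -> measurable E0 -> measurable G -> pr G = 1 ->
  (forall r, G r -> \forall k \near \oo, E k r <-> E0 r) ->
  pr (E k) @[k --> \oo] --> pr E0.
Proof.
move=> mE mE0 mG G1 EE.
have prI A : measurable A -> (pr A)%:E = (\int[P]_r (\1_(A `&` G) r)%:E)%E.
  move=> mA; have mAG := measurableI _ _ mA mG.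
  have -> : (pr A)%:E = P (A `&` G) by rewrite prE ?pr_setI_full.
  by rewrite integral_indic ?setIT.
have : (pr (E k))%:E @[k --> \oo] --> (pr E0)%:E; last by move/fine_cvgP => [].
under eq_fun do rewrite prI //; rewrite prI //.
apply: (@dominated_cvg _ _ _ _ _ measurableT _ _ (cst 1%E)) => //.
- move=> k; apply/measurable_EFinP; apply: measurable_indic; exact: measurableI.
- move=> r _; apply: cvg_near_cst; case: (pselect (G r)) => Gr; last first.
    by apply: nearW => k; rewrite !indicE !memNset // => -[].
  apply: filterS (EE r Gr) => k Er; congr (_%:E); rewrite !indicE; congr (_%:R).
  by congr (nat_of_bool _); apply/idP/idP; rewrite !inE => -[/Er ? ?].
- exact: finite_measure_integrable_cst.
- by move=> k r _; rewrite indicE gee0_abs ?lee_fin // lern1 leq_b1.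
Qed.

(** The Markov property has this form, with E1 the event of being in j and then in y, E2
    the event of being in j, and c the transition probability; it is checked on
    cylinders only. *)
Lemma pi_lambda_pr (G : set (set T)) (E1 E2 : set T) (c : R) :
  measurable E1 -> measurable E2 -> setI_closed G -> G setT ->
  G `<=` measurable ->
  (forall C, G C -> pr (C `&` E1) = c * pr (C `&` E2)) ->
  forall C, <<s G >> C -> measurable C /\ pr (C `&` E1) = c * pr (C `&` E2).
Proof.
move=> mE1 mE2 GI GT Gm GE.
pose H := [set C : set T | measurable C /\ pr (C `&` E1) = c * pr (C `&` E2)].
apply: (@lambda_system_subset _ G GI setT H) => //.
- split=> //.
  + by split; [exact: measurableT|exact: GE].
  + move=> A B BA [mA eA] [mB eB]; split; first exact: measurableD.
    have DI E : (A `\` B) `&` E = (A `&` E) `\` (B `&` E).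
      apply/seteqP; split => r /=; first by move=> [[Ar nB] Er]; split=> // -[].
      by move=> [[Ar Er] nB]; split=> //; split=> // Br; apply: nB.
    by rewrite !DI !pr_setD ?eA ?eB ?mulrBr //; do ?[exact: measurableI|exact: setSI].
  + move=> F ndF HF; have mF k : measurable (F k) by case: (HF k).
    split; first exact: bigcupT_measurable.
    rewrite !setI_bigcupl.
    have cF E : measurable E -> pr (F k `&` E) @[k --> \oo] --> pr (\bigcup_k (F k `&` E)).
      move=> mE; apply: pr_cvg_nd => [k|k l kl]; first exact: measurableI.
      by rewrite subsetEset; apply: setSI; rewrite -subsetEset; apply: ndF.
    apply: (cvg_unique _ (cF _ mE1)) => //.
    have -> : (fun k => pr (F k `&` E1)) = (fun k => c * pr (F k `&` E2)).
      by apply/funext => k; case: (HF k).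
    by apply: cvgMr; exact: cF.
- by move=> C GC; split; [exact: Gm|exact: GE].
Qed.

End RealProbability.

(** * The chain along a dense sequence of times *)

(** Exponentials of the rationals. They are positive, so that the state at time 0 is a
    limit from the right like that at any other time. *)
Lemma dense_times (R : realType) : exists e : nat -> R,
  [/\ injective e, forall k, 0 < e k & forall a b, 0 <= a -> a < b -> exists k, a < e k < b].
Proof.
have : ([set: nat] #= [set: rat])%card by rewrite card_eq_sym; exact: card_rat.
move=> /card_set_bijP [f [_ finj fsurj]].
exists (fun k => expR (ratr (f k))); split=> [k l|k|a b a0 ab].
- by move/expR_inj/fmorph_inj; apply: finj; rewrite inE.
- exact: expR_gt0.
pose a' := (a + b) / 2.
have aa' : a < a' by rewrite /a'; lra.
have a'b : a' < b by rewrite /a'; lra.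
have a'0 : 0 < a' by apply: le_lt_trans aa'.
have : ln a' < ln b by rewrite ltr_ln ?posrE // (lt_trans a'0).
move=> /rat_in_itvoo[q]; rewrite in_itv /= => /andP[aq qb].
have [k _ fk] := fsurj q I; exists k; rewrite fk; apply/andP; split.
  by apply: (lt_trans aa'); rewrite -[X in X < _]lnK ?posrE // ltr_expR.
by rewrite -[X in _ < X]lnK ?posrE ?(lt_trans a'0) // ltr_expR.
Qed.

Section Skeleton.
Variables (R : realType) (n : nat) (Q : 'M[R]_n.+1) (pi0 : 'I_n.+1 -> R).
Local Notation S := 'I_n.+1.
Hypothesis gQ : generator Q.
Hypothesis pi0_ge0 : forall x, 0 <= pi0 x.
Hypothesis pi0_sum : \sum_x pi0 x = 1.
Variable e : nat -> R.
Hypothesis e_inj : injective e.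
Hypothesis e_gt0 : forall k, 0 < e k.
Implicit Types (J L : seq nat) (z : nat -> S).

Definition earlier : rel nat := [rel k l | e k <= e l].

(** The weight of passing through the states z k at the times e k, k in L in this order,
    for a path that is at x at time s. *)
Fixpoint path_weight (s : R) (x : S) (z : nat -> S) (L : seq nat) : R :=
  if L is k :: L' then
    semigroup Q (e k - s) x (z k) * path_weight (e k) (z k) z L'
  else 1.

Definition fdd z L : R := \sum_x pi0 x * path_weight 0 x z L.

Definition upd z k y : nat -> S := fun l => if l == k then y else z l.

Lemma path_weight_ext s x z z' L : {in L, z =1 z'} ->
  path_weight s x z L = path_weight s x z' L.
Proof.
elim: L s x => [//|k L IH] s x zz /=.
rewrite zz ?mem_head // IH // => l lL; apply: zz; by rewrite inE lL orbT.
Qed.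

Lemma fdd_ext z z' L : {in L, z =1 z'} -> fdd z L = fdd z' L.
Proof. by move=> zz; apply: eq_bigr => x _; rewrite (path_weight_ext _ _ zz). Qed.

(** Chapman-Kolmogorov: summing over the state at time e k merges the two adjacent
    transitions, or removes the last one. *)
Lemma path_weight_marginal s x z k L : uniq L -> k \in L ->
  \sum_y path_weight s x (upd z k y) L = path_weight s x z (rem k L).
Proof.
elim: L s x => [//|l L IH] s x /= /andP[lL uL]; rewrite inE.
have [->|kl] /= := eqVneq k l.
  move=> _; rewrite ?eqxx.
  have updE y : {in L, upd z l y =1 z}.
    by move=> a aL; rewrite /upd; case: eqVneq => // al; rewrite -al aL in lL.
  under eq_bigr => y _ do rewrite {1 2}/upd eqxx (path_weight_ext _ _ (updE y)).
  case: L {IH lL uL updE} => [|b L] /=.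
    by under eq_bigr do rewrite mulr1; apply: semigroup_sum1.
  under eq_bigr do rewrite mulrA; rewrite -mulr_suml; congr (_ * _).
  have -> : e b - s = (e l - s) + (e b - e l) by ring.
  by rewrite (semigroupD Q (e l - s)) [RHS]mxE.
move=> kL.
under eq_bigr => y _ do rewrite {1 2}/upd eq_sym (negbTE kl).
by rewrite -mulr_sumr IH.
Qed.

Lemma fdd_marginal z k L : uniq L -> k \in L ->
  \sum_y fdd (upd z k y) L = fdd z (rem k L).
Proof.
move=> uL kL; rewrite exchange_big /=; apply: eq_bigr => x _.
by rewrite -mulr_sumr path_weight_marginal.
Qed.

Lemma path_weight_ge0 s x z L :
  (forall k, k \in L -> s <= e k) -> sorted earlier L -> 0 <= path_weight s x z L.
Proof.
elim: L s x => [//|k L IH] s x sL /= pL.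
rewrite mulr_ge0 //; first by rewrite semigroup_ge0 // subr_ge0 sL // mem_head.
apply: IH; last exact: path_sorted pL.
have tr : transitive earlier by move=> a b c /= ab bc; apply: le_trans ab bc.
by move=> l lL; have /allP := order_path_min tr pL; apply.
Qed.

Lemma path_weight_rcons s x z L a b :
  path_weight s x z (rcons (rcons L a) b) =
  path_weight s x z (rcons L a) * semigroup Q (e b - e a) (z a) (z b).
Proof.
elim: L s x => [|k L IH] s x /=; first by rewrite !mulr1.
by rewrite IH mulrA.
Qed.

Lemma fdd_rcons z L a b : fdd z (rcons (rcons L a) b) =
  fdd z (rcons L a) * semigroup Q (e b - e a) (z a) (z b).
Proof.
rewrite /fdd mulr_suml; apply: eq_bigr => x _.
by rewrite path_weight_rcons mulrA.
Qed.

Lemma earlier_total : total earlier. Proof. by move=> a b; apply: le_total. Qed.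

Lemma earlier_trans : transitive earlier.
Proof. by move=> a b c /= ab bc; apply: le_trans ab bc. Qed.

Lemma earlier_anti : antisymmetric earlier.
Proof. by move=> a b /= /le_anti /e_inj. Qed.

Definition chron L := sort earlier L.

Lemma chron_sorted L : sorted earlier (chron L).
Proof. exact: sort_sorted earlier_total _. Qed.

Lemma chronE L L' : sorted earlier L -> perm_eq L' L -> chron L' = L.
Proof.
move=> sL pL; apply: (sorted_eq earlier_trans earlier_anti) => //.
  exact: chron_sorted.
by rewrite perm_sort.
Qed.

Lemma rem_chron k L : uniq (k :: L) -> rem k (chron (k :: L)) = chron L.
Proof.
move=> u; apply/esym/chronE.
  apply: (subseq_sorted earlier_trans (rem_subseq _ _)); exact: chron_sorted.
rewrite -(perm_cons k) (perm_trans _ (perm_to_rem _)) //.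
  by rewrite perm_sym perm_sort.
by rewrite mem_sort mem_head.
Qed.

(** The indices of e do not follow the order of time, so the letters of a word, which
    come by index and last letter first, are sorted by time before the transitions are
    multiplied. *)
Definition word_weight (s : seq S) : R :=
  fdd (fun k => nth ord0 (rev s) k) (chron (iota 0 (size s))).

Lemma word_weight_ge0 s : 0 <= word_weight s.
Proof.
apply: sumr_ge0 => x _; rewrite mulr_ge0 //.
by apply: path_weight_ge0 => // [k _|]; [exact: ltW|exact: chron_sorted].
Qed.

Lemma word_weight_nil : word_weight [::] = 1.
Proof. by rewrite /word_weight /fdd /=; under eq_bigr do rewrite mulr1. Qed.

Lemma iotaSr k : iota 0 k.+1 = rcons (iota 0 k) k.
Proof. by rewrite -[k.+1]addn1 iotaD cats1. Qed.

Lemma word_weight_cons s : word_weight s = \sum_x word_weight (x :: s).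
Proof.
rewrite /word_weight /=.
set N := size s; set z := fun k => nth ord0 (rev s) k.
have pm : perm_eq (iota 0 N.+1) (N :: iota 0 N) by rewrite iotaSr perm_rcons.
have cE : chron (iota 0 N.+1) = chron (N :: iota 0 N).
  by apply: chronE; rewrite ?chron_sorted // perm_sym perm_sort perm_sym.
have uN : uniq (N :: iota 0 N) by rewrite -(perm_uniq pm) iota_uniq.
rewrite -(rem_chron uN) -fdd_marginal; last 2 first.
- by rewrite sort_uniq.
- by rewrite mem_sort mem_head.
apply: eq_bigr => x _; rewrite cE; apply: fdd_ext => k.
rewrite mem_sort -(perm_mem pm) mem_iota add0n ltnS => /= kN.
rewrite /upd rev_cons nth_rcons size_rev -/N.
have [->|kN'] := eqVneq k N; first by rewrite ltnn ?eqxx.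
by rewrite ltn_neqAle kN' kN.
Qed.

Context {d : measure_display} {T : measurableType d}.
Variables (P : probability T R) (Z : nat -> T -> S).
Hypothesis mZ : forall k x, measurable [set r | Z k r = x].
Hypothesis Zlaw : forall s,
  P [set r | [seq Z k r | k <- rev (iota 0 (size s))] = s] = (word_weight s)%:E.

(** Cylinder events. Only the entries z k with k in J matter, which is what lets [upd]
    prescribe the state at one more index. *)
Definition ev J z : set T := [set r | forall k, k \in J -> Z k r = z k].

Lemma ev_cons k J z : ev (k :: J) z = ev J z `&` [set r | Z k r = z k].
Proof.
apply/seteqP; split => r /=.
  move=> h; split; last by apply: h; rewrite mem_head.
  by move=> l lJ; apply: h; rewrite inE lJ orbT.
by move=> [h hk] l; rewrite inE => /orP[/eqP -> //|/h].
Qed.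

Lemma measurable_ev J z : measurable (ev J z).
Proof.
elim: J => [|k J IH]; last by rewrite ev_cons; apply: measurableI.
by rewrite (_ : ev _ _ = setT) //; apply/seteqP; split.
Qed.

Lemma ev_ext J J' z z' : J =i J' -> {in J, z =1 z'} -> ev J z = ev J' z'.
Proof.
move=> JJ zz; apply/seteqP; split => r /= h k kJ.
  by rewrite -zz ?JJ // h // JJ.
by rewrite zz // h // -JJ.
Qed.

(** Words fix the states at an initial segment of indices. For a general index set,
    induction on the number of indices below N that are missing: the state at a missing
    index is summed out. *)
Lemma pr_ev J z : uniq J -> pr P (ev J z) = fdd z (chron J).
Proof.
move=> uJ; pose N := (\max_(k <- J) k).+1.
have subN L : {in L, forall k, (k < N)%N} -> {subset L <= iota 0 N}.
  by move=> LN k kL; rewrite mem_iota add0n LN.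
suff gen c : forall L z', uniq L -> {in L, forall k, (k < N)%N} ->
    (size L + c = N)%N -> pr P (ev L z') = fdd z' (chron L).
  have JN : {in J, forall k, (k < N)%N}.
    by move=> k kJ; rewrite ltnS; apply: leq_bigmax_seq.
  apply: (gen (N - size J)%N) => //; rewrite subnKC //.
  by have := uniq_leq_size uJ (subN _ JN); rewrite size_iota.
elim: c => [|c IH] L z' uL LN sL.
  rewrite addn0 in sL.
  have [_ Lmem] : (size L = size (iota 0 N)) * (L =i iota 0 N).
    by apply: uniq_min_size => //; [exact: subN|rewrite size_iota sL].
  pose s := [seq z' k | k <- rev (iota 0 N)].
  have sN : size s = N by rewrite size_map size_rev size_iota.
  have -> : ev L z' = [set r | [seq Z k r | k <- rev (iota 0 (size s))] = s].
    rewrite sN; apply/seteqP; split => r /=.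
      by move=> h; apply/eq_in_map => k; rewrite mem_rev -Lmem => /h.
    by move=> /eq_in_map h k kL; apply: h; rewrite mem_rev -Lmem.
  rewrite /pr Zlaw /= /word_weight sN.
  have -> : chron (iota 0 N) = chron L.
    apply: chronE; first exact: chron_sorted.
    by rewrite perm_sym perm_sort; apply: uniq_perm => //; exact: iota_uniq.
  apply: fdd_ext => k; rewrite mem_sort => kL.
  rewrite /s map_rev revK (nth_map 0%N) ?size_iota ?LN //.
  by rewrite nth_iota ?LN.
have /allPn[k kN kL] : ~~ all (fun k => k \in L) (iota 0 N).
  apply/negP => /allP h; have := uniq_leq_size (iota_uniq 0 N) h.
  by rewrite size_iota -sL leqNgt addnS ltnS leq_addr.
rewrite mem_iota add0n /= in kN.
have ukL : uniq (k :: L) by rewrite /= kL.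
rewrite (pr_split P (measurable_ev L z') (mZ k)) -(rem_chron ukL) -fdd_marginal; last 2 first.
- by rewrite sort_uniq.
- by rewrite mem_sort mem_head.
apply: eq_bigr => y _; rewrite -IH //; last by rewrite /= addSnnS.
  rewrite ev_cons {2}/upd eqxx; congr (pr P (_ `&` _)); apply: ev_ext => // l lL.
  by rewrite /upd; case: eqVneq => // lk; rewrite -lk lL in kL.
by move=> l; rewrite inE => /orP[/eqP ->//|/LN].
Qed.

Lemma ev_undup J z : ev J z = ev (undup J) z.
Proof. by apply: ev_ext => // k; rewrite mem_undup. Qed.

(** a and b are later than all of J, so they are the last two entries once sorted, and
    the weight splits off the last transition. *)
Lemma ev_markov J z a b j y : (forall k, k \in J -> e k < e a) -> e a < e b ->
  pr P (ev J z `&` ([set r | Z a r = j] `&` [set r | Z b r = y])) =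
  semigroup Q (e b - e a) j y * pr P (ev J z `&` [set r | Z a r = j]).
Proof.
move=> Ja ab; rewrite ev_undup.
have {}Ja k : k \in undup J -> e k < e a by rewrite mem_undup; apply: Ja.
move: (undup_uniq J) Ja; set L := undup J => uL La.
have aL : a \notin L by apply/negP => /La; rewrite ltxx.
have ba : (b == a) = false.
  by apply/negP => /eqP ba; move: ab; rewrite ba ltxx.
have bL : b \notin L by apply/negP => /La /(lt_trans ab); rewrite ltxx.
pose z' := upd (upd z a j) b y.
have z'a : z' a = j by rewrite /z' /upd eq_sym ba eqxx.
have z'b : z' b = y by rewrite /z' /upd eqxx.
have z'L : {in L, z =1 z'}.
  move=> k kL; rewrite /z' /upd; case: eqVneq => [kb|_]; first by rewrite -kb kL in bL.
  by case: eqVneq => // ka; rewrite -ka kL in aL.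
have evL : ev L z = ev L z' by apply: ev_ext.
have -> : ev L z `&` ([set r | Z a r = j] `&` [set r | Z b r = y]) = ev (b :: a :: L) z'.
  by rewrite !ev_cons z'a z'b evL setIA.
have -> : ev L z `&` [set r | Z a r = j] = ev (a :: L) z' by rewrite ev_cons z'a evL.
have uaL : uniq (a :: L) by rewrite /= aL.
have ubaL : uniq (b :: a :: L) by rewrite cons_uniq inE ba (negbTE bL).
have srcons M l : sorted earlier M -> {in M, forall k, e k < e l} -> sorted earlier (rcons M l).
  rewrite !(sorted_pairwise earlier_trans) pairwise_rcons => -> Ml.
  by rewrite andbT; apply/allP => k /Ml /ltW.
have sLa : sorted earlier (rcons (chron L) a).
  by apply: srcons => [|k]; [exact: chron_sorted|rewrite mem_sort => /La].
rewrite !pr_ev //.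
have -> : chron (a :: L) = rcons (chron L) a.
  by apply: chronE => //; rewrite perm_sym perm_rcons perm_cons perm_sort.
have -> : chron [:: b, a & L] = rcons (rcons (chron L) a) b.
  apply: chronE.
    apply: srcons => // k; rewrite mem_rcons inE mem_sort => /orP[/eqP -> //|/La ka].
    exact: lt_trans ka ab.
  rewrite perm_sym perm_rcons perm_cons perm_rcons perm_cons.
  by rewrite perm_sort.
by rewrite fdd_rcons z'a z'b mulrC.
Qed.

End Skeleton.

(** * Paths with few changes *)

Section Changes.
Variables (R : realType) (S : eqType) (e : nat -> R).
Hypothesis e_inj : injective e.
Hypothesis e_gt0 : forall k, 0 < e k.
Hypothesis e_dense : forall a b : R, 0 <= a -> a < b -> exists k, a < e k < b.
Implicit Types (f : nat -> S) (L M : seq nat) (a b c k : nat).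

Fixpoint changes_from f a L : nat :=
  if L is b :: L' then (f a != f b) + changes_from f b L' else 0%N.

Definition changes f L : nat := if L is a :: L' then changes_from f a L' else 0%N.

(** Inserting a time never decreases the number of changes: the triangle inequality for
    the discrete metric. *)
Lemma changes_from_skip f a b L :
  (changes_from f a L <= (f a != f b) + changes_from f b L)%N.
Proof.
case: L => [//|c L] /=; rewrite addnA leq_add2r.
have [ab|] := eqVneq (f a) (f b); first by rewrite ab.
by case: (f a != f c) => //=; rewrite add1n.
Qed.

Lemma changes_from_subseq f a L M : subseq L M ->
  (changes_from f a L <= changes_from f a M)%N.
Proof.
elim: M a L => [|b M IH] a [|c L] //=.
have [-> /IH h|_ /IH h] := eqVneq c b; first by rewrite leq_add2l.
by apply: leq_trans (changes_from_skip f a b (c :: L)) _; rewrite leq_add2l.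
Qed.

Lemma changes_subseq f L M : subseq L M -> (changes f L <= changes f M)%N.
Proof.
elim: M L => [|b M IH] [|c L] //=.
have [->|_ /IH h] := eqVneq c b; first exact: changes_from_subseq.
apply: (leq_trans h); case: M {IH h} => [//|d M] /=; exact: leq_addl.
Qed.

Lemma changes_cat2 f L a b : (changes f L + (f a != f b) <= changes f (L ++ [:: a; b]))%N.
Proof.
case: L => [|c L] /=; first by rewrite addn0.
elim: L c => [|d L IH] c /=; first by rewrite addn0 leq_addl.
by rewrite -addnA leq_add2l.
Qed.

Definition times_upto (m K : nat) : seq nat :=
  sort (earlier e) [seq k <- iota 0 K | e k <= m%:R].

Definition few_changes f := forall m, exists C, forall K,
  (changes f (times_upto m K) < C)%N.

Lemma times_upto_subseq L m K : sorted (earlier e) L -> uniq L ->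
  {in L, forall k, (k < K)%N} -> {in L, forall k, e k <= m%:R} ->
  subseq L (times_upto m K).
Proof.
move=> sL uL LK Lm.
suff -> : L = [seq k <- times_upto m K | k \in L] by exact: filter_subseq.
have sT : sorted (earlier e) (times_upto m K) by exact: sort_sorted (earlier_total e) _.
apply: (sorted_eq (@earlier_trans _ e) (earlier_anti e_inj)) => //.
  exact: sorted_filter (@earlier_trans _ e) _ _ sT.
apply: uniq_perm => //; first by rewrite filter_uniq // sort_uniq filter_uniq // iota_uniq.
move=> k; rewrite mem_filter mem_sort mem_filter mem_iota add0n /=.
by case: (boolP (k \in L)) => //= kL; rewrite LK // Lm.
Qed.

Lemma times_upto_mono m K K' : (K <= K')%N -> subseq (times_upto m K) (times_upto m K').
Proof.
move=> KK; apply: times_upto_subseq.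
- exact: sort_sorted (earlier_total e) _.
- by rewrite sort_uniq filter_uniq // iota_uniq.
- by move=> k; rewrite mem_sort mem_filter mem_iota add0n => /and3P[_ _ /leq_trans]; apply.
- by move=> k; rewrite mem_sort mem_filter => /andP[].
Qed.

(** Without a limit from the right at s, there are two different values at times
    arbitrarily close to s; collecting such pairs from right to left gives as many
    changes as desired between s and s + 1. *)
Lemma few_changes_right_limit f s : few_changes f -> 0 <= s ->
  exists y eps, 0 < eps /\ forall k, s < e k < s + eps -> f k = y.
Proof.
move=> fewf s0; apply: contrapT => no_lim.
have pair eps : 0 < eps -> exists a b,
    [/\ s < e a, e a < e b, e b < s + eps & f a != f b].
  move=> eps0; apply: contrapT => nopair; apply: no_lim.
  have sse : s < s + eps by rewrite ltrDl.
  have [a /andP[sa ae]] := e_dense s0 sse.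
  exists (f a), eps; split=> // k /andP[sk ke]; apply: contrapT => /eqP fka.
  apply: nopair; case: (ltgtP (e a) (e k)) => ak.
  - by exists a, k; rewrite eq_sym.
  - by exists k, a.
  - by move: fka; rewrite (e_inj ak) eqxx.
have tr : transitive (fun k l => e k < e l) by move=> a b c; apply: lt_trans.
have many c eps : 0 < eps -> exists L,
    [/\ sorted (fun k l => e k < e l) L, {in L, forall k, s < e k < s + eps} &
        (c <= changes f L)%N].
  elim: c eps => [|c IH] eps eps0; first by exists [::].
  have [a [b [sa ab be fab]]] := pair eps eps0.
  have [|L [sL Ls cL]] := IH (e a - s); first by rewrite subr_gt0.
  have La k : k \in L -> s < e k < e a by move=> /Ls; rewrite subrKC.
  exists (L ++ [:: a; b]); split.
  - move: sL; rewrite !(sorted_pairwise tr) pairwise_cat /= ab andbT => -> /=.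
    rewrite andbT allrelC; apply/allrelP => k l; rewrite !inE => /orP[]/eqP -> /La /andP[_ //].
    by move=> la; apply: lt_trans ab.
  - move=> k; rewrite mem_cat !inE => /or3P[/La /andP[sk ka]|/eqP ->|/eqP ->].
    + by rewrite sk (lt_trans ka) // (lt_trans ab).
    + by rewrite sa (lt_trans ab).
    + by rewrite be (lt_trans sa).
  - apply: leq_trans (changes_cat2 f L a b); rewrite fab addn1; exact: cL.
have [m sm] : exists m : nat, s + 1 <= m%:R.
  by exists (Num.bound (s + 1)); apply: ltW; apply: archi_boundP; rewrite addr_ge0.
have [C CP] := fewf m.
have [L [sL Ls CL]] := many C 1 ltr01.
pose K := (\max_(k <- L) k).+1.
have := CP K; rewrite ltnNge => /negP; apply; apply: (leq_trans CL).
apply: changes_subseq; apply: times_upto_subseq.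
- by apply: sub_sorted sL => a b /ltW.
- apply: (sorted_uniq tr) => // a; exact: ltxx.
- by move=> k kL; rewrite ltnS; apply: leq_bigmax_seq.
- by move=> k /Ls /andP[_ /ltW ks]; apply: le_trans sm.
Qed.

End Changes.

(** * Almost every path has few changes *)

Section SkeletonRegularity.
Variables (R : realType) (n : nat) (Q : 'M[R]_n.+1) (pi0 : 'I_n.+1 -> R).
Local Notation S := 'I_n.+1.
Hypothesis gQ : generator Q.
Hypothesis pi0_ge0 : forall x, 0 <= pi0 x.
Hypothesis pi0_sum : \sum_x pi0 x = 1.
Variable e : nat -> R.
Hypothesis e_inj : injective e.
Hypothesis e_gt0 : forall k, 0 < e k.
Context {d : measure_display} {T : measurableType d}.
Variables (P : probability T R) (Z : nat -> T -> S).
Hypothesis mZ : forall k x, measurable [set r | Z k r = x].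
Hypothesis Zlaw : forall s,
  P [set r | [seq Z k r | k <- rev (iota 0 (size s))] = s] = (word_weight Q pi0 e s)%:E.
Local Notation pr := (pr P).

Lemma pr_skeleton a y : pr [set r | Z a r = y] = \sum_x pi0 x * semigroup Q (e a) x y.
Proof.
have -> : [set r | Z a r = y] = ev Z [:: a] (fun=> y).
  apply/seteqP; split => r /= => [h k|]; first by rewrite inE => /eqP ->.
  by apply; rewrite inE.
rewrite (pr_ev gQ e_inj mZ Zlaw) // /fdd /chron.
by apply: eq_bigr => x _ /=; rewrite subr0 mulr1.
Qed.

(** The empty event is added because two cylinders that disagree at a common index
    intersect in it, and the family has to be stable under intersection. *)
Definition cylinders (a : nat) : set (set T) := [set C | C = set0 \/
  exists J z, (forall k, k \in J -> e k < e a) /\ C = ev Z J z].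

Lemma cylindersI a : setI_closed (cylinders a).
Proof.
move=> A B [->|[J [z [Ja ->]]]]; first by rewrite set0I; left.
case=> [->|[J' [z' [Ja' ->]]]]; first by rewrite setI0; left.
case: (pselect (exists k, [/\ k \in J, k \in J' & z k != z' k])) => [[k [kJ kJ' zk]]|agree].
  left; apply/seteqP; split => r //= [/(_ k kJ) h /(_ k kJ')]; rewrite h => zz.
  by rewrite zz eqxx in zk.
right; exists (J ++ J'), (fun k => if k \in J then z k else z' k); split.
  by move=> k; rewrite mem_cat => /orP[/Ja|/Ja'].
apply/seteqP; split => r /=.
  move=> [hJ hJ'] k; rewrite mem_cat; case: ifP => [kJ _|_ /=]; [exact: hJ|exact: hJ'].
move=> h; split=> k kJ; have := h k; rewrite mem_cat kJ ?orbT => /(_ isT) ->//.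
case: ifP => // kJ0; apply/eqP; apply: contrapT => /negP zk; apply: agree.
by exists k.
Qed.

Lemma cylindersT a : cylinders a setT.
Proof. by right; exists [::], (fun=> ord0); split=> //; apply/seteqP; split. Qed.

Lemma skeleton_markov a b j y C : e a < e b -> <<s cylinders a >> C ->
  measurable C /\ pr (C `&` ([set r | Z a r = j] `&` [set r | Z b r = y])) =
    semigroup Q (e b - e a) j y * pr (C `&` [set r | Z a r = j]).
Proof.
move=> ab; apply: pi_lambda_pr => //.
- exact: measurableI.
- exact: cylindersI.
- exact: cylindersT.
- by move=> A [->|[J [z [_ ->]]]]; [exact: measurable0|exact: measurable_ev].
move=> A [->|[J [z [Ja ->]]]]; first by rewrite !set0I pr_set0 mulr0.
exact: (ev_markov gQ e_inj mZ Zlaw).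
Qed.

Lemma measurable_changed a b : measurable [set r | Z a r != Z b r].
Proof.
have -> : [set r | Z a r != Z b r] =
    \bigcup_(j in [set: S]) ([set r | Z a r = j] `&` ~` [set r | Z b r = j]).
  apply/seteqP; split => r /=.
    by move=> ab; exists (Z a r) => //; split=> //= ba; rewrite ba eqxx in ab.
  by move=> [j _ /= [-> bj]]; apply/eqP => jb; apply: bj.
apply: fin_bigcup_measurable => // j _; apply: measurableI => //.
exact: measurableC.
Qed.

(** The chain is in the same state at both times with probability at least exp(- rate *
    length), the lower bound on the diagonal of the uniformised semigroup. *)
Lemma pr_changed a b : e a < e b ->
  pr [set r | Z a r != Z b r] <= unif_rate Q * (e b - e a).
Proof.
move=> ab; have ab0 : 0 <= e b - e a by rewrite subr_ge0 ltW.
have -> : [set r | Z a r != Z b r] = ~` [set r | Z a r = Z b r].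
  by apply/seteqP; split => r /= => [/eqP|/eqP].
have mE : measurable [set r | Z a r = Z b r].
  rewrite (_ : [set r | Z a r = Z b r] = ~` [set r | Z a r != Z b r]).
    exact/measurableC/measurable_changed.
  by apply/seteqP; split => r /= => [->|/negP]; rewrite ?eqxx // negbK => /eqP.
rewrite pr_setC // (pr_split P mE (mZ a)).
have E1 : expR (- (unif_rate Q * (e b - e a))) <=
    \sum_y pr ([set r | Z a r = Z b r] `&` [set r | Z a r = y]).
  rewrite -[leLHS]mulr1 -(pr_setT P) (pr_split P measurableT (mZ a)) mulr_sumr.
  apply: ler_sum => y _; rewrite setTI.
  have -> : [set r | Z a r = Z b r] `&` [set r | Z a r = y] =
      setT `&` ([set r | Z a r = y] `&` [set r | Z b r = y]).
    by rewrite setTI; apply/seteqP; split => r /= [] => [<- <-|-> ->].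
  have [_ ->] := @skeleton_markov a b y y setT ab (sub_sigma_algebra (cylindersT a)).
  rewrite setTI ler_wpM2r ?pr_ge0 //.
  by have := semigroup_ge y y gQ ab0; rewrite eqxx mulr1.
have := expR_ge1Dx (- (unif_rate Q * (e b - e a))); lra.
Qed.

Lemma measurable_changes_from a L :
  measurable_fun setT (fun r => (changes_from (Z^~ r) a L)%:R : R).
Proof.
elim: L a => [|b L IH] a /=; first exact: measurable_cst.
have -> : (fun r => ((Z a r != Z b r) + changes_from (Z^~ r) b L)%:R : R) =
    (fun r => \1_[set r | Z a r != Z b r] r + (changes_from (Z^~ r) b L)%:R).
  apply/funext => r; rewrite natrD indicE; congr (_%:R + _).
  by congr nat_of_bool; apply/idP/idP; rewrite inE.
by apply: measurable_funD => //; exact: measurable_indic (measurable_changed a b).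
Qed.

Lemma expected_changes_from a L : path (fun k l => e k < e l) a L ->
  (\int[P]_r (changes_from (Z^~ r) a L)%:R%:E <= (unif_rate Q * (e (last a L) - e a))%:E)%E.
Proof.
elim: L a => [|b L IH] a /=.
  by move=> _; rewrite integral0 subrr mulr0.
move=> /andP[ab bL].
have -> : (fun r => ((Z a r != Z b r) + changes_from (Z^~ r) b L)%:R%:E : \bar R) =
    (fun r => (\1_[set r | Z a r != Z b r] r)%:E + (changes_from (Z^~ r) b L)%:R%:E)%E.
  apply/funext => r; rewrite natrD EFinD indicE; congr (_%:R%:E + _)%E.
  by congr nat_of_bool; apply/idP/idP; rewrite inE.
have mc := measurable_changed a b.
rewrite ge0_integralD //; last 2 first.
- exact/measurable_EFinP/measurable_indic.
- exact/measurable_EFinP/measurable_changes_from.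
rewrite integral_indic // setIT.
have -> : (unif_rate Q * (e (last b L) - e a))%:E =
   ((unif_rate Q * (e b - e a))%:E + (unif_rate Q * (e (last b L) - e b))%:E)%E.
  by rewrite -EFinD; congr EFin; ring.
apply: leeD; last exact: IH.
have : (P [set r | Z a r != Z b r] <= (unif_rate Q * (e b - e a))%:E)%E.
  by rewrite prE // lee_fin pr_changed.
by [].
Qed.

Definition many_changes (m C K : nat) : set T :=
  [set r | (C <= changes (Z^~ r) (times_upto e m K))%N].

Lemma measurable_many_changes m C K : measurable (many_changes m C K).
Proof.
rewrite /many_changes; case: (times_upto e m K) => [|a L] /=.
  case: C => [|C]; first by rewrite (_ : [set _ | _] = setT) //; apply/seteqP; split.
  by rewrite (_ : [set _ | _] = set0) //; apply/seteqP; split.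
have -> : [set r | (C <= changes_from (Z^~ r) a L)%N] =
    setT `&` (fun r => (changes_from (Z^~ r) a L)%:R : R) @^-1` [set` `[C%:R, +oo[].
  by rewrite setTI; apply/seteqP; split => r /=; rewrite in_itv /= andbT ler_nat.
by apply: measurable_changes_from => //; exact: measurable_itv.
Qed.

Lemma unif_rate_ge0 : 0 <= unif_rate Q.
Proof. by apply: sumr_ge0 => j _; apply: sumr_ge0. Qed.

(** Markov's inequality for the number of changes; the bound is independent of K, the
    number of times taken into account. *)
Lemma pr_many_changes m C K : pr (many_changes m C.+1 K) <= unif_rate Q * m%:R / C.+1%:R.
Proof.
have mM := measurable_many_changes m C.+1 K.
have G0 := unif_rate_ge0.
rewrite ler_pdivlMr ?ltr0n // mulrC -lee_fin.
have := mM; rewrite /many_changes.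
have sT : sorted (earlier e) (times_upto e m K) by exact: sort_sorted (earlier_total e) _.
have uT : uniq (times_upto e m K) by rewrite sort_uniq filter_uniq // iota_uniq.
have lT : {in times_upto e m K, forall k, e k <= m%:R}.
  by move=> k; rewrite mem_sort mem_filter => /andP[].
case: (times_upto e m K) sT uT lT => [|a L] sT uT lT mE /=.
  by rewrite (_ : [set _ | _] = set0) ?pr_set0 ?mulr0 ?lee_fin ?mulr_ge0 //; apply/seteqP; split.
have pL : path (fun k l => e k < e l) a L.
  have : sorted (fun k l => e k < e l) (a :: L); last by [].
  rewrite (sorted_pairwise (fun y x z => @lt_trans _ _ (e y) (e x) (e z))).
  move: sT uT; rewrite (sorted_pairwise (@earlier_trans _ e)) uniq_pairwise => h1 h2.
  have : pairwise [rel k l | earlier e k l && (k != l)] (a :: L).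
    by rewrite pairwise_relI h1.
  apply: sub_pairwise => k l /= /andP[kl nkl]; rewrite lt_neqAle (kl : e k <= e l) andbT.
  by apply: contra nkl => /eqP/e_inj ->.
apply: le_trans (_ : \int[P]_r (changes_from (Z^~ r) a L)%:R%:E <= _)%E.
  rewrite EFinM -prE //.
  have -> : (C.+1%:R%:E * P [set r | (C < changes_from (Z^~ r) a L)%N])%E =
     (\int[P]_r (C.+1%:R%:E * (\1_[set r | (C < changes_from (Z^~ r) a L)%N] r)%:E))%E.
    by rewrite ge0_integralZl_EFin ?ler0n // ?integral_indic ?setIT //;
       exact/measurable_EFinP/measurable_indic.
  apply: ge0_le_integral => //.
  - apply/(measurable_EFinP setT (fun r => C.+1%:R * \1_[set r | (C < changes_from (Z^~ r) a L)%N] r)).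
    by apply: measurable_funM => //; exact: measurable_indic.
  - exact/measurable_EFinP/measurable_changes_from.
  - move=> r _; rewrite -EFinM lee_fin indicE.
    case: (boolP (r \in _)) => [|_]; last by rewrite mulr0.
    by rewrite inE /= mulr1 ler_nat.
apply: le_trans (expected_changes_from pL) _; rewrite lee_fin ler_wpM2l //.
rewrite lerBlDr; apply: (@le_trans _ _ m%:R); first by apply: lT; exact: mem_last.
by rewrite lerDl ltW.
Qed.

Definition regular : set T := [set r | few_changes e (Z^~ r)].

Lemma regularE : regular = \bigcap_m \bigcup_C \bigcap_K ~` many_changes m C K.
Proof.
apply/seteqP; split => r /=.
  move=> h m _; have [C hC] := h m; exists C => // K _ /=.
  by rewrite /many_changes /= leqNgt hC.
move=> h m; have [C _ hC] := h m I; exists C => K; have := hC K I.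
by rewrite /many_changes /= ltnNge => /negP.
Qed.

Lemma measurable_regular : measurable regular.
Proof.
rewrite regularE; apply: bigcapT_measurable => m; apply: bigcupT_measurable => C.
apply: bigcapT_measurable => K; exact/measurableC/measurable_many_changes.
Qed.

(** For fixed m, more than C changes up to time m have probability at most rate * m / C,
    whatever the number of times inspected; let this number and then C tend to infinity. *)
Lemma pr_regular : pr regular = 1.
Proof.
have G0 := unif_rate_ge0.
pose B m := \bigcap_C \bigcup_K many_changes m C K.
have mU m C : measurable (\bigcup_K many_changes m C K).
  by apply: bigcupT_measurable => K; exact: measurable_many_changes.
have mB m : measurable (B m) by exact: bigcapT_measurable.
have UC m C : pr (\bigcup_K many_changes m C.+1 K) <= unif_rate Q * m%:R / C.+1%:R.
  have : pr (many_changes m C.+1 K) @[K --> \oo] --> pr (\bigcup_K many_changes m C.+1 K).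
    apply: pr_cvg_nd => [K|K K' KK']; first exact: measurable_many_changes.
    rewrite subsetEset => r /= h; apply: (leq_trans h).
    by apply: changes_subseq; apply: times_upto_mono.
  move=> /(cvg_lim (@Rhausdorff R)) <-; apply: limr_le.
    apply/cvg_ex; eexists; apply: pr_cvg_nd => [K|K K' KK']; first exact: measurable_many_changes.
    rewrite subsetEset => r /= h; apply: (leq_trans h).
    by apply: changes_subseq; apply: times_upto_mono.
  by apply: nearW => K; exact: pr_many_changes.
have B0 m : P (B m) = 0%E.
  rewrite prE //; congr EFin; apply/eqP; rewrite eq_le pr_ge0 andbT.
  apply/ler_addgt0Pl => eps eps0; rewrite addr0.
  have [C CP] : exists C : nat, unif_rate Q * m%:R / eps <= C%:R.
    by eexists; apply: ltW; apply: archi_boundP; rewrite divr_ge0 ?mulr_ge0 // ltW.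
  apply: (@le_trans _ _ (unif_rate Q * m%:R / C.+1%:R)).
    by apply: le_trans (UC m C); apply: pr_le => // r /(_ C.+1 I).
  rewrite ler_pdivrMr // [leRHS]mulrC -ler_pdivrMr //; apply: (le_trans CP).
  by rewrite ler_nat.
have : P.-negligible (\bigcup_m B m).
  by apply: negligible_bigcup => m; apply/negligibleP; [exact: mB|exact: B0].
move=> /negligibleP h; have {}h : P (\bigcup_m B m) = 0%E.
  by apply: h; apply: bigcupT_measurable.
have -> : regular = ~` (\bigcup_m B m).
  rewrite regularE setC_bigcup; apply: eq_bigcapr => m _.
  by rewrite /B setC_bigcap; apply: eq_bigcupr => C _; rewrite setC_bigcup.
by rewrite pr_setC ?/pr ?h ?subr0 //; apply: bigcupT_measurable.
Qed.

End SkeletonRegularity.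

(** * The right-continuous chain *)

Definition past (R : realType) (T S : Type) (Y : R -> T -> S) (s : R) : set (set T) :=
  <<s [set C | exists v y, 0 <= v <= s /\ C = [set r | Y v r = y]] >>.

Lemma cvg_semigroup (R : realType) (n : nat) (Q : 'M[R]_n.+1) (I : Type)
    (F : set_system I) (FF : Filter F) (f : I -> R) (s : R) x y :
  f i @[i --> F] --> s -> semigroup Q (f i) x y @[i --> F] --> semigroup Q s x y.
Proof.
move=> fs.
exact: (@continuous_cvg I _ _ F FF f (fun v => semigroup Q v x y) s
  (@continuous_semigroup R n Q x y s) fs).
Qed.

Section RightLimits.
Variables (R : realType) (n : nat) (Q : 'M[R]_n.+1) (pi0 : 'I_n.+1 -> R).
Local Notation S := 'I_n.+1.
Hypothesis gQ : generator Q.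
Hypothesis pi0_ge0 : forall x, 0 <= pi0 x.
Hypothesis pi0_sum : \sum_x pi0 x = 1.
Variable e : nat -> R.
Hypothesis e_inj : injective e.
Hypothesis e_gt0 : forall k, 0 < e k.
Hypothesis e_dense : forall a b : R, 0 <= a -> a < b -> exists k, a < e k < b.
Context {d : measure_display} {T : measurableType d}.
Variables (P : probability T R) (Z : nat -> T -> S).
Hypothesis mZ : forall k x, measurable [set r | Z k r = x].
Hypothesis Zlaw : forall s,
  P [set r | [seq Z k r | k <- rev (iota 0 (size s))] = s] = (word_weight Q pi0 e s)%:E.
Local Notation pr := (pr P).
Local Notation G := (regular e Z).

(** The interval to the right of s has length 1 / (m + 1), so that the existence of a
    limit is a countable union of countable intersections, hence an event. *)
Definition right_value s r y (m : nat) : Prop :=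
  forall k, s < e k < s + m.+1%:R^-1 -> Z k r = y.

(** Irregular paths are replaced by the constant ord0, so that Y is right-continuous
    everywhere and not just almost surely. *)
Definition Y s r : S := xget ord0 [set y | G r /\ exists m, right_value s r y m].

Lemma right_value_mono s r y m m' : (m <= m')%N -> right_value s r y m -> right_value s r y m'.
Proof.
move=> mm h k /andP[sk ks]; apply: h; rewrite sk (lt_le_trans ks) // lerD2l.
by rewrite lef_pV2 ?posrE // ler_nat.
Qed.

Lemma right_value_uniq s r y y' m m' : 0 <= s ->
  right_value s r y m -> right_value s r y' m' -> y = y'.
Proof.
move=> s0 h h'; pose M := maxn m m'.
have sM : s < s + M.+1%:R^-1 by rewrite ltrDl invr_gt0.
have [k kI] := e_dense s0 sM.
by rewrite -(right_value_mono (leq_maxl m m') h kI) -(right_value_mono (leq_maxr m m') h' kI).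
Qed.

Lemma right_value_exists s r : G r -> 0 <= s -> exists y m, right_value s r y m.
Proof.
move=> Gr s0; have [y [eps [eps0 h]]] := few_changes_right_limit e_inj e_dense Gr s0.
exists y, (Num.bound eps^-1) => k /andP[sk ks]; apply: h; rewrite sk (lt_trans ks) //.
rewrite ltrD2l invf_plt ?posrE //; apply: (@lt_le_trans _ _ (Num.bound eps^-1)%:R).
  by apply: archi_boundP; rewrite invr_ge0 ltW.
by rewrite ler_nat.
Qed.

Lemma YP s r y m : G r -> 0 <= s -> right_value s r y m -> Y s r = y.
Proof.
move=> Gr s0 h; rewrite /Y; case: xgetP => [z _ [_ [m' h']]|]; first exact: right_value_uniq h' h.
by move=> /(_ y) []; split=> //; exists m.
Qed.

Lemma Y_right s r : G r -> 0 <= s -> exists m, right_value s r (Y s r) m.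
Proof.
move=> Gr s0; have [y [m h]] := right_value_exists Gr s0.
by exists m; rewrite (YP Gr s0 h).
Qed.

Lemma Y_irregular s r : ~ G r -> Y s r = ord0.
Proof. by move=> NG; rewrite /Y; case: xgetP => // z _ []. Qed.

Lemma Y_right_continuous r s : 0 <= s -> exists2 eps, 0 < eps &
  forall s', s <= s' < s + eps -> Y s' r = Y s r.
Proof.
move=> s0; case: (pselect (G r)) => [Gr|NG]; last first.
  by exists 1 => // s' _; rewrite !Y_irregular.
have [m h] := Y_right Gr s0; exists m.+1%:R^-1; first by rewrite invr_gt0.
move=> s' /andP[ss s'm]; have s'0 := le_trans s0 ss.
have [m' h'] := Y_right Gr s'0.
have s'min : s' < Num.min (s + m.+1%:R^-1) (s' + m'.+1%:R^-1).
  by rewrite lt_min s'm /= ltrDl invr_gt0.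
have [k /andP[k1]] := e_dense s'0 s'min; rewrite lt_min => /andP[k2 k3].
by rewrite -(h' k) ?k1 // (h k) // k2 (le_lt_trans ss).
Qed.

(** Taking m >= m0 only does not change the event on regular paths, and it confines the
    indices involved to times before s + 1 / (m0 + 1). *)
Definition right_event s y m0 : set T :=
  \bigcup_(m in [set m | (m0 <= m)%N]) \bigcap_k
    (if s < e k < s + m.+1%:R^-1 then [set r | Z k r = y] else setT).

Lemma right_eventP s y m0 r : G r -> 0 <= s -> right_event s y m0 r <-> Y s r = y.
Proof.
move=> Gr s0; split => [[m /= _ h]|<-].
  apply: (YP (m := m) Gr s0) => k kI; by have := h k I; rewrite kI.
have [m h] := Y_right Gr s0; exists (maxn m0 m); first exact: leq_maxl.
by move=> k _; case: ifP => // kI; apply: right_value_mono h _ kI; exact: leq_maxr.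
Qed.

Lemma measurable_right_event s y m0 : measurable (right_event s y m0).
Proof.
apply: bigcup_measurable => m _; apply: bigcapT_measurable => k.
by case: ifP.
Qed.

Lemma measurable_Y s y : 0 <= s -> measurable [set r | Y s r = y].
Proof.
move=> s0; have mG : measurable G by exact: measurable_regular.
have -> : [set r | Y s r = y] =
    (right_event s y 0 `&` G) `|` (if y == ord0 then ~` G else set0).
  apply/seteqP; split => r /=.
    case: (pselect (G r)) => Gr Yr; first by left; split=> //; apply/right_eventP.
    by right; rewrite -Yr Y_irregular // eqxx.
  case=> [[h Gr]|]; first exact/(right_eventP y 0 Gr s0).
  by case: eqP => // ->; exact: Y_irregular.
apply: measurableU; first by apply: measurableI => //; exact: measurable_right_event.
by case: ifP => // _; exact: measurableC.
Qed.

(** The distance to s is bounded by 1 / (k + 1) for convergence, and by del so that a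
    sequence to the right of s can be kept below one to the right of s + del. *)
Definition right_seq (s del : R) (a : nat -> nat) : Prop :=
  forall k, s < e (a k) < s + Num.min del k.+1%:R^-1.

Lemma right_seq_exists s del : 0 <= s -> 0 < del -> exists a, right_seq s del a.
Proof.
move=> s0 del0; suff : forall k, exists a, s < e a < s + Num.min del k.+1%:R^-1.
  by move=> /choice[a h]; exists a.
move=> k; apply: e_dense => //; by rewrite ltrDl lt_min del0 invr_gt0 /=.
Qed.

Lemma right_seq_cvg s del a : right_seq s del a -> e (a k) @[k --> \oo] --> s.
Proof.
move=> h; apply/cvgrPdist_lt => eps eps0; near=> k.
have /andP[h1 h2] := h k.
rewrite distrC gtr0_norm ?subr_gt0 // ltrBlDl; apply: (lt_le_trans h2).
rewrite lerD2l ge_min; apply/orP; right; apply: ltW.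
near: k; exact: (near_infty_natSinv_lt (PosNum eps0)).
Unshelve. all: by end_near. Qed.

Lemma right_seq_Y s del a r : right_seq s del a -> G r -> 0 <= s ->
  \forall k \near \oo, Z (a k) r = Y s r.
Proof.
move=> ha Gr s0; have [m h] := Y_right Gr s0; near=> k.
have /andP[h1 h2] := ha k; apply: h; rewrite h1 (lt_le_trans h2) // lerD2l ge_min.
apply/orP; right; rewrite lef_pV2 ?posrE // ler_nat ltnS.
by near: k; exists m.
Unshelve. all: by end_near. Qed.

Lemma pr_Y s y : 0 <= s -> pr [set r | Y s r = y] = \sum_x pi0 x * semigroup Q s x y.
Proof.
move=> s0; have [a ha] := right_seq_exists s0 ltr01.
have mG : measurable G by exact: measurable_regular.
have G1 : pr G = 1 by exact: (pr_regular gQ e_inj e_gt0 mZ Zlaw).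
have c1 : pr [set r | Z (a k) r = y] @[k --> \oo] --> pr [set r | Y s r = y].
  apply: (pr_ae_cvg (G := G)) => //; first exact: measurable_Y.
  move=> r Gr; apply: filterS (right_seq_Y ha Gr s0) => k /= ->; by [].
have c2 : pr [set r | Z (a k) r = y] @[k --> \oo] --> \sum_x pi0 x * semigroup Q s x y.
  under eq_fun do rewrite (pr_skeleton gQ e_inj mZ Zlaw).
  apply: cvg_sumR => x _; apply: cvgMr.
  by apply: cvg_semigroup; exact: right_seq_cvg ha.
exact: cvg_unique c1 c2.
Qed.

(** The states up to time s are limits from the right, hence depend on dense times
    slightly after s; these can be kept below any given e a > s. Thus on regular paths
    the past of Y at s lies in the past of the chain along the dense times at each later
    index. *)
Lemma past_trace s a A : 0 <= s -> s < e a -> past Y s A ->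
  measurable A /\ exists2 B, <<s cylinders e Z a >> B & A `&` G = B `&` G.
Proof.
move=> s0 sa; pose H := [set A : set T | measurable A /\
  exists2 B, <<s cylinders e Z a >> B & A `&` G = B `&` G].
apply: (@smallest_sub _ _ _ H); last first.
  move=> _ [v [y [/andP[v0 vs] ->]]]; split; first exact: measurable_Y.
  have va := le_lt_trans vs sa.
  pose m0 := Num.bound (e a - v)^-1.
  have m0P : v + m0.+1%:R^-1 <= e a.
    rewrite -lerBrDl -[leRHS]invrK lef_pV2 ?posrE ?invr_gt0 ?subr_gt0 //.
    apply: (@le_trans _ _ m0%:R); last by rewrite ler_nat.
    by apply: ltW; apply: archi_boundP; rewrite invr_ge0 subr_ge0 ltW.
  exists (right_event v y m0); last first.
    apply/seteqP; split => r /= [h Gr]; split=> //.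
      exact/(right_eventP y m0 Gr v0).
    exact/(right_eventP y m0 Gr v0).
  apply: (@bigcup_measurable _ (g_sigma_algebraType (cylinders e Z a))) => m /= mm.
  apply: bigcapT_measurable => k; case: ifP => [/andP[vk km]|_]; last exact: measurableT.
  apply: sub_sigma_algebra; right; exists [:: k], (fun=> y); split.
    move=> l; rewrite inE => /eqP ->; apply: (lt_le_trans km); apply: le_trans m0P.
    by rewrite lerD2l lef_pV2 ?posrE // ler_nat.
  apply/seteqP; split => r /= h; last by apply: h; rewrite inE.
  by move=> l; rewrite inE => /eqP ->.
split=> [|C [mC [B sB CB]]|F HF].
- by split=> //; exists set0 => //; exact: sigma_algebra0.
- split; first by rewrite setTD; exact: measurableC.
  exists (setT `\` B); first exact: sigma_algebraCD.
  apply/seteqP; split => r /= [[_ NC] Gr]; split=> //; split=> // h; apply: NC.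
    by have : (B `&` G) r by []; rewrite -CB => -[].
  by have : (C `&` G) r by []; rewrite CB => -[].
- split; first by apply: bigcupT_measurable => k; case: (HF k).
  have /choice[B BP] : forall k, exists B, <<s cylinders e Z a >> B /\ F k `&` G = B `&` G.
    by move=> k; case: (HF k) => _ [B ? ?]; exists B.
  exists (\bigcup_k B k); first by apply: sigma_algebra_bigcup => k; case: (BP k).
  by rewrite !setI_bigcupl; apply: eq_bigcupr => k _; case: (BP k).
Qed.

(** The Markov property along the dense times, for indices a_k, b_k whose times decrease
    to s and s + u. The past of Y at s is contained in the past at a_k for all k by
    [past_trace], and the states at a_k and b_k are eventually those of Y. *)
Lemma Y_markov s u A j y : 0 <= s -> 0 <= u -> past Y s A ->
  measurable A /\
  pr (A `&` ([set r | Y s r = j] `&` [set r | Y (s + u) r = y])) =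
    semigroup Q u j y * pr (A `&` [set r | Y s r = j]).
Proof.
move=> s0 u0 pA.
have su0 : 0 <= s + u by exact: addr_ge0.
have mG : measurable G by exact: measurable_regular.
have G1 : pr G = 1 by exact: (pr_regular gQ e_inj e_gt0 mZ Zlaw).
have s1 : s < s + 1 by rewrite ltrDl.
have [a0 /andP[sa0 _]] := e_dense s0 s1.
have [mA _] := past_trace s0 sa0 pA; split=> //.
have [u1|u1] := eqVneq u 0.
  rewrite u1 addr0 semigroup0 mxE; have [->|jy] := eqVneq j y.
    by rewrite setIid mul1r.
  rewrite mul0r (_ : [set r | Y s r = j] `&` [set r | Y s r = y] = set0) ?setI0 ?pr_set0 //.
  by apply/seteqP; split => r //= [-> /eqP]; rewrite (negbTE jy).
have {}u0 : 0 < u by rewrite lt0r u1.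
have [a ha] := right_seq_exists s0 u0.
have [b hb] := right_seq_exists su0 u0.
have ab k : e (a k) < e (b k).
  have /andP[_ h1] := ha k; have /andP[h2 _] := hb k; apply: lt_trans h2.
  by apply: (lt_le_trans h1); rewrite lerD2l ge_min lexx.
have step k : pr (A `&` ([set r | Z (a k) r = j] `&` [set r | Z (b k) r = y])) =
    semigroup Q (e (b k) - e (a k)) j y * pr (A `&` [set r | Z (a k) r = j]).
  have /andP[sak _] := ha k.
  have [_ [B sB AB]] := past_trace s0 sak pA.
  have [mB BE] := skeleton_markov gQ e_inj mZ Zlaw j y (ab k) sB.
  have trace E : measurable E -> pr (A `&` E) = pr (B `&` E).
    move=> mE; rewrite -(pr_setI_full (measurableI _ _ mA mE) mG G1).
    by rewrite setIAC AB setIAC pr_setI_full //; exact: measurableI.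
  by rewrite !trace //; exact: measurableI.
have c1 : pr (A `&` ([set r | Z (a k) r = j] `&` [set r | Z (b k) r = y])) @[k --> \oo] -->
    pr (A `&` ([set r | Y s r = j] `&` [set r | Y (s + u) r = y])).
  apply: (pr_ae_cvg (G := G)) => //.
  - by move=> k; apply: measurableI => //; exact: measurableI.
  - by apply: measurableI => //; apply: measurableI; exact: measurable_Y.
  move=> r Gr; near=> k.
  have eqa : Z (a k) r = Y s r by near: k; exact: right_seq_Y.
  have eqb : Z (b k) r = Y (s + u) r by near: k; exact: right_seq_Y.
  by rewrite /setI /mkset eqa eqb.
have c2 : pr (A `&` [set r | Z (a k) r = j]) @[k --> \oo] --> pr (A `&` [set r | Y s r = j]).
  apply: (pr_ae_cvg (G := G)) => //.
  - by move=> k; apply: measurableI.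
  - by apply: measurableI => //; exact: measurable_Y.
  move=> r Gr; near=> k.
  have eqa : Z (a k) r = Y s r by near: k; exact: right_seq_Y.
  by rewrite /setI /mkset eqa.
have c3 : semigroup Q (e (b k) - e (a k)) j y @[k --> \oo] --> semigroup Q u j y.
  have : e (b k) - e (a k) @[k --> \oo] --> u.
    rewrite -[X in _ --> X](addrK s) [u + s]addrC.
    by apply: cvgB; [exact: right_seq_cvg hb|exact: right_seq_cvg ha].
  by move=> h; apply: cvg_semigroup.
apply: (cvg_unique _ c1) => //.
by rewrite (funext step); exact: cvgM.
Unshelve. all: by end_near. Qed.

End RightLimits.

(** The Markov property is for the whole past of the process at a real time s, not only
    for the states at finitely many times; without it the martingale property could not
    be tested on all events of the filtration. *)
Theorem jump_process (R : realType) (n : nat) (Q : 'M[R]_n.+1) (pi0 : 'I_n.+1 -> R) :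
  generator Q -> (forall x, 0 <= pi0 x) -> \sum_x pi0 x = 1 ->
  exists (d : measure_display) (T : measurableType d) (P : probability T R)
    (Y : R -> T -> 'I_n.+1),
  [/\ forall s y, 0 <= s -> measurable [set r | Y s r = y],
      forall r s, 0 <= s -> exists2 eps, 0 < eps &
        forall s', s <= s' < s + eps -> Y s' r = Y s r,
      forall s y, 0 <= s ->
        pr P [set r | Y s r = y] = \sum_x pi0 x * semigroup Q s x y &
      forall s u A j y, 0 <= s -> 0 <= u -> past Y s A ->
        measurable A /\
        pr P (A `&` ([set r | Y s r = j] `&` [set r | Y (s + u) r = y])) =
          semigroup Q u j y * pr P (A `&` [set r | Y s r = j])].
Proof.
move=> gQ pi0_ge0 pi0_sum; have [e [e_inj e_gt0 e_dense]] := dense_times R.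
have [d [T [P [Z [mZ Zlaw]]]]] := word_process
  (word_weight_ge0 gQ pi0_ge0 e_gt0) (word_weight_nil Q pi0_sum e)
  (word_weight_cons pi0 gQ e_inj).
exists d, T, P, (Y e Z); split.
- by move=> s y; exact: measurable_Y.
- by move=> r s; exact: Y_right_continuous.
- by move=> s y s0; apply: pr_Y.
- by move=> s u A j y s0 u0; apply: (Y_markov gQ e_inj e_gt0 e_dense mZ Zlaw).
Qed.

(** * The starting law and the jump rates *)

Section Interpolation.
Variables (R : realType) (m : nat) (i p : 'I_m.+2 -> R) (e0 : R).
Hypothesis i_incr : forall j k : 'I_m.+2, (j < k)%N -> i j < i k.
Hypothesis p_gt0 : forall j, 0 < p j.
Hypothesis p_sum1 : \sum_j p j = 1.
Hypothesis e0E : e0 = \sum_j i j * p j.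

(** Jensen's inequality for the convex payoff (x - i_l)^+, strict because p charges
    states on both sides of an interior l. *)
Lemma call_mean_gt l : interior l ->
  0 < \sum_k p k * call i l k /\ e0 - i l < \sum_k p k * call i l k.
Proof.
case/andP => l0 lm; split.
  rewrite (bigD1 ord_max) //=; apply: ltr_wpDr.
    by apply: sumr_ge0 => k _; rewrite mulr_ge0 ?call_ge0 // ltW.
  rewrite mulr_gt0 // callE // leq_ord subr_gt0; apply: i_incr.
  by rewrite ltn_neqAle leq_ord andbT.
have -> : e0 - i l = \sum_k p k * (i k - i l).
  under eq_bigr do rewrite mulrBr.
  rewrite sumrB -mulr_suml p_sum1 mul1r e0E; congr (_ - _).
  by apply: eq_bigr => k _; rewrite mulrC.
rewrite (bigD1 ord0) //= [ltRHS](bigD1 ord0) //=; apply: ltr_leD.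
  rewrite ltr_pM2l // callE // ifF; last by apply/negbTE; rewrite -ltnNge lt0n.
  by rewrite subr_lt0; apply: i_incr; rewrite lt0n.
apply: ler_sum => k _; rewrite ler_pM2l //.
by rewrite /call le_max lexx.
Qed.

Lemma e0_bounds : i ord0 < e0 < i ord_max.
Proof.
have sumE c : \sum_j c * p j = c by rewrite -mulr_sumr p_sum1 mulr1.
apply/andP; split.
  rewrite -(sumE (i ord0)) e0E (bigD1 ord_max) //= [ltRHS](bigD1 ord_max) //=.
  apply: ltr_leD; first by rewrite ltr_pM2r // i_incr.
  by apply: ler_sum => k _; rewrite ler_pM2r // i_le.
rewrite -(sumE (i ord_max)) e0E (bigD1 ord0) //= [ltRHS](bigD1 ord0) //=.
apply: ltr_leD; first by rewrite ltr_pM2r // i_incr.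
by apply: ler_sum => k _; rewrite ler_pM2r // i_le // leq_ord.
Qed.

Lemma bracket : exists a : 'I_m.+1, i (lo a) <= e0 < i (hi a).
Proof.
have /andP[h0 hm] := e0_bounds.
have P0 : i (lo ord0) <= e0 by rewrite (_ : lo ord0 = ord0) ?ltW //; apply: val_inj.
pose a := [arg max_(a > (ord0 : 'I_m.+1) | i (lo a) <= e0) (a : nat)].
exists a; rewrite /a; case: arg_maxnP => // b bP bmax; rewrite bP /= ltNge; apply/negP => hb.
have [bm|bm] := ltnP b m.
  have := bmax (Ordinal (bm : (b.+1 < m.+1)%N)).
  rewrite (_ : lo _ = hi b) => [/(_ hb)/=|]; first by rewrite ltnn.
  exact: val_inj.
suff hE : hi b = ord_max by move: hb; rewrite hE leNgt hm.
by apply: val_inj; rewrite /= bump0; congr _.+1; apply/eqP; rewrite eqn_leq bm -ltnS ltn_ord.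
Qed.

(** The law with mean e0 on the two neighbours of e0. The convention i (lo a) <= e0 < i
    (hi a) makes it the unit mass at lo a when e0 is itself a state. *)
Definition balayage (a : 'I_m.+1) k : R :=
  if k == hi a then (e0 - i (lo a)) / gap i a
  else if k == lo a then (i (hi a) - e0) / gap i a else 0.

Lemma lo_neq_hi a : (lo a : 'I_m.+2) != hi a.
Proof. by rewrite -val_eqE /= bump0 neq_ltn ltnSn. Qed.

Lemma balayage_sum a (f : 'I_m.+2 -> R) : \sum_k balayage a k * f k =
  (e0 - i (lo a)) / gap i a * f (hi a) + (i (hi a) - e0) / gap i a * f (lo a).
Proof.
rewrite (bigD1 (hi a)) //= (bigD1 (lo a)) ?lo_neq_hi //= [X in _ + (_ + X)]big1 ?addr0.
  by rewrite /balayage !eqxx (negbTE (lo_neq_hi a)).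
by move=> k /andP[/negbTE kh /negbTE kl]; rewrite /balayage kh kl mul0r.
Qed.

Section Bracketed.
Variable a : 'I_m.+1.
Hypothesis aP : i (lo a) <= e0 < i (hi a).

Lemma balayage_ge0 k : 0 <= balayage a k.
Proof.
case/andP: aP => al ah; have g0 := ltW (gap_gt0 i_incr a).
rewrite /balayage; case: ifP => _; first by rewrite divr_ge0 // subr_ge0.
by case: ifP => _ //; rewrite divr_ge0 // subr_ge0 ltW.
Qed.

Lemma balayage_sum1 : \sum_k balayage a k = 1.
Proof.
have g0 := lt0r_neq0 (gap_gt0 i_incr a).
under eq_bigr do rewrite -[balayage a _]mulr1.
rewrite balayage_sum !mulr1 -mulrDl -[RHS](divff g0); congr (_ / _); rewrite /gap; ring.
Qed.

Lemma balayage_mean : \sum_k balayage a k * i k = e0.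
Proof.
have g0 := lt0r_neq0 (gap_gt0 i_incr a).
rewrite balayage_sum; move: g0; rewrite /gap => g0; by field.
Qed.

(** The payoff is affine between neighbouring states, so its mean under [balayage] is
    (e0 - i_l)^+. *)
Lemma balayage_call l : interior l ->
  \sum_k balayage a k * call i l k < \sum_k p k * call i l k.
Proof.
move=> il; have [h1 h2] := call_mean_gt il; rewrite balayage_sum.
have [la|al] := leqP l (lo a).
  rewrite !callE // la (leq_trans la) /=; last by rewrite bump0.
  have -> // : (e0 - i (lo a)) / gap i a * (i (hi a) - i l) +
      (i (hi a) - e0) / gap i a * (i (lo a) - i l) = e0 - i l.
  have g0 := lt0r_neq0 (gap_gt0 i_incr a); move: g0; rewrite /gap => g0; by field.
rewrite !callE // [(l <= lo a)%N]leqNgt al /= mulr0 addr0.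
case: ifP => [lh|_]; last by rewrite mulr0.
have lE : l = hi a by apply: val_inj; apply/eqP; rewrite eqn_leq lh /= bump0.
by rewrite -lE subrr mulr0.
Qed.

Lemma balayage_state j : e0 = i j -> balayage a j = 1.
Proof.
move=> ej; case/andP: aP => al ah.
have jl : j = lo a.
  apply: val_inj; apply/eqP; rewrite eqn_leq; apply/andP; split.
    rewrite leqNgt; apply/negP => /= lj.
    by move: ah; rewrite ej ltNge i_le //= bump0.
  by rewrite leqNgt; apply/negP => /i_incr; rewrite -ej ltNge al.
by rewrite /balayage jl (negbTE (lo_neq_hi a)) eqxx ej jl divff // lt0r_neq0 // gap_gt0.
Qed.

End Bracketed.
End Interpolation.

Lemma random_variable_of (d : measure_display) (T : measurableType d) (R : realType)
    (P : probability T R) (f : T -> R) :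
  measurable_fun setT f -> exists X : {RV P >-> R}, forall r, X r = f r.
Proof.
move=> mf; exists (mfun_Sub (mem_set mf)); by [].
Qed.

Section Rates.
Variables (R : realType) (m : nat) (i theta : 'I_m.+2 -> R).
Hypothesis i_incr : forall j k : 'I_m.+2, (j < k)%N -> i j < i k.
Hypothesis theta_ge0 : forall j, 0 <= theta j.
Hypothesis theta_end : forall j, ~~ interior j -> theta j = 0.

Definition jump_rate j : R := - gen i theta j j.

Lemma jump_rate_vector : rate_vector jump_rate.
Proof.
have [gQ gS] := generator_gen i_incr theta_ge0.
split=> [j|j [j0|jm]].
- rewrite /jump_rate oppr_ge0; have := gS j; rewrite (bigD1 j) //= => /eqP.
  rewrite addr_eq0 => /eqP ->; rewrite oppr_le0; apply: sumr_ge0 => k kj.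
  by apply: gQ; rewrite eq_sym.
- by rewrite /jump_rate mxE theta_end ?mul0r ?oppr0 // /interior -val_eqE /= j0.
- rewrite /jump_rate mxE theta_end ?mul0r ?oppr0 // /interior negb_and !negbK; apply/orP; right.
  exact/eqP/val_inj.
Qed.

Lemma gen_neighbours (a j b : 'I_m.+2) : j = a.+1 :> nat -> b = j.+1 :> nat ->
  gen i theta j b = (i j - i a) / (i b - i a) * jump_rate j /\
  gen i theta j a = (i b - i j) / (i b - i a) * jump_rate j.
Proof.
move=> ja bj.
have ij : interior j.
  rewrite /interior -!val_eqE /= ja /= neq_ltn; apply/orP; left.
  by rewrite -ja -ltnS -bj ltn_ord.
have [a' [b' [ha lb ba gE]]] := interiorP R ij.
have aE : a = lo a'.
  by apply: val_inj; apply/eqP; rewrite /= -eqSS -ja -ha /= bump0.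
have bE : b = hi b'.
  by apply: val_inj; rewrite /= bump0 bj -lb.
have laplE k : lapl i j k = ((hi b' == k)%:R - (j == k)%:R) / gap i b' -
     ((j == k)%:R - (lo a' == k)%:R) / gap i a'.
  rewrite -(lapl_interior i (fun l => (l == k)%:R) ha lb gE).
  rewrite (bigD1 k) //= eqxx mulr1 big1 ?addr0 // => l /negbTE ->; by rewrite mulr0.
have jb : (j == b) = false by apply/negP => /eqP jb; move: bj; rewrite jb; exact: n_Sn.
have aj : (a == j) = false.
  by apply/negP => /eqP aj; move: ja; rewrite aj; exact: n_Sn.
have ab : (a == b) = false.
  by rewrite -val_eqE /= bj ja ltn_eqF.
have g1 : gap i b' = i b - i j by rewrite /gap -bE lb.
have g2 : gap i a' = i j - i a by rewrite /gap ha -aE.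
have n1 : i b - i j != 0 by rewrite -g1 lt0r_neq0 // gap_gt0.
have n2 : i j - i a != 0 by rewrite -g2 lt0r_neq0 // gap_gt0.
have n3 : i b - i a != 0.
  rewrite subr_eq0 gt_eqF //; apply: i_incr; by rewrite bj ja.
rewrite /jump_rate !mxE !laplE -aE -bE g1 g2 !eqxx jb aj ab.
rewrite ![_ == j]eq_sym ![b == _]eq_sym [j == a]eq_sym jb aj ab.
by split; field; rewrite ?n1 ?n2 ?n3.
Qed.

End Rates.

(** * The semigroup near time zero *)

Lemma is_derive_quotient (R : realType) (f : R -> R) (df x : R) :
  is_derive x 1 f df -> h^-1 * (f (x + h) - f x) @[h --> 0^'+] --> df.
Proof.
move=> [d1 dv]; apply: cvg_dnbhs_at_right.
have -> : (fun h => h^-1 * (f (x + h) - f x)) =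
    (fun h => h^-1 *: ((f \o shift x) (h *: 1) - f x)).
  by apply/funext => h; rewrite /= /GRing.scale /= mulr1 [x + h]addrC.
by rewrite -dv; exact: d1.
Qed.

Section SemigroupAtZero.
Variables (R : realType) (n : nat) (Q : 'M[R]_n.+1).
Hypothesis gQ : generator Q.

Lemma semigroup_quotient j k :
  h^-1 * (semigroup Q h j k - (j == k)%:R) @[h --> 0^'+] --> Q j k.
Proof.
have := is_derive_quotient (is_derive_semigroup Q j k 0).
rewrite semigroup0 mulmx1 mxE.
by under eq_fun do rewrite add0r.
Qed.

Lemma semigroup_gt0 h j : 0 <= h -> 0 < semigroup Q h j j.
Proof.
move=> h0; apply: lt_le_trans (semigroup_ge j j gQ h0).
by rewrite eqxx mulr1 expR_gt0.
Qed.

(** Write the power as exp (N ln P_(v/N)(j,j)), with N + 1 for N: the exponent is v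
    times the difference quotient at 0 of h |-> ln P_h(j,j), whose derivative at 0 is
    Q_jj. *)
Lemma semigroup_holding j v : 0 <= v ->
  (semigroup Q (v / N.+1%:R) j j) ^+ N.+1 @[N --> \oo] --> expR (Q j j * v).
Proof.
rewrite le_eqVlt => /orP[/eqP <-|v0].
  under eq_fun do rewrite mul0r semigroup0 mxE eqxx expr1n.
  by rewrite mulr0 expR0; exact: cvg_cst.
pose g (h : R) := ln (semigroup Q h j j).
have dg : is_derive (0 : R) 1 g (Q j j).
  have P1 : semigroup Q 0 j j = 1 by rewrite semigroup0 mxE eqxx.
  have dP := is_derive_semigroup Q j j 0; rewrite semigroup0 mulmx1 in dP.
  have dl : is_derive (semigroup Q 0 j j) 1 (@ln R) 1.
    by rewrite P1 -[X in is_derive _ _ _ X]invr1; apply: is_derive1_ln.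
  by have := is_derive1_comp dl dP; rewrite mul1r.
have g0 : g 0 = 0 by rewrite /g semigroup0 mxE eqxx ln1.
have [gc _] := cvg_at_rightP (fun h => h^-1 * (g (0 + h) - g 0)) 0 (Q j j).
have {}gc := gc (is_derive_quotient dg).
have -> : (fun N => semigroup Q (v / N.+1%:R) j j ^+ N.+1) =
    (fun N => expR (v * ((v / N.+1%:R)^-1 * (g (0 + v / N.+1%:R) - g 0)))).
  apply/funext => N; rewrite add0r g0 subr0.
  have -> : v * ((v / N.+1%:R)^-1 * g (v / N.+1%:R)) = g (v / N.+1%:R) * N.+1%:R.
    by field; rewrite ?gt_eqF // pnatr_eq0.
  by rewrite expRM_natr lnK // posrE semigroup_gt0 // divr_ge0 // ltW.
rewrite [Q j j * v]mulrC; apply: continuous_cvg; first exact: continuous_expR.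
apply: cvgMr; apply: (gc (fun N => v / N.+1%:R)); split=> [N|]; first by rewrite divr_gt0.
rewrite -[X in _ --> X](mulr0 v); apply: cvgMr.
exact: cvg_harmonic.
Qed.

End SemigroupAtZero.

(** * Markov property, holding times and jumps *)

Section Verification.
Variables (R : realType) (m : nat) (i theta : 'I_m.+2 -> R) (e0 : R) (a : 'I_m.+1).
Local Notation S := 'I_m.+2.
Hypothesis i_incr : forall j k : S, (j < k)%N -> i j < i k.
Hypothesis aP : i (lo a) <= e0 < i (hi a).
Hypothesis theta_ge0 : forall j, 0 <= theta j.
Hypothesis theta_end : forall j, ~~ interior j -> theta j = 0.
Local Notation Q := (gen i theta).
Local Notation pi0 := (balayage i e0 a).
Context {d : measure_display} {T : measurableType d}.
Variables (P : probability T R) (Y : R -> T -> S).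
Local Notation pr := (pr P).
Hypothesis mY : forall s y, 0 <= s -> measurable [set r | Y s r = y].
Hypothesis Y_right_cont : forall r s, 0 <= s -> exists2 eps, 0 < eps &
  forall s', s <= s' < s + eps -> Y s' r = Y s r.
Hypothesis Y_law : forall s y, 0 <= s ->
  pr [set r | Y s r = y] = \sum_x pi0 x * semigroup Q s x y.
Hypothesis Y_markov : forall s u A j y, 0 <= s -> 0 <= u -> past Y s A ->
  measurable A /\
  pr (A `&` ([set r | Y s r = j] `&` [set r | Y (s + u) r = y])) =
    semigroup Q u j y * pr (A `&` [set r | Y s r = j]).
Variable X : R -> {RV P >-> R}.
Hypothesis XE : forall s r, X s r = if s <= 0 then e0 else i (Y s r).

Lemma i_inj : injective i.
Proof.
move=> j k ijk; apply: val_inj; apply/eqP; case: (ltngtP j k) => // /i_incr;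
  by rewrite ijk ltxx.
Qed.

Lemma X0 r : X 0 r = e0. Proof. by rewrite XE lexx. Qed.

Lemma X_gt0 s r : 0 < s -> X s r = i (Y s r).
Proof. by move=> s0; rewrite XE leNgt s0. Qed.

Lemma at_state0 x : at_state X 0 x = if x == e0 then setT else set0.
Proof.
apply/seteqP; split => r; rewrite /at_state /= X0; case: eqVneq => [->|xe] //= ex.
by rewrite ex eqxx in xe.
Qed.

Lemma at_state_gt0 s j : 0 < s -> at_state X s (i j) = [set r | Y s r = j].
Proof.
move=> s0; apply/seteqP; split => r; rewrite /at_state /= X_gt0 //; last by move=> ->.
exact: i_inj.
Qed.

Lemma cond_probE A B : cond_prob P A B = pr (A `&` B) / pr B.
Proof. by []. Qed.

Lemma state0 j : (0 < P (at_state X 0 (i j)))%E -> e0 = i j.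
Proof.
by rewrite at_state0; case: eqVneq => // _; rewrite measure0 ltxx.
Qed.

Lemma pr_state0 j : e0 = i j -> pr [set r | Y 0 r = j] = 1.
Proof.
move=> ej; rewrite Y_law // (bigD1 j) //= big1 => [|k kj].
  by rewrite semigroup0 mxE eqxx mulr1 addr0 (balayage_state i_incr aP).
by rewrite semigroup0 mxE (negbTE kj) mulr0.
Qed.

(** At time 0 the events X = i_j and Y = j may differ, since X is e0 on every path.
    Conditioning on the first is meaningful only if e0 = i_j, and then the second is
    almost sure too. *)
Lemma pr_at_state s j E : 0 <= s -> (0 < P (at_state X s (i j)))%E -> measurable E ->
  pr (E `&` at_state X s (i j)) = pr (E `&` [set r | Y s r = j]).
Proof.
rewrite le_eqVlt => /orP[/eqP <-|s0 _ _]; last by rewrite at_state_gt0.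
move=> /state0 ej mE; rewrite at_state0 -ej eqxx setIT pr_setI_full //; first exact: mY.
exact: pr_state0.
Qed.

Lemma measurable_at_state s j : 0 <= s -> measurable (at_state X s (i j)).
Proof.
rewrite le_eqVlt => /orP[/eqP <-|s0]; last by rewrite at_state_gt0 //; apply: mY; exact: ltW.
by rewrite at_state0; case: ifP.
Qed.

Lemma natural_filtration_past s A : 0 <= s -> natural_filtration X s A -> past Y s A.
Proof.
move=> s0; apply: (@smallest_sub _ _ _ (past Y s)); first exact: smallest_sigma_algebra.
move=> C [r /= /andP[r0 rs] [B mB <-]]; rewrite setTI.
have [r1|r1] := ltP 0 r; last first.
  have -> : r = 0 by apply/eqP; rewrite eq_le r1.
  case: (pselect (B e0)) => Be.
    rewrite (_ : _ @^-1` _ = setT); last by apply/seteqP; split => w //= _;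
      rewrite /preimage /mkset X0.
    by rewrite -setC0 -setTD; apply: sigma_algebraCD; exact: sigma_algebra0.
  rewrite (_ : _ @^-1` _ = set0); first exact: sigma_algebra0.
  by apply/seteqP; split => w //=; rewrite X0.
rewrite (_ : _ @^-1` _ = \bigcup_(y in [set y | B (i y)]) [set w | Y r w = y]); last first.
  apply/seteqP; split => w /=; rewrite X_gt0 //; first by move=> Bw; exists (Y r w).
  by move=> [y /= By yE]; rewrite yE.
set G := [set C : set T | exists v y, 0 <= v <= s /\ C = [set r | Y v r = y]].
apply: (@fin_bigcup_measurable _ (g_sigma_algebraType G)); first exact: finite_finset.
by move=> y _; apply: sub_sigma_algebra; exists r, y; rewrite r0 rs.
Qed.

Lemma natural_filtration_meas s A : 0 <= s -> natural_filtration X s A -> measurable A.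
Proof.
by move=> s0 /(natural_filtration_past s0) pA; have [] := Y_markov ord0 ord0 s0 (lexx 0) pA.
Qed.

Lemma X_markov s u A j k : 0 <= s -> 0 <= u -> natural_filtration X s A ->
  (0 < P (at_state X s (i j)))%E ->
  pr (at_state X (s + u) (i k) `&` (A `&` at_state X s (i j))) =
  semigroup Q u j k * pr (A `&` at_state X s (i j)).
Proof.
move=> s0 u0 FA Pj; have mA := natural_filtration_meas s0 FA.
have := u0; rewrite le_eqVlt => /orP[/eqP u_0|u_gt0].
  rewrite -u_0 addr0 semigroup0 mxE; have [->|jk] := eqVneq j k.
    by rewrite setICA setIid mul1r.
  rewrite mul0r (_ : _ `&` _ = set0) ?pr_set0 //; apply/seteqP; split => r //=.
  rewrite /at_state /= => -[-> [_ /i_inj kj]]; by rewrite kj eqxx in jk.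
have su0 : 0 < s + u by rewrite ltr_wpDl.
have mk : measurable [set r | Y (s + u) r = k] by apply: mY; exact: ltW.
rewrite (at_state_gt0 k su0) setIA [_ `&` A]setIC !pr_at_state //; last exact: measurableI.
have [_ <-] := Y_markov j k s0 u0 (natural_filtration_past s0 FA).
by congr pr; rewrite -setIA [X in _ `&` X]setIC.
Qed.

Lemma natural_filtrationT s : natural_filtration X s setT.
Proof. by rewrite -setC0 -setTD; apply: sigma_algebraCD; exact: sigma_algebra0. Qed.

Lemma pr_gt0 E : measurable E -> (0 < P E)%E -> 0 < pr E.
Proof. by move=> mE; rewrite prE // lte_fin. Qed.

Lemma cond_prob_step s u j k : 0 <= s -> 0 <= u ->
  (0 < P (at_state X s (i j)))%E ->
  cond_prob P (at_state X (s + u) (i k)) (at_state X s (i j)) = semigroup Q u j k.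
Proof.
move=> s0 u0 Pj; rewrite cond_probE.
have := X_markov k s0 u0 (@natural_filtrationT s) Pj; rewrite !setTI => ->.
by rewrite mulfK // lt0r_neq0 //; apply: pr_gt0 => //; exact: measurable_at_state.
Qed.

Lemma X_markov_property : markov_property X i.
Proof.
move=> s u s0 u0 A FA j k PA; have mA := natural_filtration_meas s0 FA.
have mj := measurable_at_state j s0.
have Pj : (0 < P (at_state X s (i j)))%E.
  by apply: lt_le_trans PA _; apply: le_measure; rewrite ?inE //; exact: measurableI.
rewrite cond_prob_step // cond_probE X_markov // mulfK // lt0r_neq0 //.
by apply: pr_gt0 => //; exact: measurableI.
Qed.

Lemma X_time_homogeneous : time_homogeneous X i.
Proof. by move=> s s' u s0 s'0 u0 j k Pj Pj'; rewrite !cond_prob_step. Qed.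

Lemma X_jump_rates : jump_rates X i (jump_rate i theta).
Proof.
have gQ := generator_gen i_incr theta_ge0.
move=> s s0 a' j b ja bj Pj.
have [<- <-] := gen_neighbours theta i_incr ja bj.
have lim k : j != k -> h^-1 * cond_prob P (at_state X (s + h) (i k)) (at_state X s (i j))
    @[h --> 0^'+] --> Q j k.
  move=> jk; have sq := @semigroup_quotient _ _ Q j k; apply: cvg_trans sq; apply: near_eq_cvg.
  near=> h; rewrite (negbTE jk) subr0 cond_prob_step //.
split; apply: lim; rewrite -val_eqE /= ?bj ?ja neq_ltn ?ltnSn ?orbT //.
Unshelve. all: by end_near. Qed.

Definition stays s v j : set T := [set r | forall u, 0 <= u <= v -> Y (s + u) r = j].
Definition stays_grid s h j N : set T := [set r | forall k, (k <= N)%N -> Y (s + h * k%:R) r = j].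

Lemma stays_gridS s h j N : stays_grid s h j N.+1 =
  stays_grid s h j N `&` [set r | Y (s + h * N.+1%:R) r = j].
Proof.
apply/seteqP; split => r /= => [g|[g gN] k].
  by split=> [k kN|]; apply: g => //; exact: leqW.
by rewrite leq_eqVlt => /orP[/eqP -> //|]; rewrite ltnS; apply: g.
Qed.

Lemma stays_grid_past s h j N : 0 <= s -> 0 <= h -> past Y (s + h * N%:R) (stays_grid s h j N).
Proof.
move=> s0 h0; set G := [set C : set T | exists v y, 0 <= v <= s + h * N%:R /\ C = [set r | Y v r = y]].
rewrite (_ : stays_grid s h j N = \bigcap_(k in [set k | (k <= N)%N]) [set r | Y (s + h * k%:R) r = j]) //.
apply: (@bigcap_measurableType _ (g_sigma_algebraType G)) => k /= kN.
apply: sub_sigma_algebra; exists (s + h * k%:R), j; split=> //.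
by rewrite addr_ge0 ?mulr_ge0 //= lerD2l ler_wpM2l // ler_nat.
Qed.

Lemma pr_stays_grid s h j N : 0 <= s -> 0 <= h ->
  pr (stays_grid s h j N) = semigroup Q h j j ^+ N * pr [set r | Y s r = j].
Proof.
move=> s0 h0; elim: N => [|N IH].
  rewrite expr0 mul1r; congr pr; apply/seteqP; split => r /= => [/(_ 0%N isT)|e k].
    by rewrite mulr0 addr0.
  by rewrite leqn0 => /eqP ->; rewrite mulr0 addr0.
have sN : 0 <= s + h * N%:R by rewrite addr_ge0 // mulr_ge0.
have [_] := Y_markov j j sN h0 (@stays_grid_past s h j N s0 h0).
have -> : s + h * N%:R + h = s + h * N.+1%:R by rewrite -natr1; ring.
have gE : stays_grid s h j N `&` [set r | Y (s + h * N%:R) r = j] = stays_grid s h j N.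
  by apply/seteqP; split => r /= => [[]//|g]; split=> //; exact: g.
by rewrite setIA gE -stays_gridS => ->; rewrite IH exprS mulrA.
Qed.

(** Right-continuity: a path that leaves j on [s, s + v] is away from j on an interval,
    which a fine enough grid with end point s + v meets. *)
Lemma stays_grid_near s v j r : 0 <= s -> 0 < v ->
  \forall N \near \oo, stays_grid s (v / N.+1%:R) j N.+1 r <-> stays s v j r.
Proof.
move=> s0 v0; case: (pselect (stays s v j r)) => [st|nst].
  apply: nearW => N; split=> // _ k kN; apply: st.
  rewrite mulr_ge0 ?divr_ge0 ?(ltW v0) //= mulrAC ler_pdivrMr // ler_pM2l // ler_nat //.
have [u [/andP[u0 uv] Yu]] : exists u, 0 <= u <= v /\ Y (s + u) r <> j.
  apply: contrapT => h; apply: nst => u uI; apply: contrapT => Yu; apply: h.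
  by exists u.
have [eps eps0 Yeps] := Y_right_cont r (addr_ge0 s0 u0).
have nE : \forall N \near \oo, v / N.+1%:R < eps.
  near=> N; rewrite ltr_pdivrMr // mulrC -ltr_pdivrMr //.
  apply: (@lt_le_trans _ _ N%:R); last by rewrite ler_nat.
  by near: N; exact: nbhs_infty_gtr.
apply: filterS nE => N NE; split=> // g; exfalso; apply: Yu.
set h := v / N.+1%:R in NE g *.
have h0 : 0 < h by rewrite divr_gt0.
(* the first grid point after u falls in the interval where the path still
   has the value that it takes at s + u *)
have ex : exists k, u <= h * k%:R by exists N.+1; rewrite /h divfK // pnatr_eq0.
case: (ex_minnP ex) => k uk kmin.
have kN : (k <= N.+1)%N by apply: kmin; rewrite /h divfK // pnatr_eq0.
rewrite -(g k kN) (Yeps (s + h * k%:R)) // lerD2l uk /= -addrA ltrD2l.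
case: k uk kmin {kN} => [|k] uk kmin; first by rewrite mulr0 ltr_wpDl.
rewrite -natr1 mulrDr mulr1 ltrD //.
by rewrite ltNge; apply/negP => /kmin; rewrite ltnn.
Unshelve. all: by end_near. Qed.

Lemma staysE s v j : 0 <= s -> 0 < v ->
  stays s v j = \bigcap_N stays_grid s (v / N.+1%:R) j N.+1.
Proof.
move=> s0 v0; apply/seteqP; split => r /=.
  move=> st N _ k kN; apply: st; rewrite mulr_ge0 ?divr_ge0 ?(ltW v0) //=.
  by rewrite mulrAC ler_pdivrMr // ler_pM2l // ler_nat.
move=> g; have [N _ /(_ N (leqnn N)) h] := stays_grid_near j r s0 v0.
by apply/h/g.
Qed.

Lemma measurable_stays_grid s h j N : 0 <= s -> 0 <= h -> measurable (stays_grid s h j N).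
Proof.
move=> s0 h0; have sN : 0 <= s + h * N%:R by rewrite addr_ge0 // mulr_ge0.
by have [] := Y_markov j j sN h0 (@stays_grid_past s h j N s0 h0).
Qed.

Lemma measurable_stays s v j : 0 <= s -> 0 < v -> measurable (stays s v j).
Proof.
move=> s0 v0; rewrite staysE //; apply: bigcapT_measurable => N.
by apply: measurable_stays_grid => //; rewrite divr_ge0 // ltW.
Qed.

(** Along a grid of mesh h the chain stays in j with probability P_h(j,j) per step. *)
Lemma pr_stays s v j : 0 <= s -> 0 < v ->
  pr (stays s v j) = expR (Q j j * v) * pr [set r | Y s r = j].
Proof.
move=> s0 v0; have gQ := generator_gen i_incr theta_ge0.
have c1 : pr (stays_grid s (v / N.+1%:R) j N.+1) @[N --> \oo] --> pr (stays s v j).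
  apply: (pr_ae_cvg (G := setT)) => //.
  - by move=> N; apply: measurable_stays_grid => //; rewrite divr_ge0 // ltW.
  - exact: measurable_stays.
  - exact: pr_setT.
  - by move=> r _; exact: stays_grid_near.
have c2 : pr (stays_grid s (v / N.+1%:R) j N.+1) @[N --> \oo] -->
    expR (Q j j * v) * pr [set r | Y s r = j].
  rewrite (funext (fun N => pr_stays_grid j N.+1 s0 (divr_ge0 (ltW v0) (ler0n R N.+1)))).
  by apply: cvgMl; exact: semigroup_holding (ltW v0).
exact: cvg_unique c1 c2.
Qed.

(** The two events concern X and Y, which may differ at time 0; right-continuity of Y at
    s = 0 extends what X says about later times. *)
Lemma X_stays_at s v j : 0 <= s -> 0 < v -> (0 < P (at_state X s (i j)))%E ->
  stays_at X s v (i j) = stays s v j.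
Proof.
move=> s0 v0 Pj; apply/seteqP; split => r /= h; last first.
  move=> u uI; have [u0 uv] := andP uI; have := addr_ge0 s0 u0.
  rewrite le_eqVlt => /orP[/eqP su|su]; last by rewrite X_gt0 // h.
  have s00 : s = 0 by lra.
  by rewrite -su X0; apply: state0; rewrite -s00.
have Ypos u : 0 < u -> u <= v -> Y (s + u) r = j.
  move=> u0 uv; apply: i_inj; rewrite -X_gt0 ?ltr_wpDl //; apply: h.
  by rewrite ltW.
move=> u /andP[]; rewrite le_eqVlt => /orP[/eqP <- _|]; last exact: Ypos.
rewrite addr0; have [eps eps0 he] := Y_right_cont r s0.
pose w := Num.min (eps / 2) v.
have w0 : 0 < w by rewrite lt_min v0 divr_gt0.
rewrite -(he (s + w)); first by apply: Ypos => //; rewrite ge_min lexx orbT.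
rewrite lerDl (ltW w0) /= ltrD2l gt_min; apply/orP; left; lra.
Qed.

Lemma X_holding_times : holding_times X i (jump_rate i theta).
Proof.
move=> s v s0; rewrite le_eqVlt => /orP[/eqP <-|v0] j Pj.
  have -> : stays_at X s 0 (i j) = at_state X s (i j).
    apply/seteqP; split => r /= h; first by have := h 0; rewrite lexx addr0; apply.
    by move=> u; rewrite -eq_le => /eqP <-; rewrite addr0.
  split; first exact: measurable_at_state.
  rewrite cond_probE setIid divff ?mulr0 ?oppr0 ?expR0 // lt0r_neq0 //.
  by apply: pr_gt0 => //; exact: measurable_at_state.
rewrite X_stays_at //; split; first exact: measurable_stays.
rewrite cond_probE pr_at_state //; last exact: measurable_stays.
have -> : stays s v j `&` [set r | Y s r = j] = stays s v j.
  apply/seteqP; split => r /= => [[]//|h]; split=> //.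
  by rewrite -[s]addr0; apply: h; rewrite lexx ltW.
have pE : pr (at_state X s (i j)) = pr [set r | Y s r = j].
  by have := pr_at_state s0 Pj measurableT; rewrite !setTI.
rewrite pr_stays // pE mulfK ?mulNr ?opprK // -pE lt0r_neq0 //.
by apply: pr_gt0 => //; exact: measurable_at_state.
Qed.

Lemma starts_right_atE j : starts_right_at X (i j) = [set r | Y 0 r = j].
Proof.
have lim r : X h r @[h --> 0^'+] --> i (Y 0 r).
  have [eps eps0 he] := Y_right_cont r (lexx 0).
  apply: cvg_near_cst; near=> h.
  have h0 : 0 < h by near: h; exact: nbhs_right_gt.
  rewrite X_gt0 // he // ltW //= add0r; near: h; exact: nbhs_right_lt.
apply/seteqP; split => r /= => [h|<-]; last exact: lim.
apply: i_inj; exact: cvg_unique (lim r) h.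
Unshelve. all: by end_near. Qed.

Lemma X_initial_jump : initial_jump X i e0.
Proof.
move=> a' b' ba /andP[ae eb]; have [al ah] := andP aP.
have a'E : a' = lo a.
  apply: val_inj; apply/eqP; rewrite eqn_leq; apply/andP; split.
    rewrite leqNgt; apply/negP => /= la; have : i (hi a) <= i a'.
      by apply: i_le => //; rewrite /= bump0.
    by move=> h; have := lt_trans ae ah; rewrite ltNge h.
  rewrite leqNgt; apply/negP => /= la; have : i b' <= i (lo a).
    by apply: i_le => //; rewrite ba.
  by move=> h; have := le_lt_trans al eb; rewrite ltNge h.
have b'E : b' = hi a by apply: val_inj; rewrite /= ba a'E bump0.
have P0 j : cond_prob P (starts_right_at X (i j)) (at_state X 0 e0) = pi0 j.
  rewrite cond_probE at_state0 eqxx setIT pr_setT divr1 starts_right_atE Y_law //.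
  rewrite (bigD1 j) //= big1 => [|k kj]; last by rewrite semigroup0 mxE (negbTE kj) mulr0.
  by rewrite semigroup0 mxE eqxx mulr1 addr0.
split; rewrite ?starts_right_atE; try exact: mY.
- by rewrite -starts_right_atE P0 a'E b'E /balayage eqxx.
- by rewrite -starts_right_atE P0 a'E b'E /balayage (negbTE (lo_neq_hi a)) eqxx.
Qed.

End Verification.

(** * The martingale property and the theorem *)

Section FiniteValued.
Context {d : measure_display} {T : measurableType d} {R : realType}.
Variables (P : probability T R) (S : finType) (g : T -> S).
Hypothesis mg : forall y, measurable [set r | g r = y].

Lemma measurable_finite_valued (f : S -> R) : measurable_fun setT (f \o g).
Proof.
move=> _ B mB; rewrite setTI.
have -> : (f \o g) @^-1` B = \bigcup_(y in [set y | B (f y)]) [set r | g r = y].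
  apply/seteqP; split => r /=; first by move=> Br; exists (g r).
  by move=> [y /= By gy]; rewrite gy.
by apply: fin_bigcup_measurable => //; exact: finite_finset.
Qed.

Lemma integrable_finite_valued (f : S -> R) A : measurable A ->
  P.-integrable A (EFin \o (f \o g)).
Proof.
move=> mA; apply: measurable_bounded_integrable => //.
- by rewrite ltey_eq fin_num_measure.
- exact/measurable_funTS/measurable_finite_valued.
exists (\sum_y `|f y|); split; first exact: num_real.
move=> M hM r _ /=; apply: le_trans (ltW hM).
by rewrite (bigD1 (g r)) //= lerDl; apply: sumr_ge0.
Qed.

Lemma integral_finite_valued (f : S -> R) A : measurable A ->
  (\int[P]_(r in A) (f (g r))%:E)%E = (\sum_y f y * pr P (A `&` [set r | g r = y]))%:E.
Proof.
move=> mA.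
have indE y r : \1_[set r | g r = y] r = (g r == y)%:R :> R.
  by rewrite indicE; congr (nat_of_bool _)%:R; apply/idP/eqP; rewrite inE.
pose F y z := f y * (z == y)%:R.
rewrite (eq_integral (fun r => \sum_y (F y (g r))%:E)%E); last first.
  move=> r _; rewrite sumEFin; congr EFin.
  rewrite (bigD1 (g r)) //= /F eqxx mulr1 big1 ?addr0 // => y.
  by rewrite eq_sym => /negbTE ->; rewrite mulr0.
rewrite integral_sum //; last by move=> y; exact: integrable_finite_valued (F y) A mA.
rewrite -sumEFin; apply: eq_bigr => y _.
have -> : (\int[P]_(r in A) (F y (g r))%:E =
    \int[P]_(r in A) ((f y)%:E * (\1_[set r | g r = y] r)%:E))%E.
  by apply: eq_integral => r _; rewrite indE.
rewrite integralZl //; last first.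
  have := integrable_finite_valued (fun z => (z == y)%:R) mA.
  by congr (P.-integrable A _); apply/funext => r /=; rewrite indE.
rewrite integral_indic // EFinM setIC; congr (_ * _)%E.
have : P (A `&` [set r | g r = y]) = (pr P (A `&` [set r | g r = y]))%:E.
  by apply: prE; exact: measurableI.
by [].
Qed.

End FiniteValued.

Section Martingale.
Variables (R : realType) (m : nat) (i theta : 'I_m.+2 -> R) (e0 : R) (a : 'I_m.+1).
Local Notation S := 'I_m.+2.
Hypothesis i_incr : forall j k : S, (j < k)%N -> i j < i k.
Hypothesis aP : i (lo a) <= e0 < i (hi a).
Hypothesis theta_ge0 : forall j, 0 <= theta j.
Hypothesis theta_end : forall j, ~~ interior j -> theta j = 0.
Local Notation Q := (gen i theta).
Local Notation pi0 := (balayage i e0 a).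
Context {d : measure_display} {T : measurableType d}.
Variables (P : probability T R) (Y : R -> T -> S).
Local Notation pr := (pr P).
Hypothesis mY : forall s y, 0 <= s -> measurable [set r | Y s r = y].
Hypothesis Y_law : forall s y, 0 <= s ->
  pr [set r | Y s r = y] = \sum_x pi0 x * semigroup Q s x y.
Hypothesis Y_markov : forall s u A j y, 0 <= s -> 0 <= u -> past Y s A ->
  measurable A /\
  pr (A `&` ([set r | Y s r = j] `&` [set r | Y (s + u) r = y])) =
    semigroup Q u j y * pr (A `&` [set r | Y s r = j]).
Variable X : R -> {RV P >-> R}.
Hypothesis XE : forall s r, X s r = if s <= 0 then e0 else i (Y s r).

Definition value (s : R) (y : S) : R := if s <= 0 then e0 else i y.

Lemma X_value s : X s = (value s \o Y s) :> (T -> R).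
Proof. by apply/funext => r; rewrite XE. Qed.

Lemma integral_X s A : 0 <= s -> measurable A ->
  (\int[P]_(r in A) (X s r)%:E)%E =
  (\sum_y value s y * pr (A `&` [set r | Y s r = y]))%:E.
Proof.
move=> s0 mA; rewrite -(integral_finite_valued P (fun y => mY y s0) (value s) mA).
by apply: eq_integral => r _; rewrite XE.
Qed.

(** X is deterministic at time 0. *)
Lemma natural_filtration0 A : natural_filtration X 0 A -> A = set0 \/ A = setT.
Proof.
apply: (@smallest_sub _ _ _ [set A | A = set0 \/ A = setT]).
  split=> [|B [->|->]|F FE]; [by left|by right; rewrite setTD setC0|by left; rewrite setTD setCT|].
  case: (pselect (exists k, F k = setT)) => [[k Fk]|nF].
    by right; apply/seteqP; split=> // r _; exists k => //; rewrite Fk.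
  left; apply/seteqP; split=> // r [k _]; case: (FE k) => [->//|Fk]; exfalso.
  by apply: nF; exists k.
move=> C [r /= r0 [B mB <-]]; have -> : r = 0 by apply/eqP; rewrite eq_le andbC.
rewrite setTI; case: (pselect (B e0)) => Be; [right|left];
  by apply/seteqP; split => w //=; rewrite /preimage /mkset XE lexx.
Qed.

(** After a positive time s, the conditional mean of X_u is sum_y P_(u-s)(j,y) i_y =
    i_j. From time 0 the initial jump enters too, but there the past is trivial and it
    suffices that the law at time u has mean e0. *)
Lemma X_martingale : martingale X.
Proof.
split=> [s s0|s u s0 su A FA].
  by rewrite X_value; apply: integrable_finite_valued => // y; exact: mY.
have u0 := le_trans s0 su.
have mA := natural_filtration_meas Y_markov XE s0 FA.
move: su; rewrite le_eqVlt => /orP[/eqP -> //|su].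
have u_gt0 := le_lt_trans s0 su.
rewrite !integral_X //; congr EFin.
rewrite {1}/value leNgt u_gt0 /=.
move: s0; rewrite le_eqVlt => /orP[/eqP s_0|s_gt0].
  have FA0 : natural_filtration X 0 A by rewrite s_0.
  rewrite -s_0 /value lexx.
  case: (natural_filtration0 FA0) => ->.
    by rewrite !big1 // => y _; rewrite set0I pr_set0 mulr0.
  rewrite -mulr_sumr -(pr_split P measurableT (fun y => mY y (lexx 0))) pr_setT mulr1.
  under eq_bigr do rewrite setTI Y_law // mulrC.
  by rewrite [LHS](law_mean i_incr pi0 theta_end) (balayage_mean e0 i_incr).
have us0 : 0 <= u - s by rewrite subr_ge0 ltW.
have uE : s + (u - s) = u by rewrite subrKC.
rewrite /value leNgt s_gt0 /=.
have pE y : pr (A `&` [set r | Y u r = y]) =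
    \sum_j semigroup Q (u - s) j y * pr (A `&` [set r | Y s r = j]).
  have mAy : measurable (A `&` [set r | Y u r = y]) by apply: measurableI => //; exact: mY.
  rewrite (pr_split P mAy (fun j => mY j (ltW s_gt0))); apply: eq_bigr => j _.
  have [_ <-] := Y_markov j y (ltW s_gt0) us0
    (natural_filtration_past XE (ltW s_gt0) FA).
  by rewrite uE -setIA [X in _ `&` X]setIC.
under eq_bigr do rewrite pE mulr_sumr.
rewrite exchange_big /=; apply: eq_bigr => j _.
rewrite -[in RHS](semigroup_mean i_incr theta_end (u - s) j) mulr_suml.
by apply: eq_bigr => y _; ring.
Qed.

Lemma X_state_space : has_state_space X i.
Proof. by move=> s s0 r; exists (Y s r); rewrite XE leNgt s0. Qed.

End Martingale.

Theorem theorem2p8 (R : realType) (M : nat) (hM : (2 <= M)%N)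
    (i : 'I_M -> R) (i_incr : forall j k : 'I_M, (j < k)%N -> i j < i k)
    (p : 'I_M -> R) (p_gt0 : forall j, 0 < p j) (p_sum1 : \sum_j p j = 1)
    (e0 : R) (e0E : e0 = \sum_j i j * p j)
    (t : R) (t_gt0 : 0 < t) :
  exists (d : measure_display) (T : measurableType d) (P : probability T R)
         (X : R -> {RV P >-> R}),
    CMRW X i e0 /\
    (forall j : 'I_M, cond_prob P (at_state X t (i j)) (at_state X 0 e0) = p j).
Proof.
case: M hM i i_incr p p_gt0 p_sum1 e0E => [|[|m]] // _ i i_incr p p_gt0 p_sum1 e0E.
have [a aP] := bracket i_incr p_gt0 p_sum1 e0E.
have mean_eq : \sum_j balayage i e0 a j * i j = \sum_j p j * i j.
  rewrite (balayage_mean e0 i_incr) e0E; apply: eq_bigr => j _; exact: mulrC.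
have [theta [theta_ge0 theta_end law_p]] := exists_rates i_incr
  (balayage_ge0 i_incr aP) (balayage_sum1 e0 i_incr a) p_gt0 p_sum1 mean_eq
  (balayage_call i_incr p_gt0 p_sum1 e0E a) t_gt0.
have [d [T [P [Y [mY Y_right_cont Y_law Y_markov]]]]] :=
  jump_process (generator_gen i_incr theta_ge0) (balayage_ge0 i_incr aP)
    (balayage_sum1 e0 i_incr a).
have /choice[X XE] : forall s, exists X : {RV P >-> R},
    forall r, X r = if s <= 0 then e0 else i (Y s r).
  move=> s; apply: random_variable_of; case: leP => s0; first exact: measurable_cst.
  by apply: (measurable_finite_valued (g := Y s)) => y; apply: mY; exact: ltW.
exists d, T, P, X; split; last first.
  move=> j; rewrite cond_probE (at_state0 XE) eqxx setIT pr_setT divr1.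
  by rewrite (at_state_gt0 i_incr XE) // Y_law ?(ltW t_gt0) //; exact: law_p.
split.
- by rewrite (at_state0 XE) eqxx probability_setT.
- exact: X_state_space XE.
- exact: (X_martingale i_incr theta_end mY Y_law Y_markov XE).
- split; first exact: (X_markov_property i_incr aP mY Y_law Y_markov XE).
  exact: (X_time_homogeneous i_incr aP mY Y_law Y_markov XE).
exists (jump_rate i theta); split.
- exact: jump_rate_vector.
- exact: (X_holding_times i_incr aP theta_ge0 mY Y_right_cont Y_law Y_markov XE).
- exact: (X_jump_rates i_incr aP theta_ge0 mY Y_law Y_markov XE).
- exact: (X_initial_jump i_incr aP mY Y_right_cont Y_law XE).
Qed.
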